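(* Consider the BBM equation, i.e. $d=1$ and $-\omega(n)=\varphi(n)=n/(1+n^2)$. Let $\lambda_k=\frac1{\sqrt{1+k^2}}$ for $k\in\mathbb Z\setminus\{0\}$, and let $g_n=\frac1{\sqrt2}(h_n+il_n)$, $n\ge1$, where $h_n,l_n\in\mathcal N(0,1)$ are independent real standard Gaussians and the $g_n$ are independent; set $g_{-n}=\overline{g_n}$. Let $G_n(\lambda,t)$ and $R(\varepsilon;t,m,n)$ be the quantities defined in the context. Then $$G_n(\lambda,t)=R(\varepsilon;t,m,n)=0$$ for all $m,n\in\mathbb Z\setminus\{0\}$, all $t\in\mathbb R$ and all $\varepsilon>0$.
   Context: Let $L,J$ be the Fourier multipliers on $\mathbb T$ given by $\widehat{Lu}(n)=-i\omega(n)\hat u(n)$, $\widehat{Ju}(n)=i\varphi(n)\hat u(n)$. Let $u_0(x)=\sum_{n\in\mathbb Z\setminus\{0\}}g_n\lambda_ne^{inx}$ and let $u(\varepsilon;t,x)=\sum_{n\in\mathbb Z\setminus\{0\}}u_n(\varepsilon;t)e^{inx}$ be the (global) solution of $(\partial_t+L)u+\varepsilon J(u^2)=0$, $u|_{t=0}=u_0$. (The BBM equation is globally well-posed on real zero-mean functions in $H^s(\mathbb T)$, $s\ge0$, and $u_0\in H^s$ almost surely for $s<1/2$.) Put $\Delta_n^{k,l}=\omega(k)+\omega(l)-\omega(n)$, $F_n^{k,l}(t)=\int_0^te^{i\Delta_n^{k,l}\tau}d\tau$, $\delta_n^m=1$ if $m=n$ and $0$ otherwise, $E$ = expectation. $G_n(\lambda,t)$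 is defined by $G_n(\lambda,0)=0$ and $$\partial_tG_n(\lambda,t)=4\varphi(n)\sum_{k+l=n}\mathrm{Re}\big(-F_n^{k,l}(-t)\big)\Big(\varphi(n)|\lambda_k|^2|\lambda_l|^2-\varphi(k)|\lambda_n|^2|\lambda_l|^2-\varphi(l)|\lambda_n|^2|\lambda_k|^2\Big)$$ $$+\big(E(|g_n|^4)-2\big)\Big(2\delta_n^{2q}\mathrm{Re}\big(-F_n^{q,q}(-t)\big)\varphi^2(n)|\lambda_q|^4-4\mathrm{Re}\big(-F_n^{2n,-n}(-t)\big)\varphi(2n)\varphi(n)|\lambda_n|^4\Big),$$ where the sum is over $k,l\in\mathbb Z\setminus\{0\}$ with $k+l=n$ and the $\delta_n^{2q}$ term is present only if $n=2q$ for some integer $q$. $R$ is defined by $$E\big(\overline{u_m(\varepsilon;t)}u_n(\varepsilon;t)\big)=\delta_n^m|\lambda_n|^2+\delta_n^m\varepsilon^2G_n(\lambda,t)+\varepsilon^3R(\varepsilon;t,m,n).$$ *)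

(* Defs.v *)
From HB Require Import structures.
From mathcomp Require Export all_boot all_order all_algebra.
From mathcomp Require Export all_classical all_reals all_analysis.
From mathcomp.real_closed Require Export complex.

Set Implicit Arguments.
Unset Strict Implicit.
Unset Printing Implicit Defensive.

Import Order.TTheory GRing.Theory Num.Theory.
Import numFieldNormedType.Exports.

Local Open Scope classical_set_scope.
Local Open Scope ring_scope.

Definition cexpi {R : realType} (x : R) : R[i] := Complex (cos x) (sin x).

Definition cintegral {d : measure_display} {T : measurableType d}
    {R : realType} (mu : {measure set T -> \bar R}) (D : set T)
    (f : T -> R[i]) : R[i] :=
  Complex (\int[mu]_(x in D) complex.Re (f x))
          (\int[mu]_(x in D) complex.Im (f x)).

(* The oriented integral from [a] to [b]: both signs of [b - a] occur below. *)
Definition ointegral {R : realType} (a b : R) (f : R -> R[i]) : R[i] :=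
  if a <= b then cintegral lebesgue_measure `[a, b] f
  else - cintegral lebesgue_measure `[b, a] f.

Definition is_cderive {R : realType} (t : R) (f : R -> R[i]) (l : R[i]) : Prop :=
  is_derive t 1 (fun s => complex.Re (f s)) (complex.Re l) /\
  is_derive t 1 (fun s => complex.Im (f s)) (complex.Im l).

(* The integers [k] with [0 < |k| <= N]; sums over Z \ {0} are limits of sums
   over these ranges. *)
Definition nzints (N : nat) : seq int :=
  [seq k%:Z | k <- iota 1 N] ++ [seq - k%:Z | k <- iota 1 N].

(** Functions on the circle R / 2 pi Z, given on a fundamental domain. *)

Definition circle {R : realType} : set R := `[0, 2 * pi].

Definition fourier_coef {R : realType} (f : R -> R) (n : int) : R[i] :=
  ((2 * pi)^-1)%:C%C *
  cintegral lebesgue_measure circle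
    (fun x => (f x)%:C%C * cexpi (- (n%:~R * x))).

Definition square_integrable {R : realType} (f : R -> R) : Prop :=
  measurable_fun circle f /\
  lebesgue_measure.-integrable circle (fun x => (f x ^+ 2)%:E).

(* [f(x) = \sum_(n in Z \ {0}) c_n e^{inx}], with convergence in L^2. *)
Definition is_fourier_series {R : realType} (f : R -> R) (c : int -> R[i]) :
    Prop :=
  (fun N : nat => \int[lebesgue_measure]_(x in circle)
     Normc.normc ((f x)%:C%C - \sum_(n <- nzints N) c n * cexpi (n%:~R * x)) ^+ 2)
  @ \oo --> (0 : R).

(* The multipliers [L] and [J], acting on Fourier coefficients. *)
Definition Lmult {R : realType} (omega : int -> R) (c : int -> R[i]) (n : int) :
    R[i] := - 'i%C * (omega n)%:C%C * c n.

Definition Jmult {R : realType} (phi : int -> R) (c : int -> R[i]) (n : int) :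
    R[i] := 'i%C * (phi n)%:C%C * c n.

(* [u t x] is a real, zero-mean solution in C(R; L^2) of
   [(d/dt + L) u + eps J(u^2) = 0] with datum [\sum_(n != 0) a_n e^{inx}];
   the equation is tested against every [e^{inx}].  Since [u t] is only square
   integrable, [u t ^+ 2] is an L^1 function.  The series expansion of [u t]
   runs over [n != 0], which is where the zero mean is imposed. *)
Definition is_global_solution {R : realType} (omega phi : int -> R) (eps : R)
    (a : int -> R[i]) (u : R -> R -> R) : Prop :=
  [/\ forall t, square_integrable (u t) /\
        is_fourier_series (u t) (fourier_coef (u t)),
      forall t0, (fun t => \int[lebesgue_measure]_(x in circle)
                    (u t x - u t0 x) ^+ 2) @ t0 --> (0 : R),
      forall t n, is_cderive t (fun s => fourier_coef (u s) n)
        (- (Lmult omega (fourier_coef (u t)) n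
            + eps%:C%C * Jmult phi (fourier_coef (fun x => u t x ^+ 2)) n)) &
      is_fourier_series (u 0) a].

Definition mutually_independent {d : measure_display} {T : measurableType d}
    {R : realType} (P : probability T R) {I : choiceType} (D : set I)
    (X : I -> {RV P >-> R}) : Prop :=
  forall s : seq I, uniq s -> (forall i, i \in s -> D i) ->
  forall A : I -> set R, (forall i, measurable (A i)) ->
  P (\bigcap_(i in [set` s]) (X i @^-1` A i)) =
  (\prod_(i <- s) P (X i @^-1` A i))%E.

Definition standard_gaussian {d : measure_display} {T : measurableType d}
    {R : realType} (P : probability T R) (X : {RV P >-> R}) : Prop :=
  forall A : set R, measurable A -> distribution P X A = normal_prob 0 1 A.

(* The value at [n = 0] is never used. *)
Definition gaussian_coef {d : measure_display} {T : measurableType d}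
    {R : realType} (P : probability T R) (h l : nat -> {RV P >-> R})
    (n : int) (w : T) : R[i] :=
  let g k := ((Num.sqrt 2)^-1)%:C%C * Complex (h k w) (l k w) in
  match n with
  | Posz k => g k
  | Negz k => ((g k.+1)^*)%C
  end.

Definition complex_random_variable {d : measure_display} {T : measurableType d}
    {R : realType} (Z : T -> R[i]) : Prop :=
  measurable_fun [set: T] (fun w => complex.Re (Z w)) /\
  measurable_fun [set: T] (fun w => complex.Im (Z w)).

Definition cexpectation {d : measure_display} {T : measurableType d}
    {R : realType} (P : probability T R) (Z : T -> R[i]) : R[i] :=
  Complex (fine ('E_P[fun w => complex.Re (Z w)])%E)
          (fine ('E_P[fun w => complex.Im (Z w)])%E).

Definition fourth_moment {d : measure_display} {T : measurableType d}
    {R : realType} (P : probability T R) (Z : T -> R[i]) : R :=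
  fine ('E_P[(fun w => Normc.normc (Z w) ^+ 4)%R])%E.

Definition Delta {R : realType} (omega : int -> R) (n k l : int) : R :=
  omega k + omega l - omega n.

Definition Fint {R : realType} (omega : int -> R) (n k l : int) (t : R) :
    R[i] :=
  ointegral 0 t (fun tau => cexpi (Delta omega n k l * tau)).

Definition ReNF {R : realType} (omega : int -> R) (n k l : int) (t : R) : R :=
  complex.Re (- Fint omega n k l (- t)).

(* The right-hand side of the equation for [d/dt G_n]; [M4 n] is E|g_n|^4. *)
Definition G_rhs {R : realType} (omega phi lambda M4 : int -> R) (n : int)
    (t : R) : R :=
  4 * phi n *
  limn (fun N : nat => \sum_(k <- nzints N | n - k != 0)
    let l := n - k in
    ReNF omega n k l t *
    (phi n * `|lambda k| ^+ 2 * `|lambda l| ^+ 2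
     - phi k * `|lambda n| ^+ 2 * `|lambda l| ^+ 2
     - phi l * `|lambda n| ^+ 2 * `|lambda k| ^+ 2))
  + (M4 n - 2) *
    ((if (2 %| n)%Z then
        let q := (n %/ 2)%Z in
        2 * ReNF omega n q q t * phi n ^+ 2 * `|lambda q| ^+ 4
      else 0)
     - 4 * ReNF omega n (2 * n) (- n) t * phi (2 * n) * phi n
         * `|lambda n| ^+ 4).

Definition is_G {R : realType} (omega phi lambda M4 : int -> R)
    (G : int -> R -> R) : Prop :=
  forall n : int, n != 0 ->
    G n 0 = 0 /\ forall t : R, is_derive t 1 (G n) (G_rhs omega phi lambda M4 n t).

(* [R(eps; t, m, n)], solved from its defining expansion; [un k] is the random
   variable [u_k(eps; t)]. *)
Definition remainder {d : measure_display} {T : measurableType d}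
    {R : realType} (P : probability T R) (lambda : int -> R) (G : int -> R -> R)
    (eps t : R) (un : int -> T -> R[i]) (m n : int) : R[i] :=
  (cexpectation P (fun w => ((un m w)^*)%C * un n w)
   - ((m == n)%:R * `|lambda n| ^+ 2)%:C%C
   - ((m == n)%:R * eps ^+ 2 * G n t)%:C%C) / (eps ^+ 3)%:C%C.

Definition bbm_phi {R : realType} (n : int) : R := n%:~R / (1 + n%:~R ^+ 2).

Definition bbm_omega {R : realType} (n : int) : R := - bbm_phi n.

Definition bbm_lambda {R : realType} (k : int) : R :=
  (Num.sqrt (1 + k%:~R ^+ 2))^-1.

(* Main.v *)
From HB Require Import structures.
Require Import Defs.
From mathcomp Require Import measurable_realfun normal_distribution random_variable.
From mathcomp Require Import ring lra zify.

(** The coefficients of the BBM equation satisfy [phi n = n * lambda_n ^ 2],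
    and [lambda_n ^ -2 = 1 + n ^ 2] is the weight of its conserved energy, the
    square of the H^1 norm.  The random datum is the Gaussian measure attached
    to this energy, and it is invariant under the flow, which is divergence
    free.  Hence [E (conj (u_m) u_n)] keeps its initial value
    [delta_n^m lambda_n ^ 2] at all times (solution_covariance).  On the other
    hand [G_n = 0], because in each term of its right-hand side the bracket is
    a multiple of [n - k - l = 0], and because [E |g_n| ^ 4 = 2] (G_rhs_bbm,
    fourth_moment_datum).  So the remainder vanishes too.

    Invariance is proved for the solution that is given, by a splitting scheme
    that preserves the Gaussian measure exactly.  In the coordinates
    [u_n = lambda_n (x_n + i y_n) / sqrt 2], the datum is a family of
    independent standard Gaussians, and the equation truncated to the
    frequencies [|n| <= N] is a sum of vector fields of a very simple kind: each
    rotates the plane of two coordinates, at a speed that is constant or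
    proportional to a third coordinate; when a mode interacts with itself, this
    holds after a fixed rotation of its plane (splits_truncated).  A rotation
    by an angle that depends only on an independent variable preserves the law of the
    family (gauss_family_rot), and it preserves the Euclidean norm.  Performing
    these rotations in turn, for a short time each, therefore gives a
    first-order integrator whose state has the law of the datum after any number
    of steps.

    It remains to see that this scheme converges almost surely to the solution
    when [N] and the number [J N] of time steps tend to infinity.  Errors are
    measured by the least [E] such that the mode [n] is wrong by at most
    [E * phi n].  As [phi] is square summable, such an error changes the
    coefficients of [u ^ 2] by a multiple of [E] when [u] is bounded in L^2, and
    the multiplier [phi n] of the equation restores the weight
    (bbm_field_diff); so a Gronwall argument closes (splitting_error).  The
    local error of the scheme grows with [N], and is defeated by the choice of
    [J N]; the truncation error is the tail of the coefficients of [u ^ 2], which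
    is small uniformly on bounded time intervals by Dini's theorem
    (tail_uniform).  All approximations have the same law, so the second moments
    pass to the limit (gauss_family_limit_cov). *)

Set Implicit Arguments.
Unset Strict Implicit.
Unset Printing Implicit Defensive.

Import Order.TTheory GRing.Theory Num.Theory.
Import numFieldNormedType.Exports.

Local Open Scope classical_set_scope.
Local Open Scope ring_scope.

(** * Rotations of the plane preserve Lebesgue measure *)

Section rotation.
Context {R : realType}.
Local Notation leb := (@lebesgue_measure R).
Local Notation leb2 := (leb \x leb)%E.

Lemma lebesgue_measure_shift (a : R) (A : set R) : measurable A ->
  pushforward leb ((fun x => x + a) : _ -> measurableTypeR R) A = leb A.
Proof.
move=> mA; apply/esym/lebesgue_measure_unique => //=.
  exact: measurable_funD.
move=> mf _ [[b c]] _ <-; rewrite /pushforward.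
have -> : ((fun x => x + a) @^-1` `]b, c]%classic) = `]b - a, c - a]%classic.
  by apply/seteqP; split => x /=; rewrite !in_itv/= ltrBlDr lerBrDr.
rewrite !lebesgue_measure_itv/= !lte_fin ltrD2r.
by case: ifP => // _; rewrite -!EFinD; congr EFin; ring.
Qed.

Lemma ge0_integral_shift (a : R) (f : R -> \bar R) :
  measurable_fun setT f -> (forall x, 0 <= f x)%E ->
  (\int[leb]_x f (x + a)%R = \int[leb]_x f x)%E.
Proof.
move=> mf f0.
have mD : measurable_fun setT ((fun x : measurableTypeR R => x + a) : _ -> measurableTypeR R).
  exact: measurable_funD.
transitivity (\int[pushforward leb ((fun x => x + a)%R : _ -> measurableTypeR R)]_y f y)%E.
  by rewrite ge0_integral_pushforward//.
apply: eq_measure_integral => //= A mA _; exact: lebesgue_measure_shift.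
Qed.

(** A shear translates every horizontal line, so Tonelli reduces the claim to
    the translation invariance of the line. *)
Lemma ge0_integral_shearl (a : R) (H : R * R -> \bar R) :
  measurable_fun setT H -> (forall z, 0 <= H z)%E ->
  (\int[leb2]_z H (z.1 + a * z.2, z.2)%R = \int[leb2]_z H z)%E.
Proof.
move=> mH H0.
have mK : measurable_fun setT (fun z : R * R => H (z.1 + a * z.2, z.2)).
  apply: measurableT_comp => //; apply: measurable_fun_pair => //=.
  by apply: measurable_funD => //; apply: measurable_funM.
apply: (etrans (fubini_tonelli2 (m1 := leb) (m2 := leb) _ mK (fun z => H0 _))).
apply: (etrans _ (esym (fubini_tonelli2 (m1 := leb) (m2 := leb) _ mH H0))).
apply: eq_integral => y _; rewrite /fubini_G/=.
apply: (ge0_integral_shift (a * y) (f := fun x => H (x, y))) => //.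
exact: measurableT_comp.
Qed.

Lemma ge0_integral_shearr (a : R) (H : R * R -> \bar R) :
  measurable_fun setT H -> (forall z, 0 <= H z)%E ->
  (\int[leb2]_z H (z.1, z.2 + a * z.1)%R = \int[leb2]_z H z)%E.
Proof.
move=> mH H0.
have mK : measurable_fun setT (fun z : R * R => H (z.1, z.2 + a * z.1)).
  apply: measurableT_comp => //; apply: measurable_fun_pair => //=.
  by apply: measurable_funD => //; apply: measurable_funM.
apply: (etrans (fubini_tonelli1 (m1 := leb) (m2 := leb) _ mK (fun z => H0 _))).
apply: (etrans _ (esym (fubini_tonelli1 (m1 := leb) (m2 := leb) _ mH H0))).
apply: eq_integral => x _; rewrite /fubini_F/=.
apply: (ge0_integral_shift (a * x) (f := fun y => H (x, y))) => //.
exact: measurableT_comp.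
Qed.

Definition rot2 (c s : R) (z : R * R) : R * R :=
  (c * z.1 - s * z.2, s * z.1 + c * z.2).

Lemma measurable_rot2 c s : measurable_fun setT (rot2 c s).
Proof.
apply: measurable_fun_pair => /=.
  by apply: measurable_funB; apply: measurable_funM.
by apply: measurable_funD; apply: measurable_funM.
Qed.

(** The rotation of angle t is the product of three shears, of slopes - tan (t
    / 2), sin t and - tan (t / 2), and shears preserve area. *)
Lemma ge0_integral_rot2 (c s : R) (H : R * R -> \bar R) :
  c ^+ 2 + s ^+ 2 = 1 ->
  measurable_fun setT H -> (forall z, 0 <= H z)%E ->
  (\int[leb2]_z H (rot2 c s z) = \int[leb2]_z H z)%E.
Proof.
move=> cs1 mH H0.
(* the half turn, where a tangent blows up, is two quarter turns *)
wlog c1 : c s H cs1 mH H0 / 1 + c != 0.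
  move=> hw; have [c0|] := eqVneq (1 + c) 0; last exact: hw.
  have cE : c = -1 by lra.
  have s0 : s = 0.
    apply/eqP; rewrite -sqrf_eq0; apply/eqP.
    by move: cs1; rewrite cE expr2 mulrNN mulr1 => ?; lra.
  have E z : rot2 c s z = rot2 0 1 (rot2 0 1 z).
    by rewrite /rot2 s0 cE /=; congr pair; ring.
  under eq_integral do rewrite E.
  have e01 : (0 : R) ^+ 2 + 1 ^+ 2 = 1 by ring.
  have n1 : (1 + 0 : R) != 0 by rewrite addr0 oner_eq0.
  rewrite (hw 0 1 (fun z => H (rot2 0 1 z)))//; first exact: hw.
  by apply: measurableT_comp => //; exact: measurable_rot2.
(* the slope - tan (t / 2), with c = cos t and s = sin t *)
pose a := - s / (1 + c).
have E z : rot2 c s z =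
   let z1 := (z.1 + a * z.2, z.2) in let z2 := (z1.1, z1.2 + s * z1.1) in
   (z2.1 + a * z2.2, z2.2).
  rewrite /rot2 /a /=.
  have es : s ^+ 2 = (1 - c) * (1 + c) by move: cs1 => /(canRL (addKr _)) ->; ring.
  set b := - s / _.
  have e2 : b * (1 + c) = - s by rewrite /b divfK.
  have e1 : 1 + b * s = c.
    apply: (mulIf c1); transitivity (1 + c + s * (b * (1 + c))); first by ring.
    by rewrite e2 mulrN -expr2 es; ring.
  congr pair.
    transitivity ((1 + b * s) * z.1 + b * (1 + (1 + b * s)) * z.2); last by ring.
    by rewrite e1 e2; ring.
  by rewrite -{1}e1; ring.
under eq_integral do rewrite E.
have mSl : measurable_fun setT (fun z : R * R => H (z.1 + a * z.2, z.2)).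
  apply: measurableT_comp => //; apply: measurable_fun_pair => //=.
  by apply: measurable_funD => //; apply: measurable_funM.
rewrite /= (ge0_integral_shearl a (H := fun z => let z2 := (z.1, z.2 + s * z.1) in H (z2.1 + a * z2.2, z2.2)))//=.
  rewrite (ge0_integral_shearr s (H := fun z => H (z.1 + a * z.2, z.2)))//.
  exact: ge0_integral_shearl.
have mSr : measurable_fun setT (fun z : R * R => (z.1, z.2 + s * z.1)).
  apply: measurable_fun_pair => //=.
  by apply: measurable_funD => //; apply: measurable_funM.
exact: (measurableT_comp mSl mSr).
Qed.
End rotation.

(** * Rotations by independent angles preserve standard Gaussian pairs *)

Section gauss_plane.
Context {R : realType}.
Local Notation leb := (@lebesgue_measure R).
Local Notation leb2 := (leb \x leb)%E.
Local Notation gauss := (@normal_prob R 0 1).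
Local Notation gauss2 := (gauss \x gauss)%E.
Local Notation pdf := (@normal_pdf R 0 1).

(** A Gaussian integral is a Lebesgue integral weighted by the density, which
    is the Radon-Nikodym derivative almost everywhere. *)
Lemma ge0_integral_gauss (f : R -> \bar R) :
  measurable_fun setT f -> (forall x, 0 <= f x)%E ->
  (\int[gauss]_x f x = \int[leb]_x (f x * (pdf x)%:E))%E.
Proof.
move=> mf f0.
have dom : gauss `<< leb := normal_prob_dominates 0 1.
rewrite -(Radon_Nikodym_SigmaFinite.change_of_variables dom)//.
apply: ae_eq_integral => //=.
- apply: emeasurable_funM => //.
  exact: measurable_int (Radon_Nikodym_SigmaFinite.f_integrable dom).
- apply: emeasurable_funM => //; apply/measurable_EFinP.
  exact: measurable_normal_pdf.
- apply: ae_eqe_mul2l; apply: integral_ae_eq => //=.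
  + exact: Radon_Nikodym_SigmaFinite.f_integrable.
  + by apply/measurable_EFinP; exact: measurable_normal_pdf.
  + by move=> E _ mE; rewrite -Radon_Nikodym_SigmaFinite.f_integral.
Qed.

Lemma ge0_integral_gauss2 (H : R * R -> \bar R) :
  measurable_fun setT H -> (forall z, 0 <= H z)%E ->
  (\int[gauss2]_z H z = \int[leb2]_z (H z * (pdf z.1 * pdf z.2)%:E))%E.
Proof.
move=> mH H0.
have mp : measurable_fun setT (fun z : R * R => (pdf z.1 * pdf z.2)%:E).
  apply/measurable_EFinP; apply: measurable_funM.
    by apply: measurableT_comp => //; exact: measurable_normal_pdf.
  by apply: measurableT_comp => //; exact: measurable_normal_pdf.
have mHp : measurable_fun setT (fun z : R * R => H z * (pdf z.1 * pdf z.2)%:E)%E.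
  exact: emeasurable_funM.
have Hp0 z : (0 <= H z * (pdf z.1 * pdf z.2)%:E)%E.
  by rewrite mule_ge0// lee_fin mulr_ge0// normal_pdf_ge0.
apply: (etrans (fubini_tonelli1 (m1 := gauss) (m2 := gauss) _ mH H0)).
apply: (etrans _ (esym (fubini_tonelli1 (m1 := leb) (m2 := leb) _ mHp Hp0))).
rewrite ge0_integral_gauss//=; last 2 first.
- exact: measurable_fun_fubini_tonelli_F.
- by move=> x; apply: integral_ge0.
apply: eq_integral => x _; rewrite /fubini_F.
have mHx : measurable_fun setT (fun y => H (x, y)) by exact: measurableT_comp.
rewrite ge0_integral_gauss// -ge0_integralZr//; last 3 first.
- by apply: emeasurable_funM => //; apply/measurable_EFinP; exact: measurable_normal_pdf.
- by move=> y _; rewrite mule_ge0// lee_fin normal_pdf_ge0.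
- by rewrite lee_fin normal_pdf_ge0.
by apply: eq_integral => y _; rewrite /= -muleA -EFinM mulrC.
Qed.

(** The density of a standard Gaussian pair depends on x ^ 2 + y ^ 2 only, so
    the rotation invariance of area passes to the Gaussian plane. *)
Lemma ge0_integral_gauss2_rot (c s : R) (H : R * R -> \bar R) :
  c ^+ 2 + s ^+ 2 = 1 ->
  measurable_fun setT H -> (forall z, 0 <= H z)%E ->
  (\int[gauss2]_z H (rot2 c s z) = \int[gauss2]_z H z)%E.
Proof.
move=> cs1 mH H0.
have mHr : measurable_fun setT (fun z => H (rot2 c s z)).
  by apply: measurableT_comp => //; exact: measurable_rot2.
have mp : measurable_fun setT (fun z : R * R => (pdf z.1 * pdf z.2)%:E).
  apply/measurable_EFinP; apply: measurable_funM.
    by apply: measurableT_comp => //; exact: measurable_normal_pdf.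
  by apply: measurableT_comp => //; exact: measurable_normal_pdf.
have mHp : measurable_fun setT (fun z : R * R => H z * (pdf z.1 * pdf z.2)%:E)%E.
  exact: emeasurable_funM.
have Hp0 z : (0 <= H z * (pdf z.1 * pdf z.2)%:E)%E.
  by rewrite mule_ge0// lee_fin mulr_ge0// normal_pdf_ge0.
apply: (etrans (ge0_integral_gauss2 mHr (fun z => H0 _))).
apply: (etrans _ (esym (ge0_integral_gauss2 mH H0))).
apply: (etrans _ (ge0_integral_rot2 cs1 mHp Hp0)).
apply: eq_integral => -[x y] _ /=; congr (_ * _%:E)%E.
rewrite !normal_pdfE ?oner_eq0//= /normal_fun !subr0.
rewrite mulrACA [RHS]mulrACA -!expRD; congr (_ * expR _).
rewrite expr1n -!mulrDl -!opprD; congr (- _ / _).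
transitivity ((c ^+ 2 + s ^+ 2) * (x ^+ 2 + y ^+ 2)); last by ring.
by rewrite cs1 mul1r.
Qed.

Lemma gauss2_rot (c s : R) (S : set (R * R)) : c ^+ 2 + s ^+ 2 = 1 ->
  measurable S -> gauss2 (rot2 c s @^-1` S) = gauss2 S.
Proof.
move=> cs1 mS.
have mrS : measurable (rot2 c s @^-1` S).
  by rewrite -[X in measurable X]setTI; exact: measurable_rot2.
rewrite -[S in RHS]setIT -integral_indic// -[X in gauss2 X]setIT -integral_indic//.
apply: (ge0_integral_gauss2_rot (H := fun z => (\1_S z)%:E) cs1).
  exact/measurable_EFinP/measurable_indic.
by move=> z; rewrite lee_fin.
Qed.

End gauss_plane.

(** Rectangles determine a joint law. The measure mu is arbitrary because this
    is applied to a probability restricted to an event, where the marginal of one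
    variable is only a multiple of a probability. *)
Lemma joint_law_unique {R : realType} d (Om : measurableType d)
    d1 (T1 : measurableType d1) d2 (T2 : measurableType d2)
    (mu : {measure set Om -> \bar R})
    (m1 : {sigma_finite_measure set T1 -> \bar R})
    (m2 : {sigma_finite_measure set T2 -> \bar R})
    (U : Om -> T1) (V : Om -> T2) :
  measurable_fun setT U -> measurable_fun setT V ->
  (forall A B, measurable A -> measurable B ->
     mu (U @^-1` A `&` V @^-1` B) = (m1 A * m2 B)%E) ->
  forall S : set (T1 * T2), measurable S ->
    mu ((fun w => (U w, V w)) @^-1` S) = (m1 \x m2)%E S.
Proof.
move=> mU mV UV S mS.
rewrite -[LHS]/(pushforward mu (fun w => (U w, V w)) S); apply/esym.
apply: product_measure_unique => //; first exact: measurable_fun_pair.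
Qed.

Section law_finite.
Context {R : realType} d (Om : measurableType d) (mu : {finite_measure set Om -> \bar R}).
Context d' (T' : measurableType d') (f : Om -> T') (mf : measurable_fun setT f).

(** The measurability proof is an argument of the measure, so that its measure
    structure can be found by unification. *)
Definition law (_ : measurable_fun setT f) := pushforward mu f.

Let mpre D : measurable D -> measurable (f @^-1` D).
Proof. by move=> mD; rewrite -[X in measurable X]setTI; exact: mf. Qed.

Let law0 : law mf set0 = 0%E.
Proof. by rewrite /law /pushforward preimage_set0 measure0. Qed.

Let law_ge0 D : (0 <= law mf D)%E.
Proof. exact: measure_ge0. Qed.

Let law_sigma_additive : semi_sigma_additive (law mf).
Proof. by apply: measure_semi_sigma_additive. Qed.

HB.instance Definition _ := isMeasure.Build d' T' R (law mf)
  law0 law_ge0 law_sigma_additive.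

Let law_fin : fin_num_fun (law mf).
Proof. by move=> D mD; rewrite fin_num_measure//; exact: mpre. Qed.

HB.instance Definition _ := Measure_isFinite.Build d' T' R (law mf) law_fin.

End law_finite.

Section pair_rotation.
Context {R : realType} d (Om : measurableType d) (mu : {finite_measure set Om -> \bar R}).
Context d' (T' : measurableType d').
Local Notation gauss := (@normal_prob R 0 1).
Local Notation gauss2 := (gauss \x gauss)%E.

(** The angle is a function of a variable Z independent of the pair: given Z,
    the pair undergoes a fixed rotation, which preserves its law. Hence the
    rotated pair is again standard Gaussian and independent of Z. The measure mu
    stands for a probability restricted to an event that concerns further
    variables. *)
Lemma gauss_pair_rot (X Y : Om -> R) (Z : Om -> T') (c s : T' -> R) :
  measurable_fun setT X -> measurable_fun setT Y -> measurable_fun setT Z ->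
  measurable_fun setT c -> measurable_fun setT s ->
  (forall z, c z ^+ 2 + s z ^+ 2 = 1) ->
  (forall A B C, measurable A -> measurable B -> measurable C ->
    mu (X @^-1` A `&` Y @^-1` B `&` Z @^-1` C) =
    (gauss A * gauss B * mu (Z @^-1` C))%E) ->
  forall A B C, measurable A -> measurable B -> measurable C ->
    mu ((fun w => c (Z w) * X w - s (Z w) * Y w) @^-1` A `&`
        (fun w => s (Z w) * X w + c (Z w) * Y w) @^-1` B `&` Z @^-1` C) =
    (gauss A * gauss B * mu (Z @^-1` C))%E.
Proof.
move=> mX mY mZ mc ms cs1 XYZ A B C mA mB mC.
pose W w := (X w, Y w).
have mW : measurable_fun setT W by exact: measurable_fun_pair.
have mZC C' : measurable C' -> measurable (Z @^-1` C').
  by move=> ?; rewrite -[X in measurable X]setTI; exact: mZ.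
(* the pair is a standard Gaussian independent of Z *)
have ZW C' S : measurable C' -> measurable S ->
    mu (Z @^-1` C' `&` W @^-1` S) = (mu (Z @^-1` C') * gauss2 S)%E.
  move=> mC' mS.
  have fC : mu (Z @^-1` C') \is a fin_num by rewrite fin_num_measure//; exact: mZC.
  have r0 : 0 <= fine (mu (Z @^-1` C')) by rewrite fine_ge0.
  have sE D : mscale (NngNum r0) gauss D = (mu (Z @^-1` C') * gauss D)%E.
    by rewrite /mscale /= fineK.
  rewrite setIC -[LHS]/(mrestr mu (mZC _ mC') (W @^-1` S)).
  rewrite (joint_law_unique (m1 := gauss) (m2 := mscale (NngNum r0) gauss))//.
    rewrite /product_measure1; under eq_integral do rewrite /= sE.
    by rewrite ge0_integralZl//=; exact: measurable_fun_xsection.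
  move=> A' B' mA' mB'; apply: (etrans (XYZ A' B' C' mA' mB' mC')).
  transitivity (gauss A' * (mu (Z @^-1` C') * gauss B'))%E; last by rewrite -sE.
  by rewrite -muleA; congr (_ * _)%E; rewrite muleC.
pose Q := [set p : T' * (R * R) | C p.1 /\ (A `*` B) (rot2 (c p.1) (s p.1) p.2)].
have mrot : measurable_fun setT (fun p : T' * (R * R) => rot2 (c p.1) (s p.1) p.2).
  have mc1 : measurable_fun setT (fun p : T' * (R * R) => c p.1) by exact: measurableT_comp.
  have ms1 : measurable_fun setT (fun p : T' * (R * R) => s p.1) by exact: measurableT_comp.
  have m1 : measurable_fun setT (fun p : T' * (R * R) => p.2.1) by exact: measurableT_comp.
  have m2 : measurable_fun setT (fun p : T' * (R * R) => p.2.2) by exact: measurableT_comp.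
  apply: measurable_fun_pair.
    by apply: measurable_funB; apply: measurable_funM.
  by apply: measurable_funD; apply: measurable_funM.
have mQ : measurable Q.
  rewrite (_ : Q = fst @^-1` C `&` (fun p : T' * (R * R) => rot2 (c p.1) (s p.1) p.2) @^-1` (A `*` B))//.
  apply: measurableI.
    by rewrite -[X in measurable X]setTI; exact: measurable_fst.
  by rewrite -[X in measurable X]setTI; apply: mrot => //; exact: measurableX.
transitivity (mu ((fun w => (Z w, W w)) @^-1` Q)).
  congr (mu _); apply/seteqP; split => w /=; rewrite /Q/=; tauto.
pose gauss2' : probability (measurableTypeR R * measurableTypeR R)%type R := gauss2.
rewrite (joint_law_unique (m1 := law mu mZ) (m2 := gauss2'))//.
rewrite /product_measure1.
transitivity (\int[law mu mZ]_z ((gauss A * gauss B) * (\1_C z)%:E))%E.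
  apply: eq_integral => z _ /=; rewrite indicE.
  have [zC|zC] := boolP (z \in C).
    have -> : xsection Q z = rot2 (c z) (s z) @^-1` (A `*` B).
      apply/seteqP; split => p; rewrite /xsection/= inE /Q/=; first by case.
      by move=> ?; split => //; rewrite -inE.
    rewrite gauss2_rot//; last exact: measurableX.
    by rewrite product_measure1E//= mule1.
  have -> : xsection Q z = set0.
    apply/seteqP; split => p //; rewrite /xsection/= inE /Q/= => -[Cz _].
    by move: zC; rewrite notin_setE.
  by rewrite measure0 mule0.
rewrite ge0_integralZl//; last 2 first.
- exact/measurable_EFinP/measurable_indic.
- by rewrite mule_ge0.
by rewrite integral_indic// setIT.
Qed.
End pair_rotation.

(** * Families of independent standard Gaussians *)

Section gauss_family.
Context {R : realType} d (Om : measurableType d) (P : probability Om R).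
Context {I : choiceType}.
Local Notation gauss := (@normal_prob R 0 1).
Implicit Types (D : seq I) (F : Om -> I -> R).

(** The product rule over the whole of D contains the one over each subfamily,
    by taking A a to be the full line outside of it, so this is mutual
    independence together with the standard normal law of each coordinate. *)
Definition gauss_family D F : Prop :=
  (forall a, a \in D -> measurable_fun setT (F ^~ a)) /\
  (forall A : I -> set R, (forall a, measurable (A a)) ->
     P (\bigcap_(a in [set` D]) (F ^~ a) @^-1` A a) = (\prod_(a <- D) gauss (A a))%E).

(** The speed of the rotations used below is a constant times gain k x: it is
    proportional to one coordinate of the state, or constant when k is None. *)
Definition gain (k : option I) (x : I -> R) : R := if k is Some a then x a else 1.

Definition rot (i j : I) (theta : R) (x : I -> R) : I -> R := fun a =>
  if a == i then cos theta * x i - sin theta * x j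
  else if a == j then sin theta * x i + cos theta * x j
  else x a.

(** Independence of the pair of coordinates i and j from an event on the other
    coordinates, in the form in which the restriction of P to that event is
    rotated below. *)
Lemma gauss_family_split D F i j (B1 B2 : set R) (A : I -> set R) :
  gauss_family D F -> uniq D -> i \in D -> j \in D -> i != j ->
  (forall a, measurable (A a)) -> A i = setT -> A j = setT ->
  measurable B1 -> measurable B2 ->
  P ((F ^~ i) @^-1` B1 `&` (F ^~ j) @^-1` B2 `&`
     \bigcap_(a in [set` D]) (F ^~ a) @^-1` A a) =
  (gauss B1 * gauss B2 * P (\bigcap_(a in [set` D]) (F ^~ a) @^-1` A a))%E.
Proof.
move=> [mF FE] uD iD jD ij mA Ai Aj mB1 mB2.
pose A1 a := if a == i then B1 else if a == j then B2 else A a.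
have ji : (j == i) = false by rewrite eq_sym (negbTE ij).
transitivity (P (\bigcap_(a in [set` D]) (F ^~ a) @^-1` A1 a)).
  congr (P _); apply/seteqP; split => w /=.
    move=> [[w1 w2] w3] a /= aD; rewrite /A1; case: eqP => [->//|_].
    by case: eqP => [->//|_]; exact: w3.
  move=> wA; split.
    split; first by have := wA i iD; rewrite /A1/= eqxx.
    by have := wA j jD; rewrite /A1/= ji eqxx.
  move=> a aD /=; have [->|ai] := eqVneq a i; first by rewrite Ai.
  have [->|aj] := eqVneq a j; first by rewrite Aj.
  by have := wA a aD; rewrite /A1/= (negbTE ai) (negbTE aj).
rewrite !FE//; last by move=> a; rewrite /A1; case: ifP => // _; case: ifP.
have jDi : j \in [seq a <- D | a != i] by rewrite mem_filter eq_sym ij.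
have uDi : uniq [seq a <- D | a != i] by exact: filter_uniq.
rewrite [LHS](bigD1_seq i)//= [in RHS](bigD1_seq i)//=.
rewrite -[in LHS]big_filter -[in RHS]big_filter.
rewrite [in LHS](bigD1_seq j)//= [in RHS](bigD1_seq j)//=.
rewrite Ai Aj probability_setT !mul1e /A1 eqxx ji eqxx muleA; congr (_ * _)%E.
rewrite !big_filter_cond; apply: eq_bigr => a /andP[ai aj].
by rewrite (negbTE ai) (negbTE aj).
Qed.

(** The step that makes the Gaussian measure invariant. The joint law is
    tested on boxes: restricted to the event E that the box prescribes for the
    coordinates other than i and j, the pair (i, j) is still standard Gaussian and
    independent of the coordinate that drives the angle, so gauss_pair_rot applies
    to this restriction. *)
Lemma gauss_family_rot D F i j k (f : R -> R) :
  gauss_family D F -> uniq D -> i \in D -> j \in D -> i != j ->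
  (if k is Some a then [&& a \in D, a != i & a != j] else true) ->
  measurable_fun setT f ->
  gauss_family D (fun w => rot i j (f (gain k (F w))) (F w)).
Proof.
move=> gF uD iD jD ij kij mf; have [mF FE] := gF.
have ji : (j == i) = false by rewrite eq_sym (negbTE ij).
pose Z w := gain k (F w).
have mZ : measurable_fun setT Z.
  rewrite /Z /gain; case: k kij @Z => [a /and3P[aD _ _]|_]; last exact: measurable_cst.
  exact: mF.
have mc : measurable_fun setT (fun z => cos (f z)).
  by apply: measurableT_comp => //; apply: continuous_measurable_fun; exact: continuous_cos.
have ms : measurable_fun setT (fun z => sin (f z)).
  by apply: measurableT_comp => //; apply: continuous_measurable_fun; exact: continuous_sin.
have mcZ : measurable_fun setT (fun w => cos (f (Z w))) by exact: measurableT_comp mc mZ.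
have msZ : measurable_fun setT (fun w => sin (f (Z w))) by exact: measurableT_comp ms mZ.
split.
  move=> a aD; rewrite /rot; have [_|ai] := eqVneq a i.
    by apply: measurable_funB; apply: measurable_funM => //; exact: mF.
  have [_|aj] := eqVneq a j.
    by apply: measurable_funD; apply: measurable_funM => //; exact: mF.
  exact: mF.
move=> A mA.
(* E prescribes every coordinate except i and j *)
pose A0 a := if (a == i) || (a == j) then setT else A a.
have mA0 a : measurable (A0 a) by rewrite /A0; case: ifP.
have A0i : A0 i = setT by rewrite /A0 eqxx.
have A0j : A0 j = setT by rewrite /A0 eqxx orbT.
have mcap A' : (forall a, measurable (A' a)) ->
    measurable (\bigcap_(a in [set` D]) (F ^~ a) @^-1` A' a).
  move=> mA'; apply: fin_bigcap_measurable => // a aD.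
  by rewrite -[X in measurable X]setTI; exact: mF.
pose E := \bigcap_(a in [set` D]) (F ^~ a) @^-1` A0 a.
have mE : measurable E by exact: mcap.
have XYZ B1 B2 C : measurable B1 -> measurable B2 -> measurable C ->
    mrestr P mE ((F ^~ i) @^-1` B1 `&` (F ^~ j) @^-1` B2 `&` Z @^-1` C) =
    (gauss B1 * gauss B2 * mrestr P mE (Z @^-1` C))%E.
  move=> mB1 mB2 mC; rewrite /mrestr -(setIA (_ `&` _) (Z @^-1` C) E).
  suff [A' [mA' A'i A'j]] : exists A' : I -> set R,
      [/\ forall a, measurable (A' a), A' i = setT, A' j = setT &
      Z @^-1` C `&` E = \bigcap_(a in [set` D]) (F ^~ a) @^-1` A' a \/
      Z @^-1` C `&` E = set0].
    case=> ->; first exact: gauss_family_split.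
    by rewrite setI0 measure0 mule0.
  case: k kij @Z mZ mcZ msZ => [a /and3P[aD ai aj]|_] Z mZ mcZ msZ.
    exists (fun b => if b == a then A0 a `&` C else A0 b); split.
    - by move=> b; case: ifP => // _; exact: measurableI.
    - by rewrite eq_sym (negbTE ai).
    - by rewrite eq_sym (negbTE aj).
    - left; apply/seteqP; split => w /=.
        move=> [wC wE] b bD /=; case: eqP => [->|_]; last exact: wE.
        by split => //; exact: wE.
      move=> wE; split; first by have := wE a aD; rewrite /= eqxx => -[].
      by move=> b bD; have := wE b bD => /=; case: eqP => // -> [].
  exists A0; split => //.
  have [C1|nC1] := pselect (C 1); [left|right].
    by apply/seteqP; split => [w []|w wE] //; split.
  by apply/seteqP; split => [w []|w].
have H : P ((fun w => cos (f (Z w)) * F w i - sin (f (Z w)) * F w j) @^-1` A i `&`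
    (fun w => sin (f (Z w)) * F w i + cos (f (Z w)) * F w j) @^-1` A j `&` E) =
    (gauss (A i) * gauss (A j) * P E)%E.
  have cs1 z : cos (f z) ^+ 2 + sin (f z) ^+ 2 = 1 by rewrite cos2Dsin2.
  have := gauss_pair_rot (mF _ iD) (mF _ jD) mZ mc ms cs1 XYZ (mA i) (mA j) measurableT.
  have ZT : Z @^-1` setT `&` E = E by rewrite preimage_setT setTI.
  move=> H; transitivity (gauss (A i) * gauss (A j) * P (Z @^-1` setT `&` E))%E.
    by apply: etrans H; rewrite /mrestr preimage_setT setIT.
  by rewrite ZT.
transitivity (P ((F ^~ i) @^-1` A i `&` (F ^~ j) @^-1` A j `&` E)).
  rewrite gauss_family_split// -H; congr (P _); apply/seteqP; split => w /=.
    move=> wA; split.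
      split; first by have := wA i iD; rewrite /rot/= eqxx.
      by have := wA j jD; rewrite /rot/= eqxx ji.
    move=> a aD /=; rewrite /A0; have [//|ai] := eqVneq a i.
    have [//|aj] /= := eqVneq a j.
    by have := wA a aD; rewrite /rot/= (negbTE ai) (negbTE aj).
  move=> [[wi wj] wE] a aD; rewrite /rot/=; have [->//|ai] := eqVneq a i.
  have [->//|aj] := eqVneq a j.
  by have := wE a aD; rewrite /A0/= (negbTE ai) (negbTE aj).
rewrite -FE//; congr (P _); apply/seteqP; split => w /=.
  move=> [[wi wj] wE] a aD; have [->//|ai] := eqVneq a i.
  have [->//|aj] := eqVneq a j.
  by have := wE a aD; rewrite /A0/= (negbTE ai) (negbTE aj).
move=> wA; split; first by split; exact: wA.
by move=> a aD /=; rewrite /A0; case: ifP => // _; exact: wA.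
Qed.

End gauss_family.

(** * Moments of the standard Gaussian *)

Section gauss_moments.
Context {R : realType}.
Local Notation leb := (@lebesgue_measure R).
Local Notation gauss := (@normal_prob R 0 1).
Local Notation pdf := (@normal_pdf R 0 1).

Lemma normal_pdf01E (x : R) : pdf x = normal_peak 1 * expR (- (x ^+ 2 / 2)).
Proof. by rewrite normal_pdfE ?oner_eq0// /normal_fun subr0 expr1n mulNr. Qed.

Lemma is_derive_normal_pdf (x : R) : is_derive x 1 pdf (- (x * pdf x)).
Proof.
have -> : pdf = normal_peak 1 \*: (expR \o (- (2^-1 \*: (id ^+ 2)))).
  apply/funext => y; rewrite normal_pdf01E /= /GRing.scale/=; congr (_ * expR (- _)).
  by rewrite mulrC.
apply: is_derive_eq; rewrite /= /GRing.scale/=.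
rewrite [X in expR X](_ : _ = (- (2^-1 * x ^+ 2)))//.
by field.
Qed.

(** The factor exp (- x ^ 2 / 2) beats each power of x, because exp y is at
    least y ^ (k + 1) / (k + 1)! for nonnegative y. *)
Lemma exprn_normal_pdf_cvg0 (k : nat) :
  (fun n : nat => n%:R ^+ k.+1 * pdf n%:R) @ \oo --> (0 : R).
Proof.
pose C := normal_peak 1 * (k.+1)`!%:R * 2 ^+ k.+1 : R.
have C0 : 0 <= C by rewrite /C !mulr_ge0// ?normal_peak_ge0// exprn_ge0.
apply: (@squeeze_cvgr _ _ _ _ (cst 0) (fun n : nat => C * n%:R^-1)).
- near=> n; rewrite /= mulr_ge0 ?exprn_ge0 ?normal_pdf_ge0//=.
  have n0 : (0 < n)%N by near: n; exact: nbhs_infty_gt.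
  have nR : 0 < n%:R :> R by rewrite ltr0n.
  have n1 : 1 <= n%:R :> R by rewrite ler1n.
  set x : R := n%:R in nR n1 *.
  rewrite normal_pdf01E expRN.
  have y0 : 0 <= x ^+ 2 / 2 by rewrite divr_ge0// sqr_ge0.
  have h : (x ^+ 2 / 2) ^+ k.+1 / (k.+1)`!%:R <= expR (x ^+ 2 / 2).
    by apply: le_trans _ (expR_ge1Dxn k y0); rewrite lerDr.
  have f0 : 0 < (k.+1)`!%:R :> R by rewrite ltr0n fact_gt0.
  set y := x ^+ 2 / 2 in h y0 *.
  rewrite mulrCA /C -!mulrA ler_wpM2l ?normal_peak_ge0//.
  rewrite ler_pdivrMr ?expR_gt0//.
  apply: le_trans _ (ler_wpM2l _ h); last first.
    by rewrite !mulr_ge0 ?exprn_ge0// invr_ge0 ltW.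
  have -> : (k.+1)`!%:R * (2 ^+ k.+1 / x) * (y ^+ k.+1 / (k.+1)`!%:R) =
     x ^+ k.+1 * x ^+ k.
    have x0 : x != 0 by rewrite gt_eqF.
    have f0' : (k.+1)`!%:R != 0 :> R by rewrite gt_eqF.
    have t0 : (2 : R) ^+ k != 0 by rewrite expf_neq0.
    rewrite /y expr_div_n -exprM mul2n -addnn exprD [x ^+ k.+1]exprS [2 ^+ _]exprS.
    by field; rewrite x0 t0 f0'.
  by rewrite ler_peMr ?exprn_ge0 ?exprn_ege1// ltW.
- exact: cvg_cst.
- rewrite -[X in _ --> X](mulr0 C); apply: cvgM; first exact: cvg_cst.
  apply/cvgrPdist_lt => e e0; near=> n.
  rewrite sub0r normrN ger0_norm ?invr_ge0//.
  have n0 : (0 < n)%N by near: n; exact: nbhs_infty_gt.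
  rewrite invf_plt ?posrE ?ltr0n//.
  by near: n; exact: nbhs_infty_gtr.
Unshelve. all: by end_near. Qed.

Lemma continuous_exprn_pdf p : continuous (fun x : R => x ^+ p * pdf x).
Proof.
move=> x; apply: cvgM; first exact: exprn_continuous.
exact: continuous_normal_pdf.
Qed.

Lemma measurable_exprn_pdf p : measurable_fun setT (fun x : R => x ^+ p * pdf x).
Proof. by apply: continuous_measurable_fun; exact: continuous_exprn_pdf. Qed.

(** Integration by parts: the density satisfies pdf' = - x pdf, and for even p
    the two boundary terms are equal. *)
Lemma integral_itv_exprn_pdf p (n : nat) : ~~ odd p ->
  ((\int[leb]_(x in [set` `[- (n.+1%:R : R), n.+1%:R]%R]) (x ^+ p.+2 * pdf x)%:E) +
    (2 * (n.+1%:R ^+ p.+1 * pdf n.+1%:R))%R%:E =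
  p.+1%:R%:E * \int[leb]_(x in [set` `[- (n.+1%:R : R), n.+1%:R]%R]) (x ^+ p * pdf x)%:E)%E.
Proof.
move=> op; set b : R := n.+1%:R.
have b0 : 0 < b by rewrite ltr0n.
have ab : - b < b by lra.
have int q : leb.-integrable `[- b, b] (EFin \o (fun x : R => x ^+ q * pdf x)).
  apply: continuous_compact_integrable; first exact: segment_compact.
  by apply: continuous_subspaceT; exact: continuous_exprn_pdf.
pose F := - ((id ^+ p.+1) * pdf) : R -> R.
pose f x := x ^+ p.+2 * pdf x - p.+1%:R * (x ^+ p * pdf x).
have dF (x : R) : is_derive x 1 F (f x).
  have dp := is_derive_normal_pdf x.
  rewrite /F; apply: is_derive_eq; rewrite /f /= /GRing.scale/= exprfctE.
  by rewrite !exprS; ring.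
have cf : continuous f.
  move=> x; apply: cvgB; first exact: continuous_exprn_pdf.
  by apply: cvgM; [exact: cvg_cst|exact: continuous_exprn_pdf].
have cF : continuous F.
  by move=> x; apply/differentiable_continuous/derivable1_diffP; have [] := dF x.
have FTC : (\int[leb]_(x in [set` `[- b, b]%R]) (f x)%:E = (F b)%:E - (F (- b)%R)%:E)%E.
  apply: continuous_FTC2 => //.
  - exact: continuous_subspaceT.
  - split; first by move=> x _; have [] := dF x.
    + by apply: cvg_at_right_filter; exact: cF.
    + by apply: cvg_at_left_filter; exact: cF.
  - by move=> x _; rewrite derive1E; have [] := dF x.
have E : (\int[leb]_(x in [set` `[- b, b]%R]) (f x)%:E =
   \int[leb]_(x in [set` `[- b, b]%R]) (x ^+ p.+2 * pdf x)%:E - p.+1%:R%:E * \int[leb]_(x in [set` `[- b, b]%R]) (x ^+ p * pdf x)%:E)%E.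
  rewrite -integralZl//; last exact: int.
  rewrite -integralB//; [exact: int|].
  by apply: integrableZl => //; exact: int.
move: FTC; rewrite E => FTC.
have fin q : (\int[leb]_(x in [set` `[- b, b]%R]) (x ^+ q * pdf x)%:E)%E \is a fin_num.
  exact: integrable_fin_num (int q).
move: (fin p) (fin p.+2) FTC.
case: (\int[leb]_(x in [set` `[- b, b]%R]) (x ^+ p * pdf x)%:E)%E => // r _.
case: (\int[leb]_(x in [set` `[- b, b]%R]) (x ^+ p.+2 * pdf x)%:E)%E => // r2 _.
rewrite -!EFinM -!EFinB -EFinD => -[] h; congr EFin.
have pe : pdf (- b) = pdf b by rewrite !normal_pdf01E sqrrN.
move: h; rewrite /F /= !fctE pe [(- b) ^+ _]exprNn -signr_odd /= op expr1.
set X := b ^+ p.+1 => h.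
by rewrite (_ : r2 = p.+1%:R * r + (- (X * pdf b) - - (- 1 * X * pdf b))); [ring | rewrite -h; ring].
Qed.

(** The boundary terms of the integration by parts vanish at infinity. *)
Lemma integral_exprn_gauss_rec p : ~~ odd p ->
  (\int[gauss]_x (x ^+ p.+2)%:E = p.+1%:R%:E * \int[gauss]_x (x ^+ p)%:E)%E.
Proof.
move=> op.
have e0 q (x : R) : ~~ odd q -> 0 <= x ^+ q by move=> oq; rewrite exprn_even_ge0.
have mX q : measurable_fun setT (fun x : R => (x ^+ q)%:E).
  by apply/measurable_EFinP; exact: exprn_measurable.
rewrite !ge0_integral_gauss//; last 2 first.
  by move=> x; rewrite lee_fin e0.
  by move=> x; rewrite lee_fin e0//= negbK.
pose S (n : nat) : set R := `[(- n.+1%:R : R), n.+1%:R]%classic.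
have ST : \bigcup_n S n = setT.
  apply/seteqP; split => // x _.
  exists (Num.truncn `|x|) => //; rewrite /S/= in_itv/= -ler_norml.
  by rewrite ltW// truncnS_gt.
have S_nd : nondecreasing_seq S.
  move=> m n mn; apply/subsetPset => x; rewrite /S/= !in_itv/= -!ler_norml => /le_trans; apply.
  by rewrite ler_nat.
have cvgI q : ~~ odd q -> (\int[leb]_(x in S n) (x ^+ q * pdf x)%:E @[n --> \oo] --> \int[leb]_x (x ^+ q * pdf x)%:E)%E.
  move=> oq; rewrite -ST; apply: ge0_nondecreasing_set_cvg_integral => //.
  - by move=> n; exact: measurable_itv.
  - by move=> n; apply: measurable_funTS; apply/measurable_EFinP; exact: measurable_exprn_pdf.
  - by move=> n x _; rewrite lee_fin mulr_ge0 ?normal_pdf_ge0// e0.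
have c0 : ((2 * (n.+1%:R ^+ p.+1 * pdf n.+1%:R))%R%:E @[n --> \oo] --> 0%:E)%E.
  apply: cvg_EFin; first exact: nearW.
  rewrite -[X in _ --> X](mulr0 2); apply: cvgM; first exact: cvg_cst.
  have := @exprn_normal_pdf_cvg0 p.
  by rewrite -(cvg_shiftS (fun n : nat => n%:R ^+ p.+1 * pdf n%:R)).
have c1 : ((\int[leb]_(x in S n) (x ^+ p.+2 * pdf x)%:E + (2 * (n.+1%:R ^+ p.+1 * pdf n.+1%:R))%R%:E) @[n --> \oo] --> \int[leb]_x (x ^+ p.+2 * pdf x)%:E + 0%:E)%E.
  apply: cvgeD => //; first by rewrite fin_num_adde_defl.
  by apply: cvgI; rewrite /= negbK.
have c2 : (p.+1%:R%:E * \int[leb]_(x in S n) (x ^+ p * pdf x)%:E @[n --> \oo] --> p.+1%:R%:E * \int[leb]_x (x ^+ p * pdf x)%:E)%E.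
  by apply: cvgeZl => //; exact: cvgI.
transitivity (\int[leb]_x (x ^+ p.+2 * pdf x)%:E)%E.
  by apply: eq_integral => x _; rewrite EFinM.
transitivity (p.+1%:R%:E * \int[leb]_x (x ^+ p * pdf x)%:E)%E; last first.
  by congr (_ * _)%E; apply: eq_integral => x _; rewrite EFinM.
rewrite adde0 in c1; apply: (cvg_unique _ c1) => //.
apply: cvg_trans c2; apply: near_eq_cvg; apply: nearW => n.
by rewrite /S integral_itv_exprn_pdf.
Qed.

Lemma integral_sqr_gauss : (\int[gauss]_x (x ^+ 2)%:E = 1)%E.
Proof.
rewrite (integral_exprn_gauss_rec (p := 0))//.
under eq_integral do rewrite expr0.
by rewrite integral_cst//= probability_setT !mul1e.
Qed.

Lemma integral_exp4_gauss : (\int[gauss]_x (x ^+ 4)%:E = 3%:R%:E)%E.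
Proof.
by rewrite (integral_exprn_gauss_rec (p := 2))// integral_sqr_gauss mule1.
Qed.

End gauss_moments.

(** * Covariances under almost sure limits *)

Lemma ge0_integral_law {R : realType} d (Om : measurableType d) d' (T' : measurableType d')
    (mu : {measure set Om -> \bar R}) (nu : {measure set T' -> \bar R})
    (X : Om -> T') (f : T' -> \bar R) :
  measurable_fun setT X -> (forall B, measurable B -> mu (X @^-1` B) = nu B) ->
  measurable_fun setT f -> (forall x, 0 <= f x)%E ->
  (\int[mu]_w f (X w) = \int[nu]_x f x)%E.
Proof.
move=> mX XE mf f0.
transitivity (\int[pushforward mu X]_y f y)%E.
  by rewrite ge0_integral_pushforward.
by apply: eq_measure_integral => //= B mB _; rewrite -XE.
Qed.

Section same_law_limit.
Context {R : realType} d (Om : measurableType d) (P : probability Om R).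
Variables (Zn : nat -> Om -> R) (Z Z0 : Om -> R).
Hypothesis mZn : forall n, measurable_fun setT (Zn n).
Hypothesis mZ : measurable_fun setT Z.
Hypothesis mZ0 : measurable_fun setT Z0.
Hypothesis lawZn : forall n B, measurable B -> P (Zn n @^-1` B) = P (Z0 @^-1` B).
Hypothesis cvgZ : {ae P, forall w, (fun n => Zn n w) @ \oo --> Z w}.

(** The variables Zn all have the law of Z0, so their integrals do not depend
    on n, and dominated convergence identifies the limit. *)
Lemma integral_limit_bounded (phi : R -> R) (M : R) :
  continuous phi -> (forall x, 0 <= phi x <= M) ->
  (\int[P]_w (phi (Z w))%:E = \int[P]_w (phi (Z0 w))%:E)%E.
Proof.
move=> cphi bphi.
have mphi : measurable_fun setT (EFin \o phi).
  by apply/measurable_EFinP; exact: continuous_measurable_fun.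
have phi0 x : (0 <= (EFin \o phi) x)%E by rewrite lee_fin; case/andP: (bphi x).
have toLaw X : measurable_fun setT X -> (forall B, measurable B -> P (X @^-1` B) = P (Z0 @^-1` B)) ->
    (\int[P]_w (phi (X w))%:E = \int[law P mZ0]_x (phi x)%:E)%E.
  by move=> mX XE; rewrite (ge0_integral_law (nu := law P mZ0) (f := EFin \o phi) mX).
have E n : (\int[P]_w (phi (Zn n w))%:E = \int[P]_w (phi (Z0 w))%:E)%E.
  by rewrite (toLaw _ (mZn n) (lawZn n)) (toLaw _ mZ0).
have mf_ n : measurable_fun setT (fun w => (phi (Zn n w))%:E).
  exact: (measurableT_comp mphi (mZn n)).
have mf : measurable_fun setT (fun w => (phi (Z w))%:E).
  exact: (measurableT_comp mphi mZ).
have f_f : {ae P, forall w, setT w -> (fun n => (phi (Zn n w))%:E) @ \oo --> (phi (Z w))%:E}.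
  apply: filterS cvgZ => w Zw _; apply: cvg_EFin; first exact: nearW.
  by apply: (cvg_comp _ phi Zw); exact: cphi.
have ig : P.-integrable setT (fun=> M%:E : \bar R) by exact: finite_measure_integrable_cst.
have f_g : {ae P, forall w n, setT w -> (`|(phi (Zn n w))%:E| <= M%:E)%E}.
  apply: aeW => w n _; case/andP: (bphi (Zn n w)) => p0 pM.
  by rewrite /= ger0_norm// lee_fin.
have [_ _ H] := dominated_convergence measurableT mf_ mf f_f ig f_g.
apply/esym; apply: (cvg_unique _ _ H) => //.
rewrite (_ : [sequence _]_n = cst (\int[P]_w (phi (Z0 w))%:E)%E); first exact: cvg_cst.
by apply/funext => n; exact: E.
Qed.

(** Truncate psi at height n: the bounded case applies, and both sides
    increase to the integrals of psi. *)
Lemma integral_limit_ge0 (psi : R -> R) :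
  continuous psi -> (forall x, 0 <= psi x) ->
  (\int[P]_w (psi (Z w))%:E = \int[P]_w (psi (Z0 w))%:E)%E.
Proof.
move=> cpsi psi0.
have cphi (n : nat) : continuous (fun x => Num.min (psi x) n%:R).
  by move=> x; apply: (continuous_min (f := psi) (g := cst n%:R)); [exact: cpsi|exact: cvg_cst].
have phi0 (n : nat) x : 0 <= Num.min (psi x) n%:R <= n%:R.
  by rewrite le_min psi0 ler0n /= ge_min lexx orbT.
have MC X : measurable_fun setT X ->
    (\int[P]_w (psi (X w))%:E = limn (fun n => \int[P]_w (Num.min (psi (X w)) n%:R)%:E))%E.
  move=> mX; rewrite -monotone_convergence//=.
  - apply: eq_integral => w _; apply/esym/cvg_lim => //.
    apply: cvg_EFin; first exact: nearW.
    apply: cvg_near_cst; near=> n; apply/min_idPl.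
    by apply: ltW; near: n; exact: nbhs_infty_gtr.
  - move=> n; apply/measurable_EFinP.
    exact: (measurableT_comp (continuous_measurable_fun (cphi n)) mX).
  - by move=> n w _; rewrite lee_fin; case/andP: (phi0 n (X w)).
  - move=> w _ m n mn; rewrite lee_fin le_min2// ler_nat//.
rewrite (MC _ mZ) (MC _ mZ0); congr (limn _); apply/funext => n.
exact: (integral_limit_bounded (cphi n) (phi0 n)).
Unshelve. all: by end_near. Qed.

Lemma integral_limit :
  P.-integrable setT (EFin \o Z0) ->
  P.-integrable setT (EFin \o Z) /\
  (\int[P]_w (Z w)%:E = \int[P]_w (Z0 w)%:E)%E.
Proof.
move=> iZ0; split.
  apply/integrableP; split; first exact/measurable_EFinP.
  case/integrableP: iZ0 => _.
  have := integral_limit_ge0 (psi := fun x => `|x|) (@norm_continuous _ R) (fun x => normr_ge0 x).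
  by move=> /= ->.
rewrite integralE [RHS]integralE.
have pE (X : Om -> R) : (\int[P]_w ((fun w => (X w)%:E)^\+ w) = \int[P]_w (Num.max (X w) 0)%:E)%E.
  by apply: eq_integral => w _; rewrite funeposE EFin_max.
have nE (X : Om -> R) : (\int[P]_w ((fun w => (X w)%:E)^\- w) = \int[P]_w (Num.max (- X w) 0)%:E)%E.
  by apply: eq_integral => w _; rewrite funenegE EFin_max.
rewrite !pE !nE; congr (_ - _)%E.
  apply: (integral_limit_ge0 (psi := fun x => Num.max x 0)).
    by move=> x; apply: (continuous_max (f := idfun) (g := cst 0)); [exact: cvg_id|exact: cvg_cst].
  by move=> x; rewrite le_max lexx orbT.
apply: (integral_limit_ge0 (psi := fun x => Num.max (- x) 0)).
  by move=> x; apply: (continuous_max (f := -%R) (g := cst 0)); [exact: opp_continuous|exact: cvg_cst].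
by move=> x; rewrite le_max lexx orbT.
Qed.

End same_law_limit.

Section gauss_family_moments.
Context {R : realType} d (Om : measurableType d) (P : probability Om R).
Context {I : choiceType}.
Local Notation gauss := (@normal_prob R 0 1).
Local Notation gauss2 := (gauss \x gauss)%E.
Variables (D : seq I) (F : Om -> I -> R).
Hypotheses (uD : uniq D) (gF : gauss_family P D F).

Lemma gauss_family1 a B : a \in D -> measurable B ->
  P ((F ^~ a) @^-1` B) = gauss B.
Proof.
move=> aD mB; case: gF => mF FE.
have := FE (fun b => if b == a then B else setT) _.
rewrite (bigD1_seq a)//= eqxx big1_seq ?mule1; last first.
  by move=> b /andP[ba _]; rewrite (negbTE ba) probability_setT.
move=> <-; last by move=> b; case: ifP.
congr (P _); apply/seteqP; split => w /=.
  by move=> wB b bD /=; case: eqP => // ->.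
by move=> /(_ a aD)/=; rewrite eqxx.
Qed.

Lemma gauss_family2 a b S : a \in D -> b \in D -> a != b -> measurable S ->
  P ((fun w => (F w a, F w b)) @^-1` S) = gauss2 S.
Proof.
move=> aD bD ab mS; case: (gF) => mF FE.
rewrite (joint_law_unique (m1 := gauss) (m2 := gauss))//; [exact: mF|exact: mF|].
move=> A B mA mB.
have := gauss_family_split gF uD aD bD ab (fun=> measurableT) erefl erefl mA mB.
have -> : \bigcap_(c in [set` D]) (F ^~ c) @^-1` [set: R] = setT.
  by apply/seteqP; split.
by rewrite setIT probability_setT mule1.
Qed.

Lemma gauss_family_integral1 a (f : R -> R) : a \in D ->
  measurable_fun setT f -> (forall x, 0 <= f x) ->
  (\int[P]_w (f (F w a))%:E = \int[gauss]_x (f x)%:E)%E.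
Proof.
move=> aD mf f0.
apply: (ge0_integral_law (mu := P) (nu := gauss) (X := F ^~ a) (f := EFin \o f)).
- by case: gF => mF _; exact: mF.
- by move=> B mB; exact: gauss_family1.
- exact/measurable_EFinP.
- by move=> x; rewrite lee_fin.
Qed.

Lemma gauss_family_integral2 a b (f : R * R -> R) : a \in D -> b \in D -> a != b ->
  measurable_fun setT f -> (forall x, 0 <= f x) ->
  (\int[P]_w (f (F w a, F w b))%:E = \int[gauss2]_x (f x)%:E)%E.
Proof.
move=> aD bD ab mf f0.
apply: (ge0_integral_law (mu := P) (nu := gauss2) (X := fun w => (F w a, F w b)) (f := EFin \o f)).
- by case: gF => mF _; apply: measurable_fun_pair; exact: mF.
- by move=> B mB; exact: gauss_family2.
- exact/measurable_EFinP.
- by move=> x; rewrite lee_fin.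
Qed.

Lemma gauss_family_sqr a : a \in D -> (\int[P]_w (F w a ^+ 2)%:E = 1)%E.
Proof.
move=> aD; rewrite (gauss_family_integral1 (f := fun x => x ^+ 2))//.
- exact: integral_sqr_gauss.
- by move=> x; exact: sqr_ge0.
Qed.

Lemma gauss_family_exp4 a : a \in D -> (\int[P]_w (F w a ^+ 4)%:E = 3%:R%:E)%E.
Proof.
move=> aD; rewrite (gauss_family_integral1 (f := fun x => x ^+ 4))//.
- exact: integral_exp4_gauss.
- by move=> x; rewrite exprn_even_ge0.
Qed.

Lemma gauss_family_sqr_sqr a b : a \in D -> b \in D -> a != b ->
  (\int[P]_w (F w a ^+ 2 * F w b ^+ 2)%:E = 1)%E.
Proof.
move=> aD bD ab.
have mf : measurable_fun setT (fun z : R * R => z.1 ^+ 2 * z.2 ^+ 2).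
  by apply: measurable_funM; apply: measurable_funX.
rewrite (gauss_family_integral2 (f := fun z => z.1 ^+ 2 * z.2 ^+ 2))//; last first.
  by move=> x; rewrite mulr_ge0// sqr_ge0.
have mf' : measurable_fun setT (fun z : R * R => (z.1 ^+ 2 * z.2 ^+ 2)%:E) by exact/measurable_EFinP.
apply: (etrans (fubini_tonelli1 (m1 := gauss) (m2 := gauss) _ mf' _)).
  by move=> x; rewrite lee_fin mulr_ge0// sqr_ge0.
rewrite -[RHS]integral_sqr_gauss; apply: eq_integral => x _; rewrite /fubini_F/=.
under eq_integral do rewrite EFinM.
rewrite ge0_integralZl//= ?integral_sqr_gauss ?mule1//.
- by apply/measurable_EFinP; apply: measurable_funX.
- by move=> y _; rewrite lee_fin sqr_ge0.
- by rewrite lee_fin sqr_ge0.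
Qed.

(** A product of two coordinates is dominated by the sum of their squares. *)
Lemma gauss_family_integrable a b : a \in D -> b \in D ->
  P.-integrable setT (fun w => (F w a * F w b)%:E).
Proof.
move=> aD bD; have [mF _] := gF.
have msq c : c \in D -> measurable_fun setT (fun w => (F w c ^+ 2)%:E).
  by move=> cD; apply/measurable_EFinP; apply: measurable_funX; exact: mF.
have isq c : c \in D -> P.-integrable setT (fun w => (F w c ^+ 2)%:E).
  move=> cD; apply/integrableP; split; first exact: msq.
  under eq_integral do rewrite /= ger0_norm ?sqr_ge0//.
  by rewrite gauss_family_sqr// ltry.
apply: (le_integrable _ _ _ (integrableD _ (isq a aD) (isq b bD))) => //.
  by apply/measurable_EFinP; apply: measurable_funM; exact: mF.
move=> w _; rewrite /= lee_fin normrM [leRHS]ger0_norm ?addr_ge0 ?sqr_ge0//.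
rewrite -[F w a ^+ 2]real_normK ?num_real// -[F w b ^+ 2]real_normK ?num_real//.
set x := `|F w a|; set y := `|F w b|.
have := sqr_ge0 (x - y); have : 0 <= x * y by rewrite mulr_ge0 ?normr_ge0.
rewrite sqrrB; lra.
Qed.

End gauss_family_moments.

Section gauss_family_cov.
Context {R : realType} d (Om : measurableType d) (P : probability Om R).
Context {I : choiceType}.
Variables (D : seq I) (F : Om -> I -> R).
Hypotheses (uD : uniq D) (gF : gauss_family P D F).

(** Off the diagonal, a quarter turn in the plane of a and b keeps the joint
    law and changes the sign of the product, so the positive and the negative part
    of the product have the same integral. *)
Lemma gauss_family_cov a b : a \in D -> b \in D ->
  (\int[P]_w (F w a * F w b)%:E = (a == b)%:R%:E)%E.
Proof.
move=> aD bD; have [<-|ab] := eqVneq a b.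
  rewrite -[RHS](gauss_family_sqr uD gF aD).
  by apply: eq_integral => w _; rewrite -expr2.
pose F' w := rot a b (pi / 2) (F w).
have gF' : gauss_family P D F'.
  exact: (gauss_family_rot (k := None) (f := cst (pi / 2)) gF uD aD bD ab isT (measurable_cst _)).
have ba : (b == a) = false by rewrite eq_sym (negbTE ab).
have F'E w : F' w a * F' w b = - (F w a * F w b).
  by rewrite /F' /rot eqxx ba eqxx cos_pihalf sin_pihalf; ring.
have mp : measurable_fun setT (fun z : R * R => Num.max (z.1 * z.2) 0).
  by apply: measurable_maxr => //; apply: measurable_funM.
have p0 (z : R * R) : 0 <= Num.max (z.1 * z.2) 0 by rewrite le_max lexx orbT.
have E : (\int[P]_w (Num.max (F w a * F w b) 0)%:E = \int[P]_w (Num.max (- (F w a * F w b)) 0)%:E)%E.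
  have := gauss_family_integral2 uD gF aD bD ab mp p0.
  have := gauss_family_integral2 uD gF' aD bD ab mp p0.
  by move=> /= <- ->; apply: eq_integral => w _; rewrite F'E.
have /integrableP[_] := gauss_family_integrable uD gF aD bD.
have iF := gauss_family_integrable uD gF aD bD.
move=> _; rewrite integralE.
have pE (X : Om -> R) : (\int[P]_w ((fun w => (X w)%:E)^\+ w) = \int[P]_w (Num.max (X w) 0)%:E)%E.
  by apply: eq_integral => w _; rewrite funeposE EFin_max.
have nE (X : Om -> R) : (\int[P]_w ((fun w => (X w)%:E)^\- w) = \int[P]_w (Num.max (- X w) 0)%:E)%E.
  by apply: eq_integral => w _; rewrite funenegE EFin_max.
have := integrable_pos_fin_num measurableT iF.
by rewrite pE nE -E => ?; rewrite subee.
Qed.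

End gauss_family_cov.

(** The covariances of a Gaussian family pass to almost sure limits: all the
    approximations have one and the same law, so no uniform integrability has to
    be checked. *)
Lemma gauss_family_limit_cov {R : realType} d (Om : measurableType d) (P : probability Om R)
    (I : choiceType) (D : nat -> seq I) (F : nat -> Om -> I -> R) (X Y : Om -> R) (a b : I) :
  (forall N, uniq (D N)) -> (forall N, gauss_family P (D N) (F N)) ->
  (forall N, a \in D N) -> (forall N, b \in D N) ->
  measurable_fun setT X -> measurable_fun setT Y ->
  {ae P, forall w, (fun N => F N w a) @ \oo --> X w} ->
  {ae P, forall w, (fun N => F N w b) @ \oo --> Y w} ->
  P.-integrable setT (fun w => (X w * Y w)%:E) /\
  (\int[P]_w (X w * Y w)%:E = (a == b)%:R%:E)%E.
Proof.
move=> uD gF aD bD mX mY cX cY.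
have mFN N c : c \in D N -> measurable_fun setT (F N ^~ c) by case: (gF N) => mF _; exact: mF.
have [] := @integral_limit R d Om P (fun N w => F N w a * F N w b) (fun w => X w * Y w)
  (fun w => F 0%N w a * F 0%N w b).
- by move=> n; apply: measurable_funM; exact: mFN.
- exact: measurable_funM.
- by apply: measurable_funM; exact: mFN.
- move=> n B mB; have [ab|ab] := eqVneq a b.
    subst b; have mB2 : measurable ((fun x : R => x * x) @^-1` B).
      by rewrite -[X in measurable X]setTI; apply: measurable_funM.
    have := gauss_family1 (uD n) (gF n) (aD n) mB2.
    by rewrite -(gauss_family1 (uD 0%N) (gF 0%N) (aD 0%N) mB2).
  have mB2 : measurable ((fun z : R * R => z.1 * z.2) @^-1` B).
    by rewrite -[X in measurable X]setTI; apply: measurable_funM.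
  have := gauss_family2 (uD n) (gF n) (aD n) (bD n) ab mB2.
  by rewrite -(gauss_family2 (uD 0%N) (gF 0%N) (aD 0%N) (bD 0%N) ab mB2).
- by apply: filterS2 cX cY => w wX wY; exact: cvgM.
- exact: (gauss_family_integrable (uD 0%N) (gF 0%N)).
by move=> iXY ->; split => //; exact: (gauss_family_cov (uD 0%N) (gF 0%N)).
Qed.

(** * Splitting vector fields into rotations *)

Section trig_bounds.
Context {R : realType}.
Implicit Types x y : R.

(** The derivative is controlled only as far from x as y is, which is what an
    estimate along a solution on a bounded time interval provides. *)
Lemma le_MVT_norm (f df : R -> R) (M : R) x y :
  (forall z : R, is_derive z 1 f (df z)) ->
  (forall z, `|z - x| <= `|y - x| -> `|df z| <= M) ->
  `|f y - f x| <= M * `|y - x|.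
Proof.
move=> fdf bdf.
have cf : continuous f.
  by move=> z; apply/differentiable_continuous/derivable1_diffP; have [] := fdf z.
have [xy|/ltW yx] := leP x y.
  have [c cxy ->] := MVT_segment xy (fun z _ => fdf z) (continuous_subspaceT cf).
  rewrite normrM ler_wpM2r// bdf//; move: cxy; rewrite in_itv/= => /andP[xc cy].
  by rewrite !ger0_norm ?subr_ge0// lerD2r.
have [c cyx E] := MVT_segment yx (fun z _ => fdf z) (continuous_subspaceT cf).
rewrite distrC E (distrC y) normrM ler_wpM2r// bdf//; move: cyx; rewrite in_itv/= => /andP[yc cx].
by rewrite distrC (distrC y) !ger0_norm ?subr_ge0// lerD2l lerN2.
Qed.

Lemma normr_sin_le x : `|sin x| <= `|x|.
Proof.
have := @le_MVT_norm sin cos 1 0 x (fun z => is_derive_sin z) _.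
rewrite sin0 !subr0 mul1r; apply => z _.
by rewrite ler_norml cos_geN1 cos_le1.
Qed.

Lemma normr_cosB1_le x : `|cos x - 1| <= `|x|.
Proof.
have := @le_MVT_norm cos (fun z => - sin z) 1 0 x (fun z => is_derive_cos z) _.
rewrite cos0 !subr0 mul1r; apply => z _.
by rewrite normrN ler_norml sin_geN1 sin_le1.
Qed.

Lemma normr_cosB1_le2 x : `|cos x - 1| <= x ^+ 2.
Proof.
have := @le_MVT_norm cos (fun z => - sin z) `|x| 0 x (fun z => is_derive_cos z) _.
rewrite cos0 !subr0 -expr2 real_normK ?num_real//; apply => z; rewrite subr0 => zx.
by rewrite normrN (le_trans (normr_sin_le z)).
Qed.

Lemma normr_sinB_le2 x : `|sin x - x| <= x ^+ 2.
Proof.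
have d (z : R) : is_derive z 1 (sin - id : R -> R) (cos z - 1) by apply: is_deriveB.
have := @le_MVT_norm _ _ `|x| 0 x d _.
rewrite /= !fctE sin0 !subr0 -expr2 real_normK ?num_real//; apply => z; rewrite subr0 => zx.
by rewrite (le_trans (normr_cosB1_le z)).
Qed.

End trig_bounds.

Section splitting.
Context {R : realType} d (Om : measurableType d) (P : probability Om R).
Context {I : choiceType} (D : seq I) (uD : uniq D).
Implicit Types (x y : I -> R) (B : (I -> R) -> I -> R) (Psi : R -> (I -> R) -> I -> R).

Definition sqnorm x : R := \sum_(a <- D) x a ^+ 2.

(** The bounds that Psi satisfies as a first-order integrator of x' = B x, for
    a field B of degree at most two: smallness of the step, local error, and
    Lipschitz continuity of B. The powers of rho are those of a quadratic field;
    restricting to rho at least 1 lets them absorb the linear terms. *)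
Definition step_error Psi B (K : R) : Prop := forall rho, 1 <= rho ->
  [/\ forall h x a, sqnorm x <= rho ^+ 2 -> a \in D ->
        `|Psi h x a - x a| <= K * `|h| * rho ^+ 2,
      forall h x a, sqnorm x <= rho ^+ 2 -> a \in D ->
        `|Psi h x a - x a - h * B x a| <= K * h ^+ 2 * rho ^+ 3 &
      forall x y delta a, sqnorm x <= rho ^+ 2 -> sqnorm y <= rho ^+ 2 ->
        (forall b, b \in D -> `|x b - y b| <= delta) -> a \in D ->
        `|B x a - B y a| <= K * rho * delta].

(** A time step for x' = B x which is exact for the two conserved structures,
    the Gaussian law and the Euclidean norm, and approximate only for the
    trajectory. *)
Record good_step Psi B : Prop := GoodStep {
  step_law : forall h F, gauss_family P D F -> gauss_family P D (fun w => Psi h (F w));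
  step_sqnorm : forall h x, sqnorm (Psi h x) = sqnorm x;
  step_err : exists2 K, 0 <= K & step_error Psi B K }.

Definition splits B : Prop := exists Psi, good_step Psi B.

Lemma sqnorm_coord x a rho : 0 <= rho -> sqnorm x <= rho ^+ 2 -> a \in D -> `|x a| <= rho.
Proof.
move=> r0 xr aD; rewrite -(@ler_pXn2r _ 2)//= ?nnegrE//.
rewrite real_normK ?num_real//; apply: le_trans xr.
by rewrite /sqnorm (bigD1_seq a)//= lerDl sumr_ge0// => b _; rewrite sqr_ge0.
Qed.

Lemma splits_ext B1 B2 : (forall x a, a \in D -> B1 x a = B2 x a) -> splits B1 -> splits B2.
Proof.
move=> B12 [Psi [l n [K K0 e]]]; exists Psi; split => //; exists K => // rho r1.
have [e1 e2 e3] := e rho r1; split => //.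
  by move=> h x a xr aD; rewrite -B12//; exact: e2.
by move=> x y de a xr yr xy aD; rewrite -!B12//; exact: e3.
Qed.

Lemma splits0 : splits (fun _ _ => 0).
Proof.
exists (fun _ x => x); split => //; exists 0 => // rho r1; split.
- by move=> h x a _ _; rewrite subrr normr0 !mul0r.
- by move=> h x a _ _; rewrite subrr mulr0 subrr normr0 !mul0r.
- by move=> x y de a _ _ _ _; rewrite subrr normr0 !mul0r.
Qed.

(** Lie splitting: a step for B1 followed by a step for B2 is a step for B1 +
    B2. The extra error comes from evaluating B2 after the first substep, and is
    of order h ^ 2 by the Lipschitz bound. Since each substep preserves the norm,
    both are evaluated in the same ball. *)
Lemma splits_add B1 B2 : splits B1 -> splits B2 -> splits (fun x a => B1 x a + B2 x a).
Proof.
move=> [Psi1 [l1 n1 [K1 K10 e1]]] [Psi2 [l2 n2 [K2 K20 e2]]].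
exists (fun h x => Psi2 h (Psi1 h x)); split.
- by move=> h F gF; exact: l2 (l1 h _ gF).
- by move=> h x; rewrite n2 n1.
exists (K1 + K2 + K1 * K2); first by rewrite !addr_ge0// mulr_ge0.
move=> rho r1; have [a1 b1 c1] := e1 rho r1; have [a2 b2 c2] := e2 rho r1.
have r0 : 0 <= rho by apply: le_trans r1.
split => [h x a xr aD|h x a xr aD|x y de a xr yr xy aD].
- have y_r : sqnorm (Psi1 h x) <= rho ^+ 2 by rewrite n1.
  have A1 := a1 h x a xr aD; have A2 := a2 h (Psi1 h x) a y_r aD.
  have := ler_normD (Psi2 h (Psi1 h x) a - Psi1 h x a) (Psi1 h x a - x a).
  rewrite addrA subrK => H; apply: (le_trans H).
  have Z : 0 <= K1 * K2 * `|h| * rho ^+ 2 by rewrite !mulr_ge0// exprn_ge0.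
  lra.
- have y_r : sqnorm (Psi1 h x) <= rho ^+ 2 by rewrite n1.
  have A1 := b1 h x a xr aD; have A2 := b2 h (Psi1 h x) a y_r aD.
  have A3 := c2 (Psi1 h x) x (K1 * `|h| * rho ^+ 2) a y_r xr (fun b => a1 h x b xr) aD.
  have E : Psi2 h (Psi1 h x) a - x a - h * (B1 x a + B2 x a) =
     (Psi2 h (Psi1 h x) a - Psi1 h x a - h * B2 (Psi1 h x) a) +
     (Psi1 h x a - x a - h * B1 x a) + h * (B2 (Psi1 h x) a - B2 x a) by ring.
  rewrite E; apply: (le_trans (ler_normD _ _)); apply: (le_trans (lerD (ler_normD _ _) (lexx _))).
  have A4 : `|h * (B2 (Psi1 h x) a - B2 x a)| <= K1 * K2 * h ^+ 2 * rho ^+ 3.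
    rewrite normrM; apply: (le_trans (ler_wpM2l (normr_ge0 h) A3)).
    by rewrite -[h ^+ 2]real_normK ?num_real// le_eqVlt; apply/orP; left; apply/eqP; ring.
  lra.
- have A1 := c1 x y de a xr yr xy aD; have A2 := c2 x y de a xr yr xy aD.
  have de0 : 0 <= de by apply: le_trans (xy a aD).
  have -> : B1 x a + B2 x a - (B1 y a + B2 y a) = (B1 x a - B1 y a) + (B2 x a - B2 y a) by ring.
  apply: (le_trans (ler_normD _ _)).
  have Z : 0 <= K1 * K2 * rho * de by rewrite !mulr_ge0.
  lra.
Qed.

Lemma splits_sum (E : eqType) (s : seq E) (fld : E -> (I -> R) -> I -> R) :
  (forall e, e \in s -> splits (fld e)) ->
  splits (fun x a => \sum_(e <- s) fld e x a).
Proof.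
elim: s => [_|e s IH H].
  by apply: splits_ext splits0 => x a _; rewrite big_nil.
apply: splits_ext (splits_add (H e (mem_head e s)) (IH _)).
  by move=> x a _; rewrite big_cons.
by move=> f fs; apply: H; rewrite inE fs orbT.
Qed.

(** The generator of the rotations of the plane (i, j) with angular speed -
    beta * gain k x; when k differs from i and j, the speed is constant along the
    flow. *)
Definition rot_field (i j : I) (beta : R) (k : option I) x : I -> R := fun a =>
  if a == i then beta * gain k x * x j
  else if a == j then - (beta * gain k x * x i) else 0.

Lemma sqnorm_rot i j theta x : i \in D -> j \in D -> i != j ->
  sqnorm (rot i j theta x) = sqnorm x.
Proof.
move=> iD jD ij; rewrite /sqnorm.
have ji : (j == i) = false by rewrite eq_sym (negbTE ij).
have jDi : j \in [seq a <- D | a != i] by rewrite mem_filter eq_sym ij.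
have uDi : uniq [seq a <- D | a != i] by exact: filter_uniq.
rewrite (bigD1_seq i)//= [RHS](bigD1_seq i)//= -big_filter -[in RHS]big_filter.
rewrite (bigD1_seq j)//= [in RHS](bigD1_seq j)//= !addrA; congr (_ + _).
  rewrite /rot eqxx ji eqxx.
  transitivity ((cos theta ^+ 2 + sin theta ^+ 2) * (x i ^+ 2 + x j ^+ 2)); first by ring.
  by rewrite cos2Dsin2 mul1r.
rewrite !big_filter_cond; apply: eq_bigr => a /andP[ai aj].
by rewrite /rot (negbTE ai) (negbTE aj).
Qed.

(** A rotation by the angle - h * beta * gain k x is even the exact flow of
    its generator; the estimates are those of sine and cosine at small angles. *)
Lemma splits_rot i j beta k : i \in D -> j \in D -> i != j ->
  (if k is Some a then [&& a \in D, a != i & a != j] else true) ->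
  splits (rot_field i j beta k).
Proof.
move=> iD jD ij kij.
have ji : (j == i) = false by rewrite eq_sym (negbTE ij).
exists (fun h x => rot i j (- (h * beta) * gain k x) x); split.
- move=> h F gF; apply: (gauss_family_rot (f := fun z => - (h * beta) * z)) => //.
  by apply: measurable_funM.
- by move=> h x; rewrite sqnorm_rot.
have b0 := normr_ge0 beta; have b20 := sqr_ge0 beta.
have K0 : 0 <= 2 * `|beta| + 2 * beta ^+ 2 by lra.
exists (2 * `|beta| + 2 * beta ^+ 2) => //.
move=> rho r1; have r0 : 0 <= rho by apply: le_trans r1.
have gb x : sqnorm x <= rho ^+ 2 -> `|gain k x| <= rho.
  move=> xr; rewrite /gain; case: k kij => [a /and3P[aD _ _]|_]; last by rewrite normr1.
  exact: sqnorm_coord.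
have tb h x : sqnorm x <= rho ^+ 2 -> `|- (h * beta) * gain k x| <= `|h| * `|beta| * rho.
  by move=> xr; rewrite normrM normrN normrM ler_wpM2l ?mulr_ge0// gb.
split => [h x a xr aD|h x a xr aD|x y de a xr yr xy aD].
- have xi := sqnorm_coord r0 xr iD; have xj := sqnorm_coord r0 xr jD.
  have T := tb h x xr; set t := - (h * beta) * gain k x in T *.
  have key (p q : R) : `|p| <= rho -> `|q| <= rho ->
      `|(cos t - 1) * p| + `|sin t * q| <= (2 * `|beta| + 2 * beta ^+ 2) * `|h| * rho ^+ 2.
    move=> pr qr; rewrite !normrM.
    have H1 : `|cos t - 1| * `|p| <= (`|h| * `|beta| * rho) * rho.
      by apply: ler_pM => //; exact: le_trans (normr_cosB1_le t) T.
    have H2 : `|sin t| * `|q| <= (`|h| * `|beta| * rho) * rho.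
      by apply: ler_pM => //; exact: le_trans (normr_sin_le t) T.
    have Z : 0 <= beta ^+ 2 * `|h| * rho ^+ 2 by rewrite mulr_ge0 ?exprn_ge0// mulr_ge0.
    by lra.
  rewrite /rot; case: eqP => [->|_].
    have -> : cos t * x i - sin t * x j - x i = (cos t - 1) * x i - sin t * x j by ring.
    by apply: (le_trans (ler_normB _ _)); exact: key.
  case: eqP => [->|_].
    have -> : sin t * x i + cos t * x j - x j = (cos t - 1) * x j + sin t * x i by ring.
    by apply: (le_trans (ler_normD _ _)); exact: key.
  by rewrite subrr normr0 mulr_ge0 ?exprn_ge0// mulr_ge0.
- have xi := sqnorm_coord r0 xr iD; have xj := sqnorm_coord r0 xr jD.
  have T := tb h x xr; rewrite /rot_field.
  have tE : h * (beta * gain k x) = - (- (h * beta) * gain k x) by ring.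
  set t := - (h * beta) * gain k x in T tE *.
  have t2 : t ^+ 2 <= (`|h| * `|beta| * rho) ^+ 2.
    by rewrite -[t ^+ 2]real_normK ?num_real// ler_pXn2r// nnegrE ?mulr_ge0.
  have hb : (`|h| * `|beta| * rho) ^+ 2 = h ^+ 2 * beta ^+ 2 * rho ^+ 2.
    by rewrite !exprMn !real_normK ?num_real.
  rewrite hb in t2.
  have key (p q : R) : `|p| <= rho -> `|q| <= rho ->
      `|(cos t - 1) * p| + `|(sin t - t) * q| <= (2 * `|beta| + 2 * beta ^+ 2) * h ^+ 2 * rho ^+ 3.
    move=> pr qr; rewrite !normrM.
    have H1 : `|cos t - 1| * `|p| <= (h ^+ 2 * beta ^+ 2 * rho ^+ 2) * rho.
      by apply: ler_pM => //; exact: le_trans (normr_cosB1_le2 t) t2.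
    have H2 : `|sin t - t| * `|q| <= (h ^+ 2 * beta ^+ 2 * rho ^+ 2) * rho.
      by apply: ler_pM => //; exact: le_trans (normr_sinB_le2 t) t2.
    have Z : 0 <= `|beta| * h ^+ 2 * rho ^+ 3 by rewrite mulr_ge0 ?exprn_ge0// mulr_ge0 ?sqr_ge0.
    by lra.
  rewrite /rot; case: eqP => [->|_].
    have -> : cos t * x i - sin t * x j - x i - h * (beta * gain k x * x j) =
       (cos t - 1) * x i - (sin t - t) * x j by rewrite [h * _]mulrA tE; ring.
    by apply: (le_trans (ler_normB _ _)); exact: key.
  case: eqP => [->|_].
    have -> : sin t * x i + cos t * x j - x j - h * - (beta * gain k x * x i) =
       (cos t - 1) * x j + (sin t - t) * x i by rewrite mulrN [h * _]mulrA tE; ring.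
    by apply: (le_trans (ler_normD _ _)); exact: key.
  by rewrite mulr0 subr0 subrr normr0 mulr_ge0 ?exprn_ge0// mulr_ge0 ?sqr_ge0.
- have de0 : 0 <= de by apply: le_trans (xy a aD).
  have gl : `|gain k x - gain k y| <= de.
    rewrite /gain; case: k kij {gb tb} => [b /and3P[bD _ _]|_]; first exact: xy.
    by rewrite subrr normr0.
  have gy := gb y yr.
  have key b : b \in D ->
     `|beta * gain k x * x b - beta * gain k y * y b| <= (2 * `|beta| + 2 * beta ^+ 2) * rho * de.
    move=> bD; have xb := sqnorm_coord r0 xr bD; have xyb := xy b bD.
    have -> : beta * gain k x * x b - beta * gain k y * y b =
       beta * ((gain k x - gain k y) * x b + gain k y * (x b - y b)) by ring.
    rewrite normrM; have := ler_normD ((gain k x - gain k y) * x b) (gain k y * (x b - y b)).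
    rewrite !normrM => H.
    have H1 : `|gain k x - gain k y| * `|x b| <= de * rho by apply: ler_pM.
    have H2 : `|gain k y| * `|x b - y b| <= rho * de by apply: ler_pM.
    have H3 : `|beta| * `|(gain k x - gain k y) * x b + gain k y * (x b - y b)| <= `|beta| * (2 * rho * de).
      by apply: ler_wpM2l => //; lra.
    have Z : 0 <= beta ^+ 2 * rho * de by rewrite mulr_ge0// mulr_ge0.
    by apply: (le_trans H3); lra.
  rewrite /rot_field; case: eqP => [_|_]; first exact: key.
  case: eqP => [_|_]; last by rewrite subrr normr0 mulr_ge0// mulr_ge0.
  by rewrite -opprD normrN; exact: key.
Qed.

Lemma rot_linear i j theta x y c a :
  rot i j theta (fun b => x b + c * y b) a = rot i j theta x a + c * rot i j theta y a.
Proof. by rewrite /rot; case: ifP => _; [ring|case: ifP => _ //; ring]. Qed.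

Lemma rotK i j theta x a : i != j -> rot i j (- theta) (rot i j theta x) a = x a.
Proof.
move=> ij; have ji : (j == i) = false by rewrite eq_sym (negbTE ij).
rewrite /rot eqxx ji eqxx cosN sinN; case: eqP => [->|_].
  by transitivity ((cos theta ^+ 2 + sin theta ^+ 2) * x i); [ring|rewrite cos2Dsin2 mul1r].
case: eqP => [->|//].
by transitivity ((cos theta ^+ 2 + sin theta ^+ 2) * x j); [ring|rewrite cos2Dsin2 mul1r].
Qed.

Lemma rot_bound i j theta x M a : i \in D -> j \in D -> a \in D ->
  (forall b, b \in D -> `|x b| <= M) -> `|rot i j theta x a| <= 2 * M.
Proof.
move=> iD jD aD xM.
have M0 : 0 <= M by apply: le_trans (xM a aD).
have c1 : `|cos theta| <= 1 by rewrite ler_norml cos_geN1 cos_le1.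
have s1 : `|sin theta| <= 1 by rewrite ler_norml sin_geN1 sin_le1.
have key p q (u v : R) : p \in D -> q \in D -> `|u| <= 1 -> `|v| <= 1 -> `|u * x p| + `|v * x q| <= 2 * M.
  move=> pD qD u1 v1; rewrite !normrM mulrDl mul1r.
  by apply: lerD; rewrite -[leRHS]mul1r; apply: ler_pM => //; exact: xM.
rewrite /rot; case: ifP => _; first by apply: (le_trans (ler_normB _ _)); exact: key.
case: ifP => _; first by apply: (le_trans (ler_normD _ _)); exact: key.
by apply: (le_trans (xM a aD)); lra.
Qed.

(** A fixed rotation preserves the Gaussian law and the norm, so good steps
    may be written in rotated coordinates. *)
Lemma splits_conj i j theta B : i \in D -> j \in D -> i != j -> splits B ->
  splits (fun x => rot i j (- theta) (B (rot i j theta x))).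
Proof.
move=> iD jD ij [Psi [l n [K K0 e]]].
exists (fun h x => rot i j (- theta) (Psi h (rot i j theta x))).
have lr th F : gauss_family P D F -> gauss_family P D (fun w => rot i j th (F w)).
  by move=> gF; exact: (gauss_family_rot (k := None) (f := cst th) gF uD iD jD ij isT (measurable_cst _)).
split.
- by move=> h F gF; apply: (lr (- theta)); apply: l; exact: lr.
- by move=> h x; rewrite sqnorm_rot// n sqnorm_rot.
exists (4 * K); first by rewrite mulr_ge0.
move=> rho r1; have [e1 e2 e3] := e rho r1.
have r0 : 0 <= rho by apply: le_trans r1.
split => [h x a xr aD|h x a xr aD|x y de a xr yr xy aD].
- rewrite -[x a](rotK theta x a ij); set q := rot i j theta x.
  have qr : sqnorm q <= rho ^+ 2 by rewrite sqnorm_rot.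
  have -> : rot i j (- theta) (Psi h q) a - rot i j (- theta) q a =
     rot i j (- theta) (fun b => Psi h q b + (-1) * q b) a by rewrite rot_linear mulN1r.
  apply: (le_trans (rot_bound (- theta) iD jD aD _)).
    by move=> b bD; rewrite mulN1r; exact: (e1 h q b qr bD).
  have Z : 0 <= K * `|h| * rho ^+ 2 by rewrite !mulr_ge0// exprn_ge0.
  by lra.
- rewrite -[x a](rotK theta x a ij); set q := rot i j theta x.
  have qr : sqnorm q <= rho ^+ 2 by rewrite sqnorm_rot.
  have -> : rot i j (- theta) (Psi h q) a - rot i j (- theta) q a - h * rot i j (- theta) (B q) a =
     rot i j (- theta) (fun b => (Psi h q b + (-1) * q b) + (- h) * B q b) a.
    by rewrite rot_linear (rot_linear _ _ _ (Psi h q)); ring.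
  apply: (le_trans (rot_bound (- theta) iD jD aD _)).
    by move=> b bD; rewrite mulN1r mulNr; exact: (e2 h q b qr bD).
  have Z : 0 <= K * h ^+ 2 * rho ^+ 3 by rewrite mulr_ge0 ?exprn_ge0// mulr_ge0 ?sqr_ge0.
  by lra.
- set q := rot i j theta x; set p := rot i j theta y.
  have qr : sqnorm q <= rho ^+ 2 by rewrite sqnorm_rot.
  have pr : sqnorm p <= rho ^+ 2 by rewrite sqnorm_rot.
  have qp b : b \in D -> `|q b - p b| <= 2 * de.
    move=> bD.
    have -> : q b - p b = rot i j theta (fun b => x b + (-1) * y b) b by rewrite rot_linear mulN1r.
    by apply: rot_bound => // b' b'D; rewrite mulN1r; exact: xy.
  have -> : rot i j (- theta) (B q) a - rot i j (- theta) (B p) a =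
     rot i j (- theta) (fun b => B q b + (-1) * B p b) a by rewrite rot_linear mulN1r.
  apply: (le_trans (rot_bound (- theta) iD jD aD _)).
    by move=> b bD; rewrite mulN1r; exact: (e3 q p (2 * de) b qr pr qp bD).
  by rewrite le_eqVlt; apply/orP; left; apply/eqP; ring.
Qed.

End splitting.

(** * The truncated equation splits into rotations *)

(** The index (n, true) carries the real part of the mode n, and (n, false)
    its imaginary part. *)
Definition modes (N : nat) : seq (nat * bool) :=
  [seq (n, b) | n <- iota 1 N, b <- [:: true; false]].

Lemma mem_modes N n b : ((n, b) \in modes N) = (0 < n <= N)%N.
Proof.
rewrite /modes; apply/allpairsP/idP => [[[n' b'] /= [+ _ [-> _]]]|nN].
  by rewrite mem_iota add1n ltnS.
by exists (n, b); split => //=; [rewrite mem_iota add1n ltnS|case: b; rewrite !inE].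
Qed.

Lemma uniq_modes N : uniq (modes N).
Proof.
apply: allpairs_uniq => //; first exact: iota_uniq.
by move=> [? ?] [? ?] _ _ [-> ->].
Qed.

Section bbm_field.
Context {R : realType}.
Implicit Types (x : nat * bool -> R) (k l m n N : nat) (beta : R).

Definition cvec x n : R[i] := Complex (x (n, true)) (x (n, false)).

Definition realify (f : nat -> R[i]) : nat * bool -> R :=
  fun a => if a.2 then complex.Re (f a.1) else complex.Im (f a.1).

(** The part of the quadratic interaction that involves the modes k, l and k +
    l and in which l only acts as a coefficient: the modes k and k + l exchange
    energy at a rate given by the mode l. *)
Definition triad_field beta k l x m : R[i] :=
  (if m == (k + l)%N then - 'i%C * beta%:C%C * (cvec x k * cvec x l) else 0) +
  (if m == k then - 'i%C * beta%:C%C * (cvec x (k + l) * (cvec x l)^*%C) else 0).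

Definition linear_field beta n x m : R[i] :=
  if m == n then - 'i%C * beta%:C%C * cvec x n else 0.

Context d (Om : measurableType d) (P : probability Om R).

Lemma splits_linear N beta n : (0 < n <= N)%N ->
  splits P (modes N) (fun x => realify (linear_field beta n x)).
Proof.
move=> nN.
have nD b : (n, b) \in modes N by rewrite mem_modes.
have tf : (n, true) != (n, false) by rewrite xpair_eqE eqxx.
apply: splits_ext (splits_rot P (uniq_modes N) beta (k := None) (nD true) (nD false) tf isT).
move=> x [m b] _; rewrite /rot_field /realify /linear_field /cvec /= !xpair_eqE.
by case: (m == n); case: b; rewrite /= ?simpc//=; ring.
Qed.

(** For distinct k and l, the interaction is a sum of four rotations, of the
    planes spanned by one component of the mode k + l and one of the mode k; their
    speeds are the components of the mode l. *)
Lemma splits_triad_neq N beta k l : (0 < k)%N -> (0 < l)%N -> (k + l <= N)%N -> k != l ->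
  splits P (modes N) (fun x => realify (triad_field beta k l x)).
Proof.
move=> k0 l0 klN kl.
have S i j c : i \in modes N -> j \in modes N -> c \in modes N ->
    [&& i != j, c != i & c != j] -> splits P (modes N) (rot_field i j beta (Some c)).
  move=> iD jD cD /and3P[ij ci cj]; apply: splits_rot => //; first exact: uniq_modes.
  by rewrite cD ci.
have nk : (k + l == k) = false by lia.
have nl : (k + l == l) = false by lia.
have kn : (k == k + l) = false by lia.
have ln : (l == k + l) = false by lia.
have lk : (l == k) = false by rewrite eq_sym (negbTE kl).
have nD b : (k + l, b)%N \in modes N by rewrite mem_modes; lia.
have kD b : (k, b) \in modes N by rewrite mem_modes; lia.
have lD b : (l, b) \in modes N by rewrite mem_modes; lia.
have S1 : splits P (modes N) (rot_field (k + l, true)%N (k, true) beta (Some (l, false))).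
  by apply: S => //; rewrite !xpair_eqE ?nk ?ln ?lk.
have S2 : splits P (modes N) (rot_field (k + l, false)%N (k, false) beta (Some (l, false))).
  by apply: S => //; rewrite !xpair_eqE ?nk ?ln ?lk.
have S3 : splits P (modes N) (rot_field (k + l, true)%N (k, false) beta (Some (l, true))).
  by apply: S => //; rewrite !xpair_eqE ?nk ?ln ?lk.
have S4 : splits P (modes N) (rot_field (k, true) (k + l, false)%N beta (Some (l, true))).
  by apply: S => //; rewrite !xpair_eqE ?kn ?ln ?lk.
apply: splits_ext (splits_add (splits_add S1 S2) (splits_add S3 S4)) => x [m b] _.
rewrite /rot_field /realify /triad_field /cvec /gain /= !xpair_eqE.
case: (eqVneq m (k + l)%N) => [mn|mn]; rewrite ?mn ?nk/=.
  by case: b; rewrite /= ?addr0 ?simpc/=; ring.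
by case: (eqVneq m k) => [mk|mk]; case: b; rewrite /= ?simpc ?add0r ?addr0/=; ring.
Qed.

(** When k = l, the planes that pair the imaginary part of the mode 2 k with a
    component of the mode k would be driven by a coordinate of that same plane,
    because the field of that part is x_k ^ 2 - y_k ^ 2. Turning the plane of the
    mode k by 45 degrees changes this difference of squares into a product of the
    two coordinates, and the rotations become admissible. *)
Lemma splits_triad_eq N beta k : (0 < k)%N -> (k + k <= N)%N ->
  splits P (modes N) (fun x => realify (triad_field beta k k x)).
Proof.
move=> k0 klN.
have S i j c : i \in modes N -> j \in modes N -> c \in modes N ->
    [&& i != j, c != i & c != j] -> splits P (modes N) (rot_field i j beta (Some c)).
  move=> iD jD cD /and3P[ij ci cj]; apply: splits_rot => //; first exact: uniq_modes.
  by rewrite cD ci.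
have nk : (k + k == k) = false by lia.
have kn : (k == k + k) = false by lia.
have nD b : (k + k, b)%N \in modes N by rewrite mem_modes; lia.
have kD b : (k, b) \in modes N by rewrite mem_modes; lia.
have S1 : splits P (modes N) (rot_field (k + k, true)%N (k, true) beta (Some (k, false))).
  by apply: S => //; rewrite !xpair_eqE ?nk ?kn ?eqxx.
have S3 : splits P (modes N) (rot_field (k + k, true)%N (k, false) beta (Some (k, true))).
  by apply: S => //; rewrite !xpair_eqE ?nk ?kn ?eqxx.
have S2 : splits P (modes N) (rot_field (k + k, false)%N (k, true) beta (Some (k, false))).
  by apply: S => //; rewrite !xpair_eqE ?nk ?kn ?eqxx.
have S4 : splits P (modes N) (rot_field (k + k, false)%N (k, false) beta (Some (k, true))).
  by apply: S => //; rewrite !xpair_eqE ?nk ?kn ?eqxx.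
have ft : (k, false) != (k, true) by rewrite xpair_eqE eqxx.
have C := splits_conj (uniq_modes N) (pi / 4) (kD false) (kD true) ft (splits_add S2 S4).
apply: splits_ext (splits_add (splits_add S1 S3) C) => x [m b] _.
have sc : sin (pi / 4) = cos (pi / 4) :> R.
  rewrite -[RHS]cosN -sinDpihalf; congr sin; by field.
have c2 : cos (pi / 4) * cos (pi / 4) = 2^-1 :> R.
  have h := cos_pihalf R; rewrite (_ : pi / 2 = pi / 4 *+ 2) in h; last by rewrite -mulr_natr; field.
  by rewrite cos_mulr2n in h; move: h; rewrite expr2 -mulr_natr => h; lra.
rewrite /rot_field /realify /triad_field /cvec /gain /rot /= !xpair_eqE cosN sinN sc.
rewrite !eqxx /= ?nk ?kn ?andbF /=.
set c := cos (pi / 4) in c2 *.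
(* two identities below hold only because 2 c ^ 2 = 1 *)
have lin (u v w : R) : u - v = (c * c - 2^-1) * w -> u = v.
  by rewrite c2 subrr mul0r => /subr0_eq.
case: (eqVneq m (k + k)%N) => [mn|mn].
  rewrite ?mn ?nk ?kn /=; case: b; rewrite /= ?simpc/=; first by ring.
  by apply: (lin _ _ (2 * beta * (x (k, false) ^+ 2 - x (k, true) ^+ 2))); field.
case: (eqVneq m k) => [mk|mk]; case: b; rewrite /= ?simpc/=; last 2 first.
- by ring.
- by ring.
- by apply: (lin _ _ (2 * beta * x (k, true) * x (k + k, false)%N)); field.
- by apply: (lin _ _ (- 2 * beta * x (k, false) * x (k + k, false)%N)); field.
Qed.

(** The truncated equation in coordinates in which the datum is a standard
    Gaussian family; beta k l is the rate of the interaction of k with k + l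
    driven by l. *)
Definition truncated_field (phi : nat -> R) (beta : nat -> nat -> R) N x m : R[i] :=
  \sum_(n <- iota 1 N) linear_field (phi n) n x m +
  \sum_(k <- iota 1 N) \sum_(l <- iota 1 N | (k + l <= N)%N) triad_field (beta k l) k l x m.

Lemma realifyD (f g : nat -> R[i]) a :
  realify (fun m => f m + g m) a = realify f a + realify g a.
Proof. by rewrite /realify; case: ifP => _; rewrite raddfD. Qed.

Lemma realify_sum (E : Type) (s : seq E) (f : E -> nat -> R[i]) a :
  realify (fun m => \sum_(e <- s) f e m) a = \sum_(e <- s) realify (f e) a.
Proof. by rewrite /realify; case: ifP => _; rewrite raddf_sum. Qed.

Lemma splits_truncated (phi : nat -> R) (beta : nat -> nat -> R) N :
  splits P (modes N) (fun x => realify (truncated_field phi beta N x)).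
Proof.
have iN n : n \in iota 1 N -> (0 < n <= N)%N by rewrite mem_iota add1n ltnS.
have S1 : splits P (modes N) (fun x a => \sum_(n <- iota 1 N) realify (linear_field (phi n) n x) a).
  by apply: splits_sum => n /iN; exact: splits_linear.
have S2 : splits P (modes N) (fun x a => \sum_(k <- iota 1 N) \sum_(l <- [seq l <- iota 1 N | (k + l <= N)%N])
    realify (triad_field (beta k l) k l x) a).
  apply: splits_sum => k /iN /andP[k0 _]; apply: splits_sum => l.
  rewrite mem_filter => /andP[klN /iN/andP[l0 _]].
  have [kl|kl] := eqVneq k l; last exact: splits_triad_neq.
  by rewrite -kl in klN *; exact: splits_triad_eq.
apply: splits_ext (splits_add S1 S2) => x a _.
rewrite /truncated_field realifyD realify_sum; congr (_ + _).
rewrite realify_sum; apply: eq_bigr => k _.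
by rewrite -realify_sum; congr (realify _ a); apply/funext => m; rewrite big_filter.
Qed.

End bbm_field.

(** * Estimates for the field in Fourier coordinates *)

Section complex_modulus.
Context {R : realType}.
Implicit Types z w : R[i].
Local Notation nc := (@Normc.normc R).

Lemma normc_ge0 z : 0 <= nc z. Proof. by case: z => a b; exact: sqrtr_ge0. Qed.

Lemma normcB_le z w : nc (z - w) <= nc z + nc w.
Proof. by rewrite -(normcN w) le_normcD. Qed.

Lemma normc_distC z w : nc (z - w) = nc (w - z).
Proof. by rewrite -normcN opprB. Qed.

Lemma normc_real (a : R) : nc a%:C%C = `|a|.
Proof. by rewrite /= expr0n/= addr0 sqrtr_sqr. Qed.

Lemma normc_i : nc 'i%C = 1.
Proof. by rewrite /= expr0n/= add0r expr1n sqrtr1. Qed.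

Lemma normc_conj z : nc z^*%C = nc z.
Proof. by case: z => a b /=; rewrite sqrrN. Qed.

Lemma sqr_normcE z : nc z ^+ 2 = complex.Re z ^+ 2 + complex.Im z ^+ 2.
Proof. by case: z => a b /=; rewrite sqr_sqrtr// addr_ge0 ?sqr_ge0. Qed.

Lemma normr_Re_le z : `|complex.Re z| <= nc z.
Proof.
rewrite -(@ler_pXn2r _ 2)//= ?nnegrE ?normc_ge0// real_normK ?num_real// sqr_normcE.
by rewrite lerDl sqr_ge0.
Qed.

Lemma normr_Im_le z : `|complex.Im z| <= nc z.
Proof.
rewrite -(@ler_pXn2r _ 2)//= ?nnegrE ?normc_ge0// real_normK ?num_real// sqr_normcE.
by rewrite lerDr sqr_ge0.
Qed.

Lemma normc_le_ReIm z : nc z <= `|complex.Re z| + `|complex.Im z|.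
Proof.
rewrite {1}(complexE z); apply: (le_trans (le_normcD _ _)).
by rewrite Normc.normcM normc_i mul1r !normc_real.
Qed.

Lemma normc_sum_le (E : Type) (s : seq E) (p : pred E) (f : E -> R[i]) :
  nc (\sum_(e <- s | p e) f e) <= \sum_(e <- s | p e) nc (f e).
Proof.
elim/big_ind2 : _ => //; first by rewrite Normc.normc0.
by move=> z a w b za wb; apply: (le_trans (le_normcD _ _)); exact: lerD.
Qed.

Lemma normc_iM (a : R) z : nc (- 'i%C * a%:C%C * z) = `|a| * nc z.
Proof. by rewrite !Normc.normcM normcN normc_i mul1r normc_real. Qed.

End complex_modulus.

Section bbm_numbers.
Context {R : realType}.

Definition phin (n : nat) : R := bbm_phi n%:Z.
Definition lambdan (n : nat) : R := bbm_lambda n%:Z.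

Lemma phinE n : phin n = n%:R / (1 + n%:R ^+ 2).
Proof. by rewrite /phin /bbm_phi -pmulrn. Qed.

Lemma sqr_lambdan n : lambdan n ^+ 2 = (1 + n%:R ^+ 2)^-1.
Proof.
by rewrite /lambdan /bbm_lambda -pmulrn exprVn sqr_sqrtr// addr_ge0 ?sqr_ge0.
Qed.

Lemma lambdan_gt0 n : 0 < lambdan n.
Proof. by rewrite /lambdan /bbm_lambda invr_gt0 sqrtr_gt0 ltr_pwDl ?sqr_ge0. Qed.

Lemma lambdan_le1 n : lambdan n <= 1.
Proof.
rewrite -(@ler_pXn2r _ 2)//= ?nnegrE ?ler01//; last by rewrite ltW ?lambdan_gt0.
by rewrite sqr_lambdan expr1n invf_le1 ?lerDl ?sqr_ge0// ltr_pwDl ?sqr_ge0.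
Qed.

Lemma phin_lambdan n : phin n = n%:R * lambdan n ^+ 2.
Proof. by rewrite phinE sqr_lambdan. Qed.

Lemma den_gt0 n : 0 < 1 + n%:R ^+ 2 :> R. Proof. by rewrite ltr_pwDl ?sqr_ge0. Qed.

Lemma phin_ge0 n : 0 <= phin n.
Proof. by rewrite phinE divr_ge0// ltW// den_gt0. Qed.

Lemma phin_le1 n : phin n <= 1.
Proof.
rewrite phinE ler_pdivrMr ?den_gt0// mul1r.
by have := sqr_ge0 (n%:R - 1 : R); have : 0 <= n%:R :> R by []; rewrite sqrrB expr1n mulr1; lra.
Qed.

Lemma phin_lower n : (0 < n)%N -> 1 <= phin n * (1 + n%:R).
Proof.
move=> n0; rewrite phinE mulrAC ler_pdivlMr ?den_gt0// mul1r.
have : 1 <= n%:R :> R by rewrite ler1n.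
by rewrite mulrDr mulr1 -expr2; lra.
Qed.

(** Comparison with the telescoping sum of 2 / n - 2 / (n + 1). *)
Lemma sum_sqr_phin N : \sum_(n <- iota 1 N) phin n ^+ 2 <= 2.
Proof.
suff H : \sum_(n <- iota 1 N) phin n ^+ 2 <= 2 - 2 / N.+1%:R.
  by apply: (le_trans H); rewrite gerBl divr_ge0.
elim: N => [|N IH]; first by rewrite big_nil divr1 subrr.
rewrite -[N.+1]addn1 iotaD big_cat big_seq1 add1n /= addn1.
apply: (le_trans (lerD IH (lexx _))).
set m : R := N.+1%:R.
have m1 : 1 <= m by rewrite ler1n.
have -> : N.+2%:R = m + 1 :> R by rewrite -natr1.
rewrite phinE -/m.
have d0 : 0 < 1 + m ^+ 2 by exact: den_gt0.
have -> : (m / (1 + m ^+ 2)) ^+ 2 = 1 / (1 + m ^+ 2) - 1 / (1 + m ^+ 2) ^+ 2.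
  by field; rewrite gt_eqF.
have h : 1 / (1 + m ^+ 2) <= 2 / m - 2 / (m + 1).
  have -> : 2 / m - 2 / (m + 1) = 2 / (m * (m + 1)).
    by field; apply/andP; split; rewrite gt_eqF//; lra.
  rewrite ler_pdivrMr// mulrAC ler_pdivlMr; last by rewrite mulr_gt0//; lra.
  by rewrite mul1r; have := sqr_ge0 (m - 1); rewrite sqrrB expr1n mulr1 mulrDr mulr1 -!expr2; lra.
have h2 : 0 <= 1 / (1 + m ^+ 2) ^+ 2 by rewrite divr_ge0// sqr_ge0.
move: h h2; set A := 1 / _; set B := 1 / _; set C := 2 / m; set C' := 2 / _.
by lra.
Qed.

End bbm_numbers.

Lemma ler_sum_sub {R : realType} (I : eqType) (s t : seq I) (f : I -> R) :
  uniq s -> uniq t -> {subset s <= t} -> (forall i, 0 <= f i) ->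
  \sum_(i <- s) f i <= \sum_(i <- t) f i.
Proof.
move=> us ut st f0.
have p : perm_eq s [seq i <- t | i \in s].
  apply: uniq_perm => //; first exact: filter_uniq.
  by move=> i; rewrite mem_filter; case: (boolP (i \in s)) => // /st ->.
rewrite (perm_big _ p) big_filter big_mkcond /=; apply: ler_sum => i _.
by case: ifP.
Qed.

Section quadratic.
Context {R : realType}.
Local Notation nc := (@Normc.normc R).
Implicit Types (c e : nat -> R[i]) (N m n k l : nat).

(** The m-th Fourier coefficient of the square of the real trigonometric
    polynomial with coefficients c n for 0 < n <= N, when m > 0; the second sum
    collects the products of a positive and a negative frequency. *)
Definition quad N c m : R[i] :=
  \sum_(k <- iota 1 N) \sum_(l <- iota 1 N | (k + l == m)%N) c k * c l +
  2%:R * \sum_(l <- iota 1 N | (m + l <= N)%N) c (m + l)%N * (c l)^*%C.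

Definition bbm_field (eps : R) N c m : R[i] :=
  - 'i%C * (phin m)%:C%C * (c m + eps%:C%C * quad N c m).

Definition energy N c : R := \sum_(n <- iota 1 N) nc (c n) ^+ 2.

(** An error of size phin k on the mode k is square summable, uniformly in N.
    By the inequality a b <= (a ^ 2 + b ^ 2) / 2, the quadratic term then changes
    by at most a constant multiple of the error, as soon as the two states are
    bounded in L^2. *)
Lemma quad_diff N c c' M E m : 0 <= E ->
  (forall k, k \in iota 1 N -> nc (c k - c' k) <= E * phin k) ->
  energy N c <= M -> energy N c' <= M ->
  nc (quad N c m - quad N c' m) <= 3 * E * (2 + M).
Proof.
move=> E0 cc' cM c'M.
have am (a b : R) : a * b <= (a ^+ 2 + b ^+ 2) / 2.
  by have := sqr_ge0 (a - b); rewrite sqrrB -mulr_natr; lra.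
have term z w z' w' k l : nc (z - z') <= E * phin k -> nc (w - w') <= E * phin l ->
   nc (z * w - z' * w') <= E * ((phin k ^+ 2 + nc w ^+ 2) / 2 + (phin l ^+ 2 + nc z' ^+ 2) / 2).
  move=> zz ww; have -> : z * w - z' * w' = (z - z') * w + z' * (w - w') by ring.
  apply: (le_trans (le_normcD _ _)); rewrite !Normc.normcM mulrDr; apply: lerD.
    apply: (le_trans (ler_wpM2r (normc_ge0 _) zz)).
    by rewrite -mulrA ler_wpM2l.
  apply: (le_trans (ler_wpM2l (normc_ge0 _) ww)).
  by rewrite mulrCA ler_wpM2l// [nc z' * _]mulrC; exact: am.
have phi2 := @sum_sqr_phin R N.
set s1 := \sum_(n <- iota 1 N) phin n ^+ 2 in phi2.
have pos1 k : 0 <= (phin k : R) ^+ 2 by exact: sqr_ge0.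
have pos2 c0 k : 0 <= nc (c0 k) ^+ 2 by exact: sqr_ge0.
(* a sum over pairs with prescribed sum runs at most once over each index *)
have diagl (f : nat -> R) : (forall k, 0 <= f k) ->
    \sum_(k <- iota 1 N) \sum_(l <- iota 1 N | (k + l == m)%N) f k <= \sum_(k <- iota 1 N) f k.
  move=> f0; apply: ler_sum => k _; rewrite -big_filter.
  have : uniq [seq l <- iota 1 N | (k + l == m)%N] by rewrite filter_uniq// iota_uniq.
  have : forall l, l \in [seq l <- iota 1 N | (k + l == m)%N] -> (l = m - k)%N.
    by move=> l; rewrite mem_filter => /andP[/eqP <- _]; rewrite addKn.
  case: [seq l <- iota 1 N | (k + l == m)%N] => [_ _|a s H]; first by rewrite big_nil.
  case: s H => [_ _|b s H]; first by rewrite big_seq1.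
  have -> : a = b by rewrite (H a) ?mem_head// (H b)// !inE eqxx orbT.
  by rewrite /= inE eqxx.
have diagr (f : nat -> R) : (forall k, 0 <= f k) ->
    \sum_(k <- iota 1 N) \sum_(l <- iota 1 N | (k + l == m)%N) f l <= \sum_(k <- iota 1 N) f k.
  move=> f0; have := diagl f f0.
  rewrite (exchange_big_dep xpredT)//=; under eq_bigr do under eq_bigl do rewrite addnC.
  by [].
have shift (f : nat -> R) : (forall k, 0 <= f k) ->
    \sum_(l <- iota 1 N | (m + l <= N)%N) f (m + l)%N <= \sum_(k <- iota 1 N) f k.
  move=> f0; rewrite -big_filter -(big_map (addn m) xpredT f).
  have u1 : uniq (map (addn m) [seq l <- iota 1 N | (m + l <= N)%N]).
    by rewrite map_inj_uniq ?filter_uniq ?iota_uniq//; exact: addnI.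
  apply: ler_sum_sub => //; first exact: iota_uniq.
  by move=> k /mapP[l]; rewrite mem_filter !mem_iota => /andP[ml /andP[l0 lN]] ->; lia.
have drop (f : nat -> R) : (forall k, 0 <= f k) ->
    \sum_(l <- iota 1 N | (m + l <= N)%N) f l <= \sum_(k <- iota 1 N) f k.
  move=> f0; rewrite -big_filter; apply: ler_sum_sub => //; rewrite ?filter_uniq ?iota_uniq//.
  by move=> k; rewrite mem_filter => /andP[].
have s1M : \sum_(k <- iota 1 N) phin k ^+ 2 = s1 by [].
rewrite /quad opprD addrACA -mulrBr -!sumrB.
apply: (le_trans (le_normcD _ _)).
have H1 : nc (\sum_(k <- iota 1 N) (\sum_(l <- iota 1 N | (k + l == m)%N) c k * c l -
     \sum_(l <- iota 1 N | (k + l == m)%N) c' k * c' l)) <= E * (2 + M).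
  apply: (le_trans (normc_sum_le _ _ _)).
  apply: (@le_trans _ _ (\sum_(k <- iota 1 N) \sum_(l <- iota 1 N | (k + l == m)%N)
     E * ((phin k ^+ 2 + nc (c l) ^+ 2) / 2 + (phin l ^+ 2 + nc (c' k) ^+ 2) / 2))).
    rewrite big_seq [leRHS]big_seq; apply: ler_sum => k kN; rewrite -sumrB.
    apply: (le_trans (normc_sum_le _ _ _)).
    rewrite big_seq_cond [leRHS]big_seq_cond; apply: ler_sum => l /andP[lN _].
    by apply: term; exact: cc'.
  under eq_bigr do rewrite -mulr_sumr.
  rewrite -mulr_sumr ler_wpM2l//.
  under eq_bigr do rewrite big_split /= -!mulr_suml !big_split /=.
  rewrite big_split /= -!mulr_suml !big_split /=.
  have A1 := diagl (fun k => phin k ^+ 2) pos1; have A2 := diagr (fun k => phin k ^+ 2) pos1.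
  have A3 := diagl (fun k => nc (c' k) ^+ 2) (pos2 c'); have A4 := diagr (fun k => nc (c k) ^+ 2) (pos2 c).
  by rewrite /energy in cM c'M; rewrite s1M in A1 A2; lra.
have H2 : nc (2%:R * \sum_(l <- iota 1 N | (m + l <= N)%N) (c (m + l)%N * (c l)^*%C - c' (m + l)%N * (c' l)^*%C))
    <= 2 * (E * (2 + M)).
  rewrite Normc.normcM.
  have -> : nc 2%:R = 2 by rewrite -(rmorph_nat (real_complex R)) normc_real ger0_norm.
  rewrite ler_wpM2l//; apply: (le_trans (normc_sum_le _ _ _)).
  apply: (@le_trans _ _ (\sum_(l <- iota 1 N | (m + l <= N)%N)
     E * ((phin (m + l) ^+ 2 + nc (c l) ^+ 2) / 2 + (phin l ^+ 2 + nc (c' (m + l)%N) ^+ 2) / 2))).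
    rewrite big_seq_cond [leRHS]big_seq_cond; apply: ler_sum => l /andP[lN mlN].
    rewrite -(normc_conj (c l)); apply: term.
      by apply: cc'; move: lN; rewrite !mem_iota => /andP[? ?]; lia.
    by rewrite -rmorphB normc_conj; exact: cc'.
  rewrite -mulr_sumr ler_wpM2l// big_split /= -!mulr_suml !big_split /=.
  have A1 := shift (fun k => phin k ^+ 2) pos1; have A2 := drop (fun k => phin k ^+ 2) pos1.
  have A3 := shift (fun k => nc (c' k) ^+ 2) (pos2 c'); have A4 := drop (fun k => nc (c k) ^+ 2) (pos2 c).
  by rewrite /energy in cM c'M; rewrite s1M in A1 A2; lra.
lra.
Qed.

(** The prefactor phin m of the field gives back the weight that quad_diff
    consumes, so that errors measured by E * phin m close up under iteration. *)
Lemma bbm_field_diff (eps : R) N c c' M E m : 0 <= eps -> 0 <= E -> m \in iota 1 N ->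
  (forall k, k \in iota 1 N -> nc (c k - c' k) <= E * phin k) ->
  energy N c <= M -> energy N c' <= M ->
  nc (bbm_field eps N c m - bbm_field eps N c' m) <= phin m * E * (1 + 3 * eps * (2 + M)).
Proof.
move=> eps0 E0 mN cc' cM c'M; rewrite /bbm_field -mulrBr normc_iM ger0_norm ?phin_ge0//.
rewrite -mulrA ler_wpM2l ?phin_ge0//.
have -> : c m + eps%:C%C * quad N c m - (c' m + eps%:C%C * quad N c' m) =
  (c m - c' m) + eps%:C%C * (quad N c m - quad N c' m) by ring.
apply: (le_trans (le_normcD _ _)); rewrite Normc.normcM normc_real ger0_norm//.
have H := quad_diff m E0 cc' cM c'M.
have H1 := cc' m mN.
have H2 : E * phin m <= E by rewrite ler_piMr// phin_le1.
have H3 := ler_wpM2l eps0 H.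
by lra.
Qed.

(** In these coordinates the coefficient of the mode n of the datum is lambdan
    n times a standard complex Gaussian. *)
Definition scaled (x : nat * bool -> R) n : R[i] := (lambdan n / Num.sqrt 2)%:C%C * cvec x n.

(** The factor k, rather than the symmetric (k + l) / 2, makes the modes k and
    k + l exchange energy; summing over both orders of the pair restores k + l. *)
Definition triad_rate (eps : R) k l : R :=
  Num.sqrt 2 * k%:R * eps * lambdan (k + l) * lambdan k * lambdan l.

(** As phi (n) = n lambda_n ^ 2, the equation has in normalised coordinates
    the coefficients of a conservative interaction. The identity amounts to
    symmetrising the factor k of triad_rate over the pairs with k + l = m. *)
Lemma scaled_field (eps : R) N x m : m \in iota 1 N ->
  (lambdan m / Num.sqrt 2)%:C%C * truncated_field phin (triad_rate eps) N x m =
  bbm_field eps N (scaled x) m.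
Proof.
move=> mN; have sq2 : Num.sqrt 2 != 0 :> R by rewrite gt_eqF// sqrtr_gt0.
have sq22 : Num.sqrt 2 ^+ 2 = 2 :> R by rewrite sqr_sqrtr.
rewrite /truncated_field /bbm_field !mulrDr; congr (_ + _).
  rewrite (bigD1_seq m) ?iota_uniq//= big1 ?addr0; last first.
    by move=> n nm; rewrite /linear_field eq_sym (negbTE nm).
  by rewrite /linear_field eqxx /scaled; ring.
set a := (lambdan m / Num.sqrt 2)%:C%C.
have E k : \sum_(l <- iota 1 N | (k + l <= N)%N) triad_field (triad_rate eps k l) k l x m =
    \sum_(l <- iota 1 N | (k + l == m)%N)
       - 'i%C * (triad_rate eps k l)%:C%C * (cvec x k * cvec x l) +
    (if k == m then \sum_(l <- iota 1 N | (m + l <= N)%N)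
       - 'i%C * (triad_rate eps m l)%:C%C * (cvec x (m + l) * (cvec x l)^*%C) else 0).
  rewrite /triad_field big_split /=; congr (_ + _).
    rewrite -big_mkcondr; apply: eq_bigl => l.
    rewrite [m == _]eq_sym; case: eqP => [->|_]; rewrite ?andbF ?andbT//.
    by move: mN; rewrite mem_iota; lia.
  rewrite eq_sym; case: eqP => [->//|_]; exact: big1.
have -> : \sum_(k <- iota 1 N) \sum_(l <- iota 1 N | (k + l <= N)%N) triad_field (triad_rate eps k l) k l x m =
  \sum_(k <- iota 1 N) \sum_(l <- iota 1 N | (k + l == m)%N)
       - 'i%C * (triad_rate eps k l)%:C%C * (cvec x k * cvec x l) +
  \sum_(l <- iota 1 N | (m + l <= N)%N)
       - 'i%C * (triad_rate eps m l)%:C%C * (cvec x (m + l) * (cvec x l)^*%C).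
  under eq_bigr do rewrite E.
  rewrite big_split; congr (_ + _); rewrite (bigD1_seq m) ?iota_uniq//.
  apply: etrans (addr0 _); rewrite eqxx; congr (_ + _).
  by apply: big1 => k km; rewrite (negbTE km).
have phiE : (phin m)%:C%C = m%:R * (lambdan m)%:C%C ^+ 2 :> R[i].
  by rewrite phin_lambdan rmorphM rmorph_nat rmorphXn.
set S : R[i] := (Num.sqrt 2)%:C%C.
have S0 : S != 0 by rewrite /S eqE /= negb_and sq2.
have SS : S * S = 2%:R by rewrite -rmorphM -expr2 sq22 rmorph_nat.
have aE : a = (lambdan m)%:C%C / S by rewrite /a rmorphM; congr (_ * _); exact: fmorphV.
have scE n : scaled x n = (lambdan n)%:C%C / S * cvec x n.
  by rewrite /scaled rmorphM; congr (_ * _ * _); exact: fmorphV.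
have rE k l : (triad_rate eps k l)%:C%C =
    S * k%:R * eps%:C%C * (lambdan (k + l))%:C%C * (lambdan k)%:C%C * (lambdan l)%:C%C.
  by rewrite /triad_rate !rmorphM rmorph_nat.
rewrite mulrDr; congr (_ + _).
- rewrite !mulr_sumr.
  (* each unordered pair is counted twice, so k may be averaged with l *)
  pose W := - 'i%C * eps%:C%C * (lambdan m)%:C%C ^+ 2 : R[i].
  pose G k l := scaled x k * scaled x l.
  have L1 : \sum_(k <- iota 1 N) a * (\sum_(l <- iota 1 N | (k + l == m)%N)
       - 'i%C * (triad_rate eps k l)%:C%C * (cvec x k * cvec x l)) =
    W * \sum_(k <- iota 1 N) \sum_(l <- iota 1 N | (k + l == m)%N) (2%:R * (k%:R * G k l)).
    rewrite mulr_sumr; apply: eq_bigr => k _; rewrite !mulr_sumr; apply: eq_bigr => l /eqP klm.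
    rewrite rE klm aE /G !scE /W -SS; field; exact: S0.
  have L2 : \sum_(k <- iota 1 N) \sum_(l <- iota 1 N | (k + l == m)%N) (2%:R * (k%:R * G k l)) =
     m%:R * \sum_(k <- iota 1 N) \sum_(l <- iota 1 N | (k + l == m)%N) G k l.
    transitivity (\sum_(k <- iota 1 N) \sum_(l <- iota 1 N | (k + l == m)%N) (k%:R * G k l) +
        \sum_(k <- iota 1 N) \sum_(l <- iota 1 N | (k + l == m)%N) (k%:R * G k l)).
      rewrite -big_split /=; apply: eq_bigr => k _; rewrite -big_split /=.
      by apply: eq_bigr => l _; ring.
    rewrite [X in _ + X](exchange_big_dep xpredT)//= -big_split /= mulr_sumr.
    apply: eq_bigr => k _; under [X in _ + X]eq_bigl do rewrite addnC.
    rewrite -big_split /= mulr_sumr; apply: eq_bigr => l /eqP <-.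
    by rewrite natrD /G; ring.
  rewrite L1 L2 -!mulr_sumr phiE /W; ring.
- rewrite !mulr_sumr; apply: eq_bigr => l _.
  have cjE : (scaled x l)^*%C = (lambdan l)%:C%C / S * (cvec x l)^*%C.
    have -> : (lambdan l)%:C%C / S = (lambdan l / Num.sqrt 2)%:C%C.
      by rewrite rmorphM; congr (_ * _); rewrite -fmorphV.
    by apply/eqP; rewrite eq_complex /=; apply/andP; split; apply/eqP; ring.
  rewrite cjE rE aE !scE phiE -SS; field; exact: S0.
Qed.
End quadratic.

(** * Error of a one-step scheme along a solution *)

Section error_estimate.
Context {R : realType}.
Local Notation nc := (@Normc.normc R).

(** The factor 2 comes from treating the real and the imaginary part
    separately. *)
Lemma le_cMVT (f df : R -> R[i]) (B x y : R) :
  (forall z, is_cderive z f (df z)) ->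
  (forall z, `|z - x| <= `|y - x| -> nc (df z) <= B) ->
  nc (f y - f x) <= 2 * (B * `|y - x|).
Proof.
move=> fdf bdf; apply: (le_trans (normc_le_ReIm _)); rewrite !raddfB /=.
rewrite [leRHS]mulrDl mul1r; apply: lerD.
  apply: (le_MVT_norm (fun z => (fdf z).1)) => z zx.
  exact: le_trans (normr_Re_le _) (bdf z zx).
apply: (le_MVT_norm (fun z => (fdf z).2)) => z zx.
exact: le_trans (normr_Im_le _) (bdf z zx).
Qed.

Variables (eps : R) (c q : R -> nat -> R[i]) (T M : R).
Hypothesis eps0 : 0 <= eps.
Hypothesis hder : forall s n, (0 < n)%N ->
  is_cderive s (fun s => c s n) (- 'i%C * (phin n)%:C%C * (c s n + eps%:C%C * q s n)).
Hypothesis hM : forall s N, `|s| <= T -> energy N (c s) <= M.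
Hypothesis hq : forall s n, `|s| <= T -> (0 < n)%N -> nc (q s n) <= M.

Let K1 := 1 + M + eps * M.

Lemma coef_bound s n : `|s| <= T -> (0 < n)%N -> nc (c s n) <= 1 + M.
Proof.
move=> sT n0; have := hM n sT; rewrite /energy (bigD1_seq n) ?iota_uniq//=; last first.
  by rewrite mem_iota add1n ltnS n0 leqnn.
have : 0 <= \sum_(i <- iota 1 n | i != n) nc (c s i) ^+ 2.
  by apply: sumr_ge0 => i _; exact: sqr_ge0.
by have := sqr_ge0 (nc (c s n) - 1); rewrite sqrrB expr1n mulr1; have := normc_ge0 (c s n); lra.
Qed.

Lemma M_ge0 : 0 <= T -> 0 <= M.
Proof. by move=> T0; rewrite (le_trans (normc_ge0 _) (hq (s := 0) (n := 1) _ _))// normr0. Qed.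

Lemma deriv_bound s n : `|s| <= T -> (0 < n)%N ->
  nc (- 'i%C * (phin n)%:C%C * (c s n + eps%:C%C * q s n)) <= phin n * K1.
Proof.
move=> sT n0; rewrite normc_iM ger0_norm ?phin_ge0// ler_wpM2l ?phin_ge0//.
apply: (le_trans (le_normcD _ _)); rewrite Normc.normcM normc_real ger0_norm//.
by apply: lerD; [exact: coef_bound|rewrite ler_wpM2l// hq].
Qed.

(** Each coefficient moves at a speed of order phin n, so displacements in
    time are of the form that quad_diff accepts. *)
Lemma coef_lip s s' n : `|s| + `|s' - s| <= T -> (0 < n)%N ->
  nc (c s' n - c s n) <= 2 * K1 * `|s' - s| * phin n.
Proof.
move=> sT n0.
have := le_cMVT (B := phin n * K1) (x := s) (y := s') (fun z => hder z n0).
move=> /(_ _)/le_trans; apply => [z zs|]; last by rewrite le_eqVlt; apply/orP; left; apply/eqP; ring.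
apply: deriv_bound => //; have := ler_normD (z - s) s; rewrite subrK; lra.
Qed.

Let C2 := 2 * K1 * (1 + 3 * eps * (2 + M)).

(** Along the solution, the field truncated at N differs from the velocity by
    the tail eta of the quadratic term; and freezing the field at time s costs one
    more power of h. *)
Lemma solution_step N eta s h n : 0 <= eta ->
  (forall s n, `|s| <= T -> n \in iota 1 N -> nc (q s n - quad N (c s) n) <= eta) ->
  `|s| + `|h| <= T -> n \in iota 1 N ->
  nc (c (s + h) n - c s n - h%:C%C * bbm_field eps N (c s) n) <=
    phin n * (`|h| * (2 * (C2 * `|h| + eps * eta))).
Proof.
move=> eta0 htail shT nN; have n0 : (0 < n)%N by move: nN; rewrite mem_iota => /andP[].
have T0 : 0 <= T by apply: le_trans shT; rewrite addr_ge0.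
have M0 := M_ge0 T0.
have K10 : 0 <= K1 by rewrite /K1 !addr_ge0// mulr_ge0.
set F := bbm_field eps N (c s) n.
(* g is the solution minus the line whose slope is the truncated field at time s *)
pose g (z : R) : R[i] := Complex (complex.Re (c z n) - z * complex.Re F) (complex.Im (c z n) - z * complex.Im F).
pose dc z : R[i] := - 'i%C * (phin n)%:C%C * (c z n + eps%:C%C * q z n).
have dg z : is_cderive z g (dc z - F).
  have [d1 d2] := hder z n0.
  split; rewrite /= raddfB /=.
    have d3 : is_derive z 1 (fun w => w * complex.Re F) (complex.Re F).
      rewrite (_ : (fun w => w * complex.Re F) = complex.Re F \*: id); last first.
        by apply/funext => w; rewrite /= /GRing.scale/= mulrC.
      by apply: is_derive_eq; rewrite /GRing.scale/= mulr1.
    exact: is_deriveB.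
  have d3 : is_derive z 1 (fun w => w * complex.Im F) (complex.Im F).
    rewrite (_ : (fun w => w * complex.Im F) = complex.Im F \*: id); last first.
      by apply/funext => w; rewrite /= /GRing.scale/= mulrC.
    by apply: is_derive_eq; rewrite /GRing.scale/= mulr1.
  exact: is_deriveB.
have gE : c (s + h) n - c s n - h%:C%C * F = g (s + h) - g s.
  have Re_mulc (a : R) (z : R[i]) : complex.Re (a%:C%C * z) = a * complex.Re z.
    by case: z => x y /=; rewrite mul0r subr0.
  have Im_mulc (a : R) (z : R[i]) : complex.Im (a%:C%C * z) = a * complex.Im z.
    by case: z => x y /=; rewrite mul0r addr0.
  rewrite /g; apply/eqP; rewrite eq_complex !raddfB /= Re_mulc Im_mulc.
  by apply/andP; split; apply/eqP; ring.
rewrite gE.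
have B z : `|z - s| <= `|s + h - s| -> nc (dc z - F) <= phin n * (C2 * `|h| + eps * eta).
  rewrite addrAC subrr add0r => zs.
  have zT : `|z| <= T by have := ler_normD (z - s) s; rewrite subrK; lra.
  have -> : dc z - F = - 'i%C * (phin n)%:C%C * (eps%:C%C * (q z n - quad N (c z) n)) +
      (bbm_field eps N (c z) n - F) by rewrite /dc /bbm_field; ring.
  apply: (le_trans (le_normcD _ _)).
  rewrite normc_iM ger0_norm ?phin_ge0// Normc.normcM normc_real ger0_norm//.
  have h1 := htail z n zT nN.
  have sT : `|s| <= T by apply: le_trans shT; rewrite lerDl.
  have E0 : 0 <= 2 * K1 * `|h| by rewrite !mulr_ge0.
  have h2 : nc (bbm_field eps N (c z) n - F) <= phin n * (2 * K1 * `|h|) * (1 + 3 * eps * (2 + M)).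
    apply: bbm_field_diff => //; last 2 first.
    - exact: hM.
    - exact: hM.
    move=> k; rewrite mem_iota => /andP[k0 _].
    apply: (le_trans (coef_lip (s := s) _ k0)); first by lra.
    by rewrite ler_wpM2r ?phin_ge0// ler_wpM2l// mulr_ge0.
  have h3 : phin n * (eps * nc (q z n - quad N (c z) n)) <= phin n * (eps * eta).
    by rewrite !ler_wpM2l ?phin_ge0.
  apply: (le_trans (lerD h3 h2)).
  by rewrite le_eqVlt; apply/orP; left; apply/eqP; rewrite /C2; ring.
apply: (le_trans (le_cMVT dg B)).
rewrite addrAC subrr add0r le_eqVlt; apply/orP; left; apply/eqP; ring.
Qed.

Let C3 := 1 + 3 * eps * (6 + 2 * M).

(** Discrete Gronwall argument for errors of the form E * phin n. The error
    stays below phin n throughout, so the scheme inherits from the solution the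
    energy bound that the Lipschitz estimate needs. *)
Lemma splitting_error N J h eta theta (U : nat -> nat -> R[i]) :
  0 <= eta -> 0 <= theta ->
  (forall s n, `|s| <= T -> n \in iota 1 N -> nc (q s n - quad N (c s) n) <= eta) ->
  (forall n, n \in iota 1 N -> U 0%N n = c 0 n) ->
  (forall j n, n \in iota 1 N ->
     nc (U j.+1 n - U j n - h%:C%C * bbm_field eps N (U j) n) <= phin n * (`|h| * theta)) ->
  J%:R * `|h| + `|h| <= T ->
  let delta := 2 * (C2 * `|h| + eps * eta) + theta in
  J%:R * `|h| * delta * expR (J%:R * `|h| * C3) <= 1 ->
  forall n, n \in iota 1 N ->
  nc (U J n - c (J%:R * h) n) <= J%:R * `|h| * delta * expR (J%:R * `|h| * C3).
Proof.
move=> eta0 th0 htail U0 Ustep JT delta small.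
have T0 : 0 <= T by apply: le_trans JT; rewrite addr_ge0// mulr_ge0.
have M0 := M_ge0 T0.
have K10 : 0 <= K1 by rewrite /K1 !addr_ge0// mulr_ge0.
have C30 : 0 <= C3 by rewrite /C3 addr_ge0// !mulr_ge0// addr_ge0// mulr_ge0.
have C20 : 0 <= C2 by rewrite /C2 mulr_ge0 ?mulr_ge0 ?addr_ge0 ?mulr_ge0 ?addr_ge0.
have de0 : 0 <= delta by rewrite /delta addr_ge0// mulr_ge0// addr_ge0// mulr_ge0.
have h0 := normr_ge0 h.
(* the discrete Gronwall bound: delta is the local error per unit of time *)
pose err j := j%:R * `|h| * delta * (1 + `|h| * C3) ^+ j.
have a1 : 1 <= 1 + `|h| * C3 by rewrite lerDl mulr_ge0.
have a0 : 0 <= 1 + `|h| * C3 by exact: le_trans ler01 a1.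
have err0 j : 0 <= err j by rewrite /err mulr_ge0 ?exprn_ge0// !mulr_ge0.
have err_le j : (j <= J)%N -> err j <= J%:R * `|h| * delta * expR (J%:R * `|h| * C3).
  move=> jJ; rewrite /err; apply: ler_pM.
  - by rewrite !mulr_ge0.
  - by rewrite exprn_ge0.
  - by rewrite !ler_wpM2r// ler_nat.
  - apply: (@le_trans _ _ (expR (`|h| * C3) ^+ j)).
      by apply: lerXn2r; rewrite ?nnegrE ?expR_ge0 ?expR_ge1Dx.
    by rewrite -expRM_natl ler_expR mulrA ler_wpM2r// ler_wpM2r// ler_nat.
have errS j : err j * (1 + `|h| * C3) + `|h| * delta <= err j.+1.
  rewrite /err exprS -natr1.
  have p1 : 1 <= (1 + `|h| * C3) ^+ j.+1 by rewrite exprn_ege1.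
  have hd : 0 <= `|h| * delta by rewrite mulr_ge0.
  have := ler_wpM2l hd p1; rewrite mulr1 exprS => H.
  apply: (le_trans (lerD (lexx _) H)).
  by rewrite le_eqVlt; apply/orP; left; apply/eqP; ring.
suff main j : (j <= J)%N -> forall n, n \in iota 1 N ->
    nc (U j n - c (j%:R * h) n) <= err j * phin n.
  move=> n nN; apply: (le_trans (main J (leqnn J) n nN)).
  apply: (@le_trans _ _ (err J)); last exact: err_le.
  by rewrite ler_piMr// phin_le1.
elim: j => [|j IH] jJ n nN.
  by rewrite U0// mul0r subrr Normc.normc0 mulr_ge0// phin_ge0.
have {}IH := IH (ltnW jJ).
set s := j%:R * h.
have jR : j%:R + 1 <= J%:R :> R by rewrite natr1 ler_nat.
have sJ : `|s| + `|h| <= T.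
  rewrite /s normrM ger0_norm//; have := ler_wpM2r h0 jR; rewrite mulrDl mul1r; lra.
have sT : `|s| <= T by apply: le_trans sJ; rewrite lerDl.
have e1 : err j <= 1 by exact: le_trans (err_le j (ltnW jJ)) small.
(* as long as the error is at most phin, the scheme has bounded energy *)
have EU : energy N (U j) <= 2 * M + 4.
  rewrite /energy; apply: (@le_trans _ _ (\sum_(k <- iota 1 N) (2 * nc (c s k) ^+ 2 + 2 * phin k ^+ 2))).
    rewrite big_seq [leRHS]big_seq; apply: ler_sum => k kN.
    have h1 := IH k kN.
    have h2 : nc (U j k - c s k) <= phin k.
      by apply: (le_trans h1); rewrite ler_piMl// phin_ge0.
    have := le_normcD (c s k) (U j k - c s k); rewrite addrC subrK => h3.
    have h4 : nc (U j k) <= nc (c s k) + phin k by lra.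
    have h5 : nc (U j k) ^+ 2 <= (nc (c s k) + phin k) ^+ 2.
      by rewrite ler_pXn2r// nnegrE ?addr_ge0 ?normc_ge0 ?phin_ge0.
    by apply: (le_trans h5); have := sqr_ge0 (nc (c s k) - phin k); rewrite sqrrB sqrrD; lra.
  rewrite big_split /= -!mulr_sumr; have := hM N sT; rewrite /energy.
  by have := @sum_sqr_phin R N; lra.
have Ec : energy N (c s) <= 2 * M + 4 by have := hM N sT; lra.
have H1 := Ustep j n nN.
have H2 := solution_step eta0 htail sJ nN.
have H3 := bbm_field_diff eps0 (err0 j) nN IH EU Ec.
have -> : j.+1%:R * h = s + h by rewrite /s -natr1; ring.
have -> : U j.+1 n - c (s + h) n = (U j n - c s n) +
   (h%:C%C * (bbm_field eps N (U j) n - bbm_field eps N (c s) n)) +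
   ((U j.+1 n - U j n - h%:C%C * bbm_field eps N (U j) n) -
    (c (s + h) n - c s n - h%:C%C * bbm_field eps N (c s) n)) by ring.
apply: (le_trans (le_normcD _ _)); apply: (le_trans (lerD (le_normcD _ _) (normcB_le _ _))).
rewrite Normc.normcM normc_real.
have H4 := IH n nN.
have H3' := ler_wpM2l h0 H3.
have p0 : 0 <= phin n :> R by exact: phin_ge0.
apply: (@le_trans _ _ (phin n * (err j * (1 + `|h| * C3) + `|h| * delta))); last first.
  by rewrite mulrC ler_wpM2r.
apply: (le_trans (lerD (lerD H4 H3') (lerD H1 H2))).
rewrite le_eqVlt; apply/orP; left; apply/eqP; rewrite /delta /C3; ring.
Qed.

End error_estimate.

(** * Convergence of the rotation scheme *)

Section scheme.
Context {R : realType}.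
Local Notation nc := (@Normc.normc R).
Implicit Types (x : nat * bool -> R).

Lemma sqnorm_modes N x : sqnorm (modes N) x =
  \sum_(n <- iota 1 N) (x (n, true) ^+ 2 + x (n, false) ^+ 2).
Proof.
rewrite /sqnorm /modes; elim: (iota 1 N) => [|n s IH]; first by rewrite !big_nil.
by rewrite /= !big_cons IH addrA.
Qed.

Lemma scale_factor n : 0 <= (lambdan n / Num.sqrt 2 : R) <= 1.
Proof.
have s2 : 1 <= Num.sqrt 2 :> R by rewrite -[leLHS]sqrtr1 ler_sqrt// ler1n.
rewrite divr_ge0 ?sqrtr_ge0 ?(ltW (lambdan_gt0 _))//= ler_pdivrMr ?(lt_le_trans ltr01)// mul1r.
exact: le_trans (lambdan_le1 n) s2.
Qed.

(** The normalised coordinates undo the decay of lambdan, which costs a factor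
    of order N; the norm they give is therefore bounded for each N only. *)
Lemma sqnorm_scaled N x M : energy N (scaled x) <= M -> 0 <= M ->
  sqnorm (modes N) x <= (2 * N.+1%:R * (1 + M)) ^+ 2.
Proof.
move=> EM M0; rewrite sqnorm_modes.
apply: (@le_trans _ _ (\sum_(n <- iota 1 N) (2 * (1 + N%:R ^+ 2)) * nc (scaled x n) ^+ 2)).
  rewrite big_seq [leRHS]big_seq; apply: ler_sum => n; rewrite mem_iota add1n ltnS => /andP[n0 nN].
  have -> : nc (scaled x n) ^+ 2 = lambdan n ^+ 2 / 2 * (x (n, true) ^+ 2 + x (n, false) ^+ 2).
    rewrite /scaled Normc.normcM normc_real exprMn real_normK ?num_real// expr_div_n sqr_sqrtr//.
    by rewrite sqr_normcE.
  rewrite sqr_lambdan.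
  set y := x (n, true) ^+ 2 + _; have y0 : 0 <= y by rewrite addr_ge0 ?sqr_ge0.
  have d0 := @den_gt0 R n.
  have -> : 2 * (1 + N%:R ^+ 2) * ((1 + n%:R ^+ 2)^-1 / 2 * y) = (1 + N%:R ^+ 2) / (1 + n%:R ^+ 2) * y.
    by field; rewrite gt_eqF.
  rewrite ler_peMl// ler_pdivlMr// mul1r lerD2l.
  by rewrite ler_pXn2r// ?nnegrE// ler_nat.
rewrite -mulr_sumr; set e := \sum_(_ <- _) _.
have {}EM : e <= M := EM.
have d0 := @den_gt0 R N.
apply: (@le_trans _ _ (2 * (1 + N%:R ^+ 2) * M)).
  by rewrite ler_wpM2l// mulr_ge0// ltW.
rewrite -natr1; set m : R := N%:R; have m0 : 0 <= m by rewrite ler0n.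
rewrite !exprMn.
apply: ler_pM => //; [by rewrite mulr_ge0// addr_ge0// sqr_ge0| |].
  by have := sqr_ge0 m; rewrite sqrrD expr1n mulr1; lra.
by have := sqr_ge0 M; rewrite sqrrD expr1n mul1r; lra.
Qed.

Variables (eps : R) (Psi : nat -> R -> (nat * bool -> R) -> (nat * bool -> R)) (K : nat -> R) (J : nat -> nat).
Hypothesis eps0 : 0 <= eps.
Hypothesis K0 : forall N, 0 <= K N.
Hypothesis Psi_sqnorm : forall N h x, sqnorm (modes N) (Psi N h x) = sqnorm (modes N) x.
Hypothesis Psi_err : forall N, step_error (modes N) (Psi N)
  (fun x => realify (truncated_field phin (triad_rate eps) N x)) (K N).
Hypothesis J_large : forall N, N.+1%:R * (1 + 16 * K N * N.+1%:R ^+ 4) <= (J N)%:R.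

Definition scheme N t x := iter (J N) (Psi N (t / (J N)%:R)) x.

(** The local error of the step is not uniform in N, because the normalised
    coordinates grow with N; the constants displayed here are what J N has to
    compensate. *)
Lemma scheme_step N h x M n : 0 <= M -> sqnorm (modes N) x <= (2 * N.+1%:R * (1 + M)) ^+ 2 ->
  n \in iota 1 N ->
  nc (scaled (Psi N h x) n - scaled x n - h%:C%C * bbm_field eps N (scaled x) n) <=
    phin n * (`|h| * (16 * K N * N.+1%:R ^+ 4 * (1 + M) ^+ 3 * `|h|)).
Proof.
move=> M0 xM nN; rewrite -scaled_field//.
set rho := 2 * N.+1%:R * (1 + M) in xM.
have N1 : 1 <= N.+1%:R :> R by rewrite ler1n.
have rho1 : 1 <= rho.
  rewrite /rho -[leLHS]mul1r; apply: ler_pM => //; last by rewrite lerDl.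
  by have := N1; lra.
have [_ e2 _] := Psi_err N rho1.
pose f := truncated_field phin (triad_rate eps) N x; rewrite -/f.
have -> : scaled (Psi N h x) n - scaled x n - h%:C%C * ((lambdan n / Num.sqrt 2)%:C%C * f n) =
  (lambdan n / Num.sqrt 2)%:C%C * (cvec (Psi N h x) n - cvec x n - h%:C%C * f n).
  by rewrite /scaled; ring.
have [l0 l1] := andP (scale_factor n).
rewrite Normc.normcM normc_real ger0_norm//.
have B0 : 0 <= K N * h ^+ 2 * rho ^+ 3.
  by rewrite mulr_ge0 ?exprn_ge0 ?(le_trans ler01 rho1)// mulr_ge0 ?sqr_ge0.
have nD b : (n, b) \in modes N.
  by rewrite mem_modes; move: nN; rewrite mem_iota add1n ltnS.
have H : nc (cvec (Psi N h x) n - cvec x n - h%:C%C * f n) <= 2 * (K N * h ^+ 2 * rho ^+ 3).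
  apply: (le_trans (normc_le_ReIm _)); rewrite mulrDl mul1r; apply: lerD.
    have := e2 h x (n, true) xM (nD true); rewrite /realify /= -/f.
    by case: (f n) => a b /=; rewrite mul0r subr0.
  have := e2 h x (n, false) xM (nD false); rewrite /realify /= -/f.
  by case: (f n) => a b /=; rewrite mul0r addr0.
apply: (le_trans (ler_pM l0 (normc_ge0 _) l1 H)); rewrite mul1r.
have h2 : h ^+ 2 = `|h| ^+ 2 by rewrite real_normK ?num_real.
set B := 2 * _; have BB : 0 <= B by rewrite mulr_ge0.
have pl : 1 <= phin n * N.+1%:R :> R.
  have n0 : (0 < n)%N by move: nN; rewrite mem_iota => /andP[].
  apply: (le_trans (phin_lower n0)); rewrite ler_wpM2l ?phin_ge0// -natr1 addrC lerD2r ler_nat.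
  by move: nN; rewrite mem_iota add1n ltnS => /andP[].
have := ler_wpM2l BB pl; rewrite mulr1 => H1; apply: (le_trans H1).
rewrite le_eqVlt; apply/orP; left; apply/eqP; rewrite /B /rho h2; ring.
Qed.

Variables (c q : R -> nat -> R[i]) (M t : R) (x0 : nat * bool -> R).
Let T := `|t| + 1.
Hypothesis hder : forall s n, (0 < n)%N ->
  is_cderive s (fun s => c s n) (- 'i%C * (phin n)%:C%C * (c s n + eps%:C%C * q s n)).
Hypothesis hM : forall s N, `|s| <= T -> energy N (c s) <= M.
Hypothesis hq : forall s n, `|s| <= T -> (0 < n)%N -> nc (q s n) <= M.
Hypothesis htail : forall eta, 0 < eta -> exists N0, forall N, (N0 <= N)%N ->
  forall s n, `|s| <= T -> n \in iota 1 N -> nc (q s n - quad N (c s) n) <= eta.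
Hypothesis hx0 : forall n, (0 < n)%N -> scaled x0 n = c 0 n.

(** The number J N of steps grows so fast with N that the local error, whose
    constant depends on N, tends to 0; the remaining error is the tail of the
    quadratic term, which is small uniformly in time. *)
Lemma scheme_cvg n : (0 < n)%N ->
  (fun N => nc (scaled (scheme N t x0) n - c t n)) @ \oo --> (0 : R).
Proof.
move=> n0.
have T0 : 0 <= T by rewrite addr_ge0.
have M0 : 0 <= M by exact: (M_ge0 hq).
pose C2 := 2 * (1 + M + eps * M) * (1 + 3 * eps * (2 + M)).
pose C3 := 1 + 3 * eps * (6 + 2 * M).
pose E := `|t| * expR (`|t| * C3).
have E0 : 0 <= E by rewrite mulr_ge0// expR_ge0.
have C20 : 0 <= C2 by rewrite /C2 mulr_ge0 ?mulr_ge0 ?addr_ge0 ?mulr_ge0 ?addr_ge0.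
pose A := E * (2 * C2 * `|t| + `|t| * (1 + M) ^+ 3).
have M3 : 0 <= (1 + M) ^+ 3 by rewrite exprn_ge0// addr_ge0.
have A0 : 0 <= A.
  apply: mulr_ge0 => //; apply: addr_ge0; apply: mulr_ge0 => //; first by apply: mulr_ge0.
apply/cvgrPdist_le => e0 e0_gt0.
pose e := Num.min e0 1.
have e_gt0 : 0 < e by rewrite lt_min e0_gt0 ltr01.
(* with this eta the frequencies above N contribute at most e / 2 *)
pose eta := e / (4 * (E * eps + 1)).
have Ee : 0 < E * eps + 1 by rewrite ltr_wpDl// mulr_ge0.
have eta_gt0 : 0 < eta by rewrite divr_gt0// mulr_gt0.
have [N0 tailN] := htail eta_gt0.
near=> N.
have N1 : 0 < N.+1%:R :> R by rewrite ltr0n.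
have N1' : 1 <= N.+1%:R :> R by rewrite ler1n.
have JN := J_large N; set j : R := (J N)%:R in JN *.
have KN : 0 <= 16 * K N * N.+1%:R ^+ 4 by rewrite mulr_ge0 ?exprn_ge0// mulr_ge0.
have JN1 : N.+1%:R <= j.
  by apply: le_trans JN; rewrite -[leLHS]mulr1 ler_wpM2l// lerDl.
have j0 : 0 < j by exact: lt_le_trans JN1.
set h := t / j.
have jh : j * `|h| = `|t|.
  by rewrite /h normrM normfV (gtr0_norm j0) mulrCA divff ?mulr1// gt_eqF.
have h1 : `|h| <= `|t| / N.+1%:R.
  rewrite /h normrM normfV (gtr0_norm j0) ler_wpM2l//.
  by rewrite lef_pV2 ?posrE.
have hle1 : `|h| <= 1.
  apply: (le_trans h1); rewrite ler_pdivrMr// mul1r.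
  near: N; have [m _ mP] := nbhs_infty_ger (`|t|).
  exists m => // k mk; apply: (le_trans (mP k mk)); rewrite ler_nat; exact: leqnSn.
have NN0 : (N0 <= N)%N by near: N; exact: nbhs_infty_ge.
have nN : n \in iota 1 N.
  by rewrite mem_iota n0 add1n ltnS; near: N; exact: nbhs_infty_ge.
have x0M : sqnorm (modes N) x0 <= (2 * N.+1%:R * (1 + M)) ^+ 2.
  apply: sqnorm_scaled => //; have := hM N (s := 0); rewrite normr0 => /(_ T0).
  rewrite /energy; apply: le_trans; rewrite le_eqVlt; apply/orP; left; apply/eqP.
  rewrite big_seq [RHS]big_seq; apply: eq_bigr => k; rewrite mem_iota => /andP[k0 _].
  by rewrite hx0.
pose X i := iter i (Psi N h) x0.
have XM i : sqnorm (modes N) (X i) <= (2 * N.+1%:R * (1 + M)) ^+ 2.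
  by elim: i => // i IH; rewrite /X /= Psi_sqnorm.
pose theta := 16 * K N * N.+1%:R ^+ 4 * (1 + M) ^+ 3 * `|h|.
have th0 : 0 <= theta by rewrite mulr_ge0// mulr_ge0.
have th1 : theta <= `|t| * (1 + M) ^+ 3 / N.+1%:R.
  rewrite ler_pdivlMr// /theta -jh.
  have : N.+1%:R * (16 * K N * N.+1%:R ^+ 4) <= j.
    by apply: le_trans JN; rewrite ler_wpM2l// lerDr.
  move=> H; have := ler_wpM2r (mulr_ge0 M3 (normr_ge0 h)) H.
  move=> H'; apply: le_trans (le_trans _ H') _; rewrite le_eqVlt; apply/orP; left; apply/eqP; ring.
have de : j * `|h| * (2 * (C2 * `|h| + eps * eta) + theta) * expR (j * `|h| * C3) <= e.
  rewrite jh mulrAC -/E.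
  have a1 : C2 * `|h| <= C2 * (`|t| / N.+1%:R) by rewrite ler_wpM2l.
  have a2 : E * (2 * (C2 * `|h| + eps * eta) + theta) <=
     A / N.+1%:R + E * (2 * (eps * eta)).
    apply: (@le_trans _ _ (E * (2 * (C2 * (`|t| / N.+1%:R) + eps * eta) + `|t| * (1 + M) ^+ 3 / N.+1%:R))).
      by rewrite ler_wpM2l//; apply: lerD th1; rewrite ler_wpM2l// lerD2r.
    by rewrite le_eqVlt; apply/orP; left; apply/eqP; rewrite /A; ring.
  have a3 : A / N.+1%:R <= e / 2.
    rewrite ler_pdivrMr// mulrC -ler_pdivrMr ?divr_gt0//.
    near: N; have [m _ mP] := nbhs_infty_ger (A / (e / 2)).
    exists m => // k mk; apply: (le_trans (mP k mk)); rewrite ler_nat; exact: leqnSn.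
  have a4 : E * (2 * (eps * eta)) <= e / 2.
    rewrite /eta.
    have -> : E * (2 * (eps * (e / (4 * (E * eps + 1))))) = (e / 2) * ((E * eps) / (E * eps + 1)).
      by field; rewrite gt_eqF.
    rewrite ler_piMr ?(ltW (divr_gt0 e_gt0 _))// ler_pdivrMr// mul1r lerDl//.
  by rewrite (le_trans a2)// [leRHS]splitr lerD.
have jhT : j * `|h| + `|h| <= T by rewrite jh /T lerD2l.
have th : j * h = t by rewrite /h mulrCA divff ?mulr1// gt_eqF.
have X0 k : k \in iota 1 N -> scaled (X 0%N) k = c 0 k.
  by rewrite mem_iota => /andP[k0 _]; exact: hx0.
have XS i k : k \in iota 1 N ->
    nc (scaled (X i.+1) k - scaled (X i) k - h%:C%C * bbm_field eps N (scaled (X i)) k) <=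
      phin k * (`|h| * theta).
  by move=> kN; exact: (scheme_step h M0 (XM i) kN).
have de1 : j * `|h| * (2 * (C2 * `|h| + eps * eta) + theta) * expR (j * `|h| * C3) <= 1.
  by apply: (le_trans de); rewrite ge_min lexx orbT.
have := splitting_error eps0 hder hM hq (ltW eta_gt0) th0 (tailN N NN0) X0 XS jhT de1 nN.
rewrite -/j th => H.
rewrite sub0r normrN ger0_norm ?normc_ge0//; apply: (le_trans H).
by apply: (le_trans de); rewrite ge_min lexx.
Unshelve. all: by end_near. Qed.

End scheme.

(** * Integration over the circle *)

Section circle_integrals.
Context {R : realType}.
Local Notation leb := (@lebesgue_measure R).
Local Notation circ := (@circle R).
Local Notation nc := (@Normc.normc R).
Implicit Types (f g : R -> R).

Definition rint f : Prop := leb.-integrable circ (EFin \o f).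

Lemma measurable_circle : measurable circ.
Proof. exact: measurable_itv. Qed.
Hint Resolve measurable_circle : core.

Lemma lebesgue_circle : leb circ = (2 * pi)%:E.
Proof.
rewrite /circle lebesgue_measure_itv/= lte_fin mulr_gt0 ?pi_gt0//.
by rewrite -EFinD subr0.
Qed.

Lemma Rintegral_circle_cst (r : R) : \int[leb]_(x in circ) r = r * (2 * pi).
Proof.
rewrite Rintegral_cst//; congr (_ * _); exact: (congr1 fine lebesgue_circle).
Qed.

Lemma rintD f g : rint f -> rint g -> rint (fun x => f x + g x).
Proof. by move=> rf rg; have := integrableD (mu := leb) measurable_circle rf rg. Qed.

Lemma rintZ (a : R) f : rint f -> rint (fun x => a * f x).
Proof. by move=> rf; have := integrableZl (mu := leb) measurable_circle a rf. Qed.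

Lemma rintB f g : rint f -> rint g -> rint (fun x => f x - g x).
Proof. by move=> rf rg; have := integrableB (mu := leb) measurable_circle rf rg. Qed.

Lemma rint_meas f : rint f -> measurable_fun circ f.
Proof. by move=> /measurable_int/measurable_EFinP. Qed.

Lemma rint_le f g : measurable_fun circ f -> rint g ->
  (forall x, `|f x| <= g x) -> rint f.
Proof.
move=> mf rg fg; apply: (le_integrable (mu := leb) measurable_circle _ _ rg) => //.
  exact/measurable_EFinP.
by move=> x _ /=; rewrite lee_fin (le_trans (fg x))// ler_norm.
Qed.

Lemma rint_norm f : rint f -> rint (fun x => `|f x|).
Proof. by move=> rf; have := integrable_norm (mu := leb) rf. Qed.

Lemma continuous_circle_meas f : continuous f -> measurable_fun circ f.
Proof. by move=> cf; apply: measurable_funTS; exact: continuous_measurable_fun. Qed.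

Lemma rint_bmul f g : rint f -> continuous g -> (forall x, `|g x| <= 1) ->
  rint (fun x => f x * g x).
Proof.
move=> rf cg g1; apply: (rint_le _ (rint_norm rf)).
  by apply: measurable_funM; [exact: rint_meas|exact: continuous_circle_meas].
by move=> x; rewrite normrM ler_piMr.
Qed.

Lemma rint_continuous f : continuous f -> rint f.
Proof.
move=> cf; apply: continuous_compact_integrable; first exact: segment_compact.
exact: continuous_subspaceT.
Qed.

Lemma sqint_continuous f : continuous f -> square_integrable f.
Proof.
move=> cf; split; first exact: continuous_circle_meas.
apply: (rint_continuous (f := fun x => f x ^+ 2)) => x.
by apply: (cvg_comp f (fun y => y ^+ 2) (cf x)); exact: exprn_continuous.
Qed.

Lemma sqint_mul f g : square_integrable f -> square_integrable g ->
  rint (fun x => f x * g x).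
Proof.
move=> [mf rf] [mg rg]; apply: (rint_le _ (rintD rf rg)).
  exact: measurable_funM.
move=> x; have := sqr_ge0 (f x - g x); have := sqr_ge0 (f x + g x).
rewrite sqrrB sqrrD ler_norml => h1 h2; have := sqr_ge0 (f x); have := sqr_ge0 (g x).
by move=> h3 h4; apply/andP; split; lra.
Qed.

Lemma sqintD f g : square_integrable f -> square_integrable g ->
  square_integrable (fun x => f x + g x).
Proof.
move=> sf sg; have [mf rf] := sf; have [mg rg] := sg; split; first exact: measurable_funD.
have := rintD (rintD rf rg) (rintZ 2 (sqint_mul sf sg)).
by rewrite /rint; apply: eq_integrable => // x _ /=; congr EFin; ring.
Qed.

Lemma sqintZ (a : R) f : square_integrable f -> square_integrable (fun x => a * f x).
Proof.
move=> [mf rf]; split; first exact: measurable_funM.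
have := rintZ (a ^+ 2) rf.
by rewrite /rint; apply: eq_integrable => // x _ /=; congr EFin; ring.
Qed.

Lemma sqintB f g : square_integrable f -> square_integrable g ->
  square_integrable (fun x => f x - g x).
Proof.
move=> sf sg; have := sqintD sf (sqintZ (-1) sg).
rewrite (_ : (fun x => f x + -1 * g x) = (fun x => f x - g x))//.
by apply/funext => x; rewrite mulN1r.
Qed.

Lemma sqint_rint f : square_integrable f -> rint f.
Proof.
move=> sf; have s1 : square_integrable (cst (1 : R)) by apply: sqint_continuous => x; exact: cvg_cst.
have := sqint_mul sf s1; rewrite (_ : (fun x => f x * cst 1 x) = f)//.
by apply/funext => x; rewrite mulr1.
Qed.

Definition cint (F : R -> R[i]) : Prop :=
  rint (fun x => complex.Re (F x)) /\ rint (fun x => complex.Im (F x)).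

Lemma Re_mulc (a z : R[i]) : complex.Re (a * z) = complex.Re a * complex.Re z - complex.Im a * complex.Im z.
Proof. by case: a z => [? ?] []. Qed.

Lemma Im_mulc (a z : R[i]) : complex.Im (a * z) = complex.Re a * complex.Im z + complex.Im a * complex.Re z.
Proof. by case: a z => [? ?] []. Qed.

Lemma cintD F G : cint F -> cint G -> cint (fun x => F x + G x).
Proof.
move=> [f1 f2] [g1 g2]; split.
  by under eq_fun do rewrite raddfD; exact: rintD.
by under eq_fun do rewrite raddfD; exact: rintD.
Qed.

Lemma cintZ (a : R[i]) F : cint F -> cint (fun x => a * F x).
Proof.
move=> [f1 f2]; split.
  by under eq_fun do rewrite Re_mulc; apply: rintB; exact: rintZ.
by under eq_fun do rewrite Im_mulc; apply: rintD; exact: rintZ.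
Qed.

Lemma cint0 : cint (fun=> 0).
Proof. by split; apply: rint_continuous => x; exact: cvg_cst. Qed.

Lemma cintegralD F G : cint F -> cint G ->
  cintegral leb circ (fun x => F x + G x) = cintegral leb circ F + cintegral leb circ G.
Proof.
move=> [f1 f2] [g1 g2]; rewrite /cintegral.
apply/eqP; rewrite eq_complex /=; apply/andP; split; apply/eqP.
  by rewrite -RintegralD//; apply: eq_Rintegral => x _; rewrite raddfD.
by rewrite -RintegralD//; apply: eq_Rintegral => x _; rewrite raddfD.
Qed.

Lemma cintegralZ (a : R[i]) F : cint F ->
  cintegral leb circ (fun x => a * F x) = a * cintegral leb circ F.
Proof.
move=> [f1 f2]; rewrite /cintegral.
apply/eqP; rewrite eq_complex Re_mulc Im_mulc /=; apply/andP; split; apply/eqP.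
  rewrite -!RintegralZl// -RintegralB//; [|exact: rintZ|exact: rintZ].
  by apply: eq_Rintegral => x _; rewrite Re_mulc.
rewrite -!RintegralZl// -RintegralD//; [|exact: rintZ|exact: rintZ].
by apply: eq_Rintegral => x _; rewrite Im_mulc.
Qed.

Lemma cint_sum (E : Type) (s : seq E) (p : pred E) (F : E -> R -> R[i]) : (forall e, cint (F e)) ->
  cint (fun x => \sum_(e <- s | p e) F e x).
Proof.
move=> cF; elim: s => [|e s IH].
  by under eq_fun do rewrite big_nil; exact: cint0.
under eq_fun do rewrite big_cons; case: (p e) => //; exact: cintD.
Qed.

Lemma cintegral_sum (E : Type) (s : seq E) (p : pred E) (F : E -> R -> R[i]) :
  (forall e, cint (F e)) ->
  cintegral leb circ (fun x => \sum_(e <- s | p e) F e x) = \sum_(e <- s | p e) cintegral leb circ (F e).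
Proof.
move=> cF; elim: s => [|e s IH].
  rewrite big_nil; under eq_fun do rewrite big_nil.
  by rewrite /cintegral /Rintegral !integral0.
rewrite big_cons; under eq_fun do rewrite big_cons.
case: (p e) => //; rewrite cintegralD//; last exact: cint_sum.
by rewrite IH.
Qed.

Lemma cexpiD (x y : R) : cexpi (x + y) = cexpi x * cexpi y.
Proof.
by apply/eqP; rewrite eq_complex /= cosD sinD eqxx/= addrC; apply/eqP; ring.
Qed.

Lemma cexpi_conj (x : R) : (cexpi x)^*%C = cexpi (- x).
Proof. by rewrite /cexpi cosN sinN. Qed.

Lemma continuous_cosM (a : R) : continuous (fun x => cos (a * x)).
Proof. by move=> x; apply: (cvg_comp (fun x => a * x) cos); [exact: mulrl_continuous|exact: continuous_cos]. Qed.

Lemma continuous_sinM (a : R) : continuous (fun x => sin (a * x)).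
Proof. by move=> x; apply: (cvg_comp (fun x => a * x) sin); [exact: mulrl_continuous|exact: continuous_sin]. Qed.

Lemma normr_cos_le1 (x : R) : `|cos x| <= 1.
Proof. by rewrite ler_norml cos_geN1 cos_le1. Qed.

Lemma normr_sin_le1 (x : R) : `|sin x| <= 1.
Proof. by rewrite ler_norml sin_geN1 sin_le1. Qed.

Lemma cint_mode (a : R) : cint (fun x => cexpi (a * x)).
Proof.
by split; apply: rint_continuous; [exact: continuous_cosM|exact: continuous_sinM].
Qed.

Lemma cint_mul_mode f (a : R) : rint f -> cint (fun x => (f x)%:C%C * cexpi (a * x)).
Proof.
move=> rf; split.
  under eq_fun do rewrite Re_mulc /= mul0r subr0.
  by apply: rint_bmul => //; [exact: continuous_cosM|move=> x; exact: normr_cos_le1].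
under eq_fun do rewrite Im_mulc /= mul0r addr0.
by apply: rint_bmul => //; [exact: continuous_sinM|move=> x; exact: normr_sin_le1].
Qed.

Lemma cos_sin_2pi (j : int) : cos (j%:~R * (2 * pi)) = 1 :> R /\ sin (j%:~R * (2 * pi)) = 0 :> R.
Proof.
have H (n : nat) : cos (n%:R * (2 * pi)) = 1 :> R /\ sin (n%:R * (2 * pi)) = 0 :> R.
  have E : n%:R * (2 * pi) = 0 + (pi *+ 2) *+ n :> R.
    by rewrite add0r -[RHS]mulr_natl -[pi *+ 2]mulr_natl.
  by rewrite E (periodicn (@cosD2pi R)) (periodicn (@sinD2pi R)) cos0 sin0.
case: j => n; first by rewrite -pmulrn; exact: H.
have [h1 h2] := H n.+1.
by rewrite NegzE mulrNz -pmulrn mulNr cosN sinN h1 h2 oppr0.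
Qed.

(** Orthogonality of the characters: a nonzero frequency has a periodic
    primitive. *)
Lemma cintegral_mode (j : int) :
  cintegral leb circ (fun x => cexpi (j%:~R * x)) = if j == 0 then (2 * pi)%:C%C else 0.
Proof.
have [->|j0] := eqVneq j 0.
  rewrite /cintegral.
  under [X in Complex X _]eq_Rintegral do rewrite /cexpi /= mulr0z mul0r cos0.
  under [X in Complex _ X]eq_Rintegral do rewrite /cexpi /= mulr0z mul0r sin0.
  by rewrite !Rintegral_circle_cst mul1r mul0r.
set a : R := j%:~R; have a0 : a != 0 by rewrite intr_eq0.
have [cs sn] := cos_sin_2pi j; rewrite -/a in cs sn.
have p0 : 0 < 2 * pi :> R by rewrite mulr_gt0 ?pi_gt0.
have ds (x : R) : is_derive x 1 (fun x => a^-1 * sin (a * x)) (cos (a * x)).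
  have d1 : is_derive x 1 (fun x => a * x) a.
    rewrite (_ : (fun x => a * x) = a \*: id)//.
    by apply: is_derive_eq; rewrite /GRing.scale/= mulr1.
  have d2 := is_derive1_comp (is_derive_sin (a * x)) d1.
  rewrite (_ : (fun x => a^-1 * sin (a * x)) = a^-1 \*: (sin \o (fun x => a * x)))//.
  by apply: is_derive_eq; rewrite /GRing.scale/=; field.
have dc (x : R) : is_derive x 1 (fun x => - a^-1 * cos (a * x)) (sin (a * x)).
  have d1 : is_derive x 1 (fun x => a * x) a.
    rewrite (_ : (fun x => a * x) = a \*: id)//.
    by apply: is_derive_eq; rewrite /GRing.scale/= mulr1.
  have d2 := is_derive1_comp (is_derive_cos (a * x)) d1.
  rewrite (_ : (fun x => - a^-1 * cos (a * x)) = (- a^-1) \*: (cos \o (fun x => a * x)))//.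
  by apply: is_derive_eq; rewrite /GRing.scale/=; field.
have FTC (f F : R -> R) : (forall x : R, is_derive x 1 F (f x)) -> continuous f ->
    \int[leb]_(x in circ) f x = F (2 * pi) - F 0.
  move=> dF cf; have cF : continuous F.
    by move=> x; apply/differentiable_continuous/derivable1_diffP; have [] := dF x.
  rewrite /Rintegral (continuous_FTC2 (F := F))//.
  - exact: continuous_subspaceT.
  - split; first by move=> x _; have [] := dF x.
    + by apply: cvg_at_right_filter; exact: cF.
    + by apply: cvg_at_left_filter; exact: cF.
  - by move=> x _; rewrite derive1E; have [] := dF x.
rewrite /cintegral /cexpi /= (FTC _ _ ds (@continuous_cosM a)) (FTC _ _ dc (@continuous_sinM a)).
by rewrite cs sn !mulr0 sin0 cos0 subrr mulr0 subrr.
Qed.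

Lemma nc_cintegral f (a : R) : rint f ->
  nc (cintegral leb circ (fun x => (f x)%:C%C * cexpi (a * x))) <= 2 * \int[leb]_(x in circ) `|f x|.
Proof.
move=> rf; have [c1 c2] := cint_mul_mode a rf.
apply: (le_trans (normc_le_ReIm _)); rewrite mulrDl mul1r /cintegral /=; apply: lerD.
  apply: (le_trans (le_normr_Rintegral (mu := leb) measurable_circle c1)).
  apply: le_Rintegral => //; [exact: rint_norm|exact: rint_norm|].
  by move=> x _; rewrite Re_mulc /= mul0r subr0 normrM ler_piMr// normr_cos_le1.
apply: (le_trans (le_normr_Rintegral (mu := leb) measurable_circle c2)).
apply: le_Rintegral => //; [exact: rint_norm|exact: rint_norm|].
by move=> x _; rewrite Im_mulc /= mul0r addr0 normrM ler_piMr// normr_sin_le1.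
Qed.

End circle_integrals.
#[global] Hint Resolve measurable_circle : core.

(** * Fourier series of real functions *)

Section fourier_facts.
Context {R : realType}.
Local Notation leb := (@lebesgue_measure R).
Local Notation circ := (@circle R).
Local Notation nc := (@Normc.normc R).
Implicit Types (f g : R -> R) (al : int -> R[i]) (N : nat).

#[local] Hint Extern 0 (measurable _) => solve [exact: measurable_circle] : core.

Lemma sum_seq_eq (I : eqType) (V : nmodType) (r : seq I) (i : I) (F : I -> V) :
  uniq r -> i \in r -> \sum_(j <- r | j == i) F j = F i.
Proof.
move=> ur ir; rewrite big_mkcond (bigD1_seq i)//= eqxx big1 ?addr0// => k.
by move=> /negbTE ->.
Qed.

Lemma twopi_gt0 : 0 < 2 * pi :> R. Proof. by rewrite mulr_gt0 ?pi_gt0. Qed.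

Lemma fourier_coefE f (n : int) : fourier_coef f n =
  ((2 * pi)^-1)%:C%C * cintegral leb circ (fun x => (f x)%:C%C * cexpi ((- n)%:~R * x)).
Proof. by rewrite /fourier_coef; under eq_fun do rewrite -mulNr -mulrNz. Qed.

Definition trig al N x : R[i] := \sum_(n <- nzints N) al n * cexpi (n%:~R * x).
Definition rtrig al N x : R := complex.Re (trig al N x).
Definition hermitian al : Prop := forall n, n != 0 -> al (- n) = (al n)^*%C.

Lemma big_nzints (V : nmodType) (F : int -> V) N :
  \sum_(n <- nzints N) F n = \sum_(k <- iota 1 N) F k%:Z + \sum_(k <- iota 1 N) F (- k%:Z).
Proof. by rewrite /nzints big_cat !big_map. Qed.

Lemma trig_real al N x : hermitian al -> trig al N x = (rtrig al N x)%:C%C.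
Proof.
move=> hal; apply/eqP; rewrite eq_complex /rtrig eqxx /=; apply/eqP.
rewrite /trig big_nzints raddfD /= !raddf_sum /= -big_split /= big_seq.
apply: big1 => k; rewrite mem_iota => /andP[k0 _].
rewrite hal ?eqz_nat -?lt0n// mulrNz mulNr -cexpi_conj.
rewrite !Im_mulc; case: (al k) => a b /=; ring.
Qed.

Lemma rtrig_continuous al N : continuous (rtrig al N).
Proof.
have -> : rtrig al N = (fun x => \sum_(n <- nzints N) (complex.Re (al n) * cos (n%:~R * x) - complex.Im (al n) * sin (n%:~R * x))).
  by apply/funext => x; rewrite /rtrig /trig raddf_sum /=; apply: eq_bigr => n _; rewrite Re_mulc.
elim: (nzints N) => [|n s IH].
  by under eq_fun do rewrite big_nil; move=> x; exact: cvg_cst.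
under eq_fun do rewrite big_cons.
move=> x; apply: cvgD; last exact: IH.
by apply: cvgB; apply: cvgM; [exact: cvg_cst|exact: continuous_cosM|exact: cvg_cst|exact: continuous_sinM].
Qed.

Lemma rtrig_sqint al N : square_integrable (rtrig al N).
Proof. exact: sqint_continuous (@rtrig_continuous al N). Qed.

Lemma fourier_coefB f g (n : int) : rint f -> rint g ->
  fourier_coef (fun x => f x - g x) n = fourier_coef f n - fourier_coef g n.
Proof.
move=> rf rg; rewrite !fourier_coefE -mulrBr; congr (_ * _).
have cf := cint_mul_mode ((- n)%:~R) rf.
have cg := cintZ (-1) (cint_mul_mode ((- n)%:~R) rg).
rewrite -mulN1r -cintegralZ; last exact: cint_mul_mode.
rewrite -cintegralD//; congr (cintegral _ _ _); apply/funext => x.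
by rewrite rmorphB; ring.
Qed.

Lemma nc_fourier_coef f (n : int) : rint f ->
  nc (fourier_coef f n) <= pi^-1 * \int[leb]_(x in circ) `|f x|.
Proof.
move=> rf; rewrite fourier_coefE Normc.normcM normc_real.
have p0 : 0 < 2 * pi :> R := twopi_gt0.
rewrite ger0_norm ?invr_ge0 ?(ltW p0)//.
apply: (le_trans (ler_wpM2l _ (nc_cintegral _ rf))); first by rewrite invr_ge0 ltW.
rewrite mulrA le_eqVlt; apply/orP; left; apply/eqP; congr (_ * _).
by rewrite invfM mulrAC mulVf ?mul1r// pnatr_eq0.
Qed.

Lemma fourier_coef_rtrig al N (m : int) : hermitian al ->
  fourier_coef (rtrig al N) m = \sum_(n <- nzints N | n == m) al n.
Proof.
move=> hal; rewrite fourier_coefE.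
transitivity (((2 * pi)^-1)%:C%C * cintegral leb circ (fun x => \sum_(n <- nzints N) al n * cexpi ((n - m)%:~R * x)) : R[i]).
  congr (_ * cintegral _ _ _); apply/funext => x; rewrite -trig_real// /trig mulr_suml.
  by apply: eq_bigr => n _; rewrite -mulrA -cexpiD -mulrDl -intrD.
rewrite cintegral_sum; last by move=> n; apply: cintZ; exact: cint_mode.
rewrite mulr_sumr [RHS]big_mkcond; apply: eq_bigr => n _.
rewrite cintegralZ; last exact: cint_mode.
rewrite cintegral_mode subr_eq0; case: eqP => _; last by rewrite !mulr0.
rewrite mulrCA -rmorphM mulVf ?mulr1// gt_eqF//; exact: twopi_gt0.
Qed.

Lemma fourier_coef_sqr_rtrig al N (m : int) : hermitian al ->
  fourier_coef (fun x => rtrig al N x ^+ 2) m =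
  \sum_(n <- nzints N) \sum_(k <- nzints N | n + k == m) al n * al k.
Proof.
move=> hal; rewrite fourier_coefE.
transitivity (((2 * pi)^-1)%:C%C * cintegral leb circ (fun x => \sum_(n <- nzints N) \sum_(k <- nzints N)
    (al n * al k) * cexpi ((n + k - m)%:~R * x)) : R[i]).
  congr (_ * cintegral _ _ _); apply/funext => x; rewrite rmorphXn /= -trig_real// /trig expr2.
  rewrite -mulrA mulr_suml; apply: eq_bigr => n _.
  rewrite mulr_suml mulr_sumr; apply: eq_bigr => k _.
  by rewrite !intrD !mulrDl !cexpiD; ring.
rewrite cintegral_sum; last by move=> n; apply: cint_sum => k; apply: cintZ; exact: cint_mode.
rewrite mulr_sumr; apply: eq_bigr => n _.
rewrite cintegral_sum; last by move=> k; apply: cintZ; exact: cint_mode.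
rewrite mulr_sumr [RHS]big_mkcond; apply: eq_bigr => k _.
rewrite cintegralZ; last exact: cint_mode.
rewrite cintegral_mode subr_eq0; case: eqP => _; last by rewrite !mulr0.
rewrite mulrCA -rmorphM mulVf ?mulr1// gt_eqF//; exact: twopi_gt0.
Qed.

Lemma fourier_coefN f n : rint f -> fourier_coef f (- n) = (fourier_coef f n)^*%C.
Proof.
move=> rf.
have [c1 c2] := cint_mul_mode ((- n)%:~R) rf.
rewrite !fourier_coefE /cintegral; apply/eqP; rewrite eq_complex /= !mul0r !subr0 !addr0.
apply/andP; split; apply/eqP.
  congr (_ * _); apply: eq_Rintegral => x _.
  by rewrite !mul0r !subr0 opprK mulrNz mulNr cosN.
rewrite -mulrN; congr (_ * _).
rewrite -[RHS]mulN1r -RintegralZl; [|exact: measurable_circle|exact: c2].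
apply: eq_Rintegral => x _.
by rewrite /= !mul0r !addr0 mulN1r opprK mulrNz [in RHS]mulNr sinN mulrN opprK.
Qed.

Lemma hermitian_fourier f : rint f -> hermitian (fourier_coef f).
Proof. by move=> rf n _; exact: fourier_coefN. Qed.

Lemma sum_nc_nzints al N : hermitian al ->
  \sum_(n <- nzints N) nc (al n) ^+ 2 = 2 * energy N (fun n => al n%:Z).
Proof.
move=> hal; rewrite big_nzints /energy mulrDl mul1r; congr (_ + _).
rewrite big_seq [RHS]big_seq; apply: eq_bigr => k; rewrite mem_iota => /andP[k0 _].
by rewrite hal ?normc_conj// eqz_nat -lt0n.
Qed.

Lemma mem_nzints N (n : int) : (n \in nzints N) = (0 < `|n| <= N)%N.
Proof.
rewrite /nzints mem_cat; apply/idP/idP.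
  by case/orP => /mapP[k]; rewrite mem_iota => kN ->; lia.
case: n => n nN; apply/orP; [left|right]; apply/mapP.
  by exists n => //; rewrite mem_iota; lia.
by exists n.+1; [rewrite mem_iota; lia|rewrite NegzE].
Qed.

Lemma uniq_nzints N : uniq (nzints N).
Proof.
rewrite /nzints cat_uniq !map_inj_uniq ?iota_uniq /=; [|by move=> ? ? /oppr_inj []|by move=> ? ? []].
rewrite andbT; apply/hasPn => n /mapP[k]; rewrite mem_iota => /andP[k0 _] ->.
by apply/negP => /mapP[l _]; case: k k0.
Qed.

Lemma nzints_opp N (n : int) (F : int -> R[i]) : n \in nzints N ->
  \sum_(k <- nzints N | n + k == 0) F k = F (- n).
Proof.
move=> nN; under eq_bigl do rewrite addrC addr_eq0.
by rewrite sum_seq_eq ?uniq_nzints// mem_nzints abszN -mem_nzints.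
Qed.

Lemma nc_sqr_conj (z : R[i]) : z * z^*%C = (nc z ^+ 2)%:C%C.
Proof. by rewrite sqr_normcE; case: z => a b; apply/eqP; rewrite eq_complex /=; apply/andP; split; apply/eqP; ring. Qed.

(** Parseval, for a trigonometric polynomial: the coefficient of its square at
    the frequency 0. *)
Lemma integral_sqr_rtrig al N : hermitian al ->
  \int[leb]_(x in circ) (rtrig al N x ^+ 2) = 4 * pi * energy N (fun n => al n%:Z).
Proof.
move=> hal; have := fourier_coef_sqr_rtrig N 0 hal.
have -> : \sum_(n <- nzints N) \sum_(k <- nzints N | n + k == 0) al n * al k =
   (2 * energy N (fun n => al n%:Z))%:C%C.
  rewrite -sum_nc_nzints// rmorph_sum /= big_seq [RHS]big_seq; apply: eq_bigr => n nN.
  by rewrite nzints_opp// hal ?nc_sqr_conj// -absz_gt0; move: nN; rewrite mem_nzints => /andP[].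
move=> /(congr1 (@complex.Re R)); rewrite fourier_coefE Re_mulc /= mul0r subr0.
under eq_Rintegral do rewrite oppr0 mulr0z mul0r cos0 mulr1 mul0r subr0.
move=> /(congr1 (fun z => (2 * pi) * z)); rewrite mulrA divff ?mul1r ?gt_eqF ?twopi_gt0// => ->.
by ring.
Qed.

Lemma integral_mul_rtrig f al N : rint f -> hermitian al ->
  \int[leb]_(x in circ) (f x * rtrig al N x) =
  2 * pi * \sum_(n <- nzints N) complex.Re (al n * (fourier_coef f n)^*%C).
Proof.
move=> rf hal.
have cm n : cint (fun x => al n * ((f x)%:C%C * cexpi (n%:~R * x))).
  by apply: cintZ; exact: cint_mul_mode.
transitivity (complex.Re (cintegral leb circ (fun x => \sum_(n <- nzints N) al n * ((f x)%:C%C * cexpi (n%:~R * x))))).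
  rewrite /cintegral /=; apply: eq_Rintegral => x _.
  have -> : \sum_(n <- nzints N) al n * ((f x)%:C%C * cexpi (n%:~R * x)) = (f x)%:C%C * trig al N x.
    by rewrite /trig mulr_sumr; apply: eq_bigr => n _; rewrite mulrCA.
  by rewrite Re_mulc /= mul0r subr0.
have Re_sum (F : int -> R[i]) : complex.Re (\sum_(n <- nzints N) F n) =
    \sum_(n <- nzints N) complex.Re (F n) by rewrite raddf_sum.
rewrite cintegral_sum// Re_sum mulr_sumr; apply: eq_bigr => n _.
rewrite cintegralZ; last exact: cint_mul_mode.
rewrite -fourier_coefN// fourier_coefE opprK mulrCA.
rewrite [in RHS](Re_mulc ((2 * pi)^-1)%:C%C) [complex.Im _%:C%C]/= mul0r subr0 [complex.Re _%:C%C]/=.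
by rewrite mulrA divff ?mul1r// gt_eqF// twopi_gt0.
Qed.

(** Bessel: the partial sum of the Fourier series is an orthogonal projection.
    *)
Lemma rtrig_error f N : square_integrable f ->
  \int[leb]_(x in circ) ((f x - rtrig (fourier_coef f) N x) ^+ 2) =
  \int[leb]_(x in circ) (f x ^+ 2) - 4 * pi * energy N (fun n => fourier_coef f n%:Z).
Proof.
move=> sf; have rf := sqint_rint sf; have hf := hermitian_fourier rf.
set s := rtrig _ _; have ss : square_integrable s := rtrig_sqint _ _.
transitivity (\int[leb]_(x in circ) ((f x ^+ 2 - 2 * (f x * s x)) + s x ^+ 2)).
  by apply: eq_Rintegral => x _; ring.
have r1 : rint (fun x => f x ^+ 2) by case: sf.
have r2 : rint (fun x => f x * s x) by exact: sqint_mul.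
have r3 : rint (fun x => s x ^+ 2) by case: ss.
rewrite RintegralD//; [|exact: (rintB r1 (rintZ 2 r2))].
rewrite RintegralB//; [|exact: rintZ].
rewrite RintegralZl// integral_mul_rtrig// integral_sqr_rtrig//.
have -> : \sum_(n <- nzints N) complex.Re (fourier_coef f n * (fourier_coef f n)^*%C) =
  2 * energy N (fun n => fourier_coef f n%:Z).
  by rewrite -sum_nc_nzints//; apply: eq_bigr => n _; rewrite nc_sqr_conj.
by ring.
Qed.

Lemma Rint_sqr_ge0 f : 0 <= \int[leb]_(x in circ) (f x ^+ 2).
Proof. by apply: Rintegral_ge0 => x _; exact: sqr_ge0. Qed.

Lemma energy_le f N : square_integrable f ->
  4 * pi * energy N (fun n => fourier_coef f n%:Z) <= \int[leb]_(x in circ) (f x ^+ 2).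
Proof. by move=> sf; rewrite -subr_ge0 -rtrig_error//; exact: Rint_sqr_ge0. Qed.

(** The weighted inequality 2 |f g| <= f ^ 2 / de + de g ^ 2 takes the place
    of the Cauchy-Schwarz inequality; de is chosen small first, and the integral
    of f ^ 2 afterwards. *)
Lemma integral_mul_le f g (de : R) : 0 < de -> square_integrable f -> square_integrable g ->
  \int[leb]_(x in circ) `|f x * g x| <=
  (de^-1 * \int[leb]_(x in circ) (f x ^+ 2) + de * \int[leb]_(x in circ) (g x ^+ 2)) / 2.
Proof.
move=> de0 sf sg.
have r1 : rint (fun x => f x ^+ 2) by case: sf.
have r2 : rint (fun x => g x ^+ 2) by case: sg.
have r3 := rintZ (de^-1 / 2) r1; have r4 := rintZ (de / 2) r2.
rewrite mulrDl [de^-1 * _ / 2]mulrAC [de * _ / 2]mulrAC.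
rewrite -!RintegralZl// -RintegralD//.
apply: le_Rintegral => //; [exact: rint_norm (sqint_mul sf sg)|exact: rintD|].
move=> x _; rewrite normrM.
have := sqr_ge0 (`|f x| - de * `|g x|); rewrite sqrrB exprMn !real_normK ?num_real// => h.
have -> : de^-1 / 2 * f x ^+ 2 + de / 2 * g x ^+ 2 =
   (de^-1 / 2) * (f x ^+ 2 + de ^+ 2 * g x ^+ 2) by field; rewrite gt_eqF.
have -> : `|f x| * `|g x| = (de^-1 / 2) * (`|f x| * (de * `|g x|) *+ 2).
  by rewrite -mulr_natr; field; rewrite gt_eqF.
by rewrite ler_wpM2l ?divr_ge0 ?invr_ge0 ?(ltW de0)//; lra.
Qed.

Lemma nc_real_fun f al N x : hermitian al ->
  nc ((f x)%:C%C - trig al N x) ^+ 2 = (f x - rtrig al N x) ^+ 2.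
Proof.
by move=> hal; rewrite trig_real// -rmorphB normc_real real_normK ?num_real.
Qed.

(** Fourier coefficients are continuous in L^2, and those of a partial sum of
    the series are its own. *)
Lemma fourier_series_unique f al : square_integrable f -> hermitian al ->
  is_fourier_series f al -> forall n : int, n != 0 -> fourier_coef f n = al n.
Proof.
move=> sf hal fal n n0; apply/eqP; rewrite -subr_eq0; apply/eqP/Normc.eq0_normc/eqP.
rewrite eq_le normc_ge0 andbT; apply/ler_addgt0Pr => e e0; rewrite add0r.
have p0 := @pi_gt0 R.
(* the constant makes both halves of the weighted bound equal to e / 2 *)
pose de := e / 2.
have de0 : 0 < de by rewrite divr_gt0.
have [N [nN HN]] : exists N, n \in nzints N /\
    \int[leb]_(x in circ) ((f x - rtrig al N x) ^+ 2) <= pi * e * de.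
  have pe : 0 < pi * e * de by rewrite !mulr_gt0.
  have /cvgrPdist_le /(_ _ pe) [N0 _ HN0] := fal.
  exists (maxn N0 `|n|); split; first by rewrite mem_nzints leq_maxr absz_gt0 n0.
  have := HN0 (maxn N0 `|n|) (leq_maxl _ _); rewrite /= sub0r normrN.
  under eq_Rintegral do rewrite nc_real_fun//.
  by rewrite ger0_norm ?Rint_sqr_ge0.
have sr := rtrig_sqint al N.
have -> : fourier_coef f n - al n = fourier_coef (fun x => f x - rtrig al N x) n.
  rewrite fourier_coefB; [|exact: sqint_rint|exact: sqint_rint].
  rewrite fourier_coef_rtrig//; congr (_ - _).
  by rewrite sum_seq_eq ?uniq_nzints.
have sd := sqintB sf sr.
apply: (le_trans (nc_fourier_coef n (sqint_rint sd))).
have s1 : square_integrable (cst (1 : R)) by apply: sqint_continuous => x; exact: cvg_cst.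
have := integral_mul_le de0 sd s1.
under eq_Rintegral do rewrite /= mulr1.
under [X in _ <= (_ + de * X) / 2 -> _]eq_Rintegral do rewrite /= expr1n.
rewrite Rintegral_circle_cst mul1r => H.
rewrite mulrC ler_pdivrMr//; apply: (le_trans H).
have H2 : de^-1 * \int[leb]_(x in circ) ((f x - rtrig al N x) ^+ 2) <= pi * e.
  by rewrite mulrC ler_pdivrMr.
have : de * (2 * pi) = pi * e by rewrite /de; field.
lra.
Qed.

(** A pair with n + k = m > 0 consists of two positive frequencies or of one
    of each sign; two negative ones cannot occur. *)
Lemma quad_sum al N (m : nat) : hermitian al -> (0 < m)%N ->
  \sum_(n <- nzints N) \sum_(k <- nzints N | n + k == m%:Z) al n * al k =
  quad N (fun n => al n%:Z) m.
Proof.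
move=> hal m0; rewrite big_nzints /quad.
have E (n : int) : \sum_(k <- nzints N | n + k == m%:Z) al n * al k =
   \sum_(k <- iota 1 N | n + k%:Z == m%:Z) al n * al k%:Z +
   \sum_(k <- iota 1 N | n - k%:Z == m%:Z) al n * al (- k%:Z).
  by rewrite big_mkcond big_nzints -!big_mkcond.
under eq_bigr do rewrite E.
under [X in _ + X]eq_bigr do rewrite E.
rewrite !big_split /= -!addrA; congr (_ + _).
have mixed : \sum_(l <- iota 1 N | (m + l <= N)%N) al (m + l)%N%:Z * (al l%:Z)^*%C =
   \sum_(l <- iota 1 N) \sum_(k <- iota 1 N | k%:Z - l%:Z == m%:Z) al k%:Z * al (- l%:Z).
  rewrite big_mkcond big_seq [RHS]big_seq; apply: eq_bigr => l lN.
  have l0 : l%:Z != 0 by move: lN; rewrite mem_iota eqz_nat -lt0n => /andP[].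
  have H k : (k%:Z - l%:Z == m%:Z) = (k == (m + l)%N).
    by rewrite subr_eq -PoszD eqz_nat.
  under [RHS]eq_bigl do rewrite H.
  case: ifP => mlN.
    by rewrite sum_seq_eq ?iota_uniq ?hal// mem_iota; lia.
  rewrite big_seq_cond big1// => k /andP[kN /eqP kE].
  by move: kN; rewrite kE mem_iota; lia.
have Z : \sum_(k <- iota 1 N) \sum_(l <- iota 1 N | - k%:Z - l%:Z == m%:Z) al (- k%:Z) * al (- l%:Z) = 0.
  apply: big1 => k _; apply: big1 => l /eqP H; exfalso; lia.
rewrite Z addr0 mulr2n mulrDl mul1r mixed; congr (_ + _).
  by rewrite (exchange_big_dep xpredT).
apply: eq_bigr => l _; apply: eq_big => k; first by rewrite addrC.
by rewrite mulrC.
Qed.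

(** The difference of the squares factors as (f - s) (f + s), and the partial
    sum s has no more mass than f. *)
Lemma quad_error f N (m : nat) (de : R) : 0 < de -> (0 < m)%N -> square_integrable f ->
  nc (fourier_coef (fun x => f x ^+ 2) m%:Z - quad N (fun n => fourier_coef f n%:Z) m) <=
  (2 * pi)^-1 * (de^-1 * \int[leb]_(x in circ) ((f x - rtrig (fourier_coef f) N x) ^+ 2) +
     de * (4 * \int[leb]_(x in circ) (f x ^+ 2))).
Proof.
move=> de0 m0 sf; have hf := hermitian_fourier (sqint_rint sf).
have p0 := @pi_gt0 R.
rewrite -quad_sum// -fourier_coef_sqr_rtrig//.
set s := rtrig _ _; have ss : square_integrable s := rtrig_sqint _ _.
have r1 : rint (fun x => f x ^+ 2) by case: sf.
have r3 : rint (fun x => s x ^+ 2) by case: ss.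
rewrite -fourier_coefB//; apply: (le_trans (nc_fourier_coef _ (rintB r1 r3))).
have sd := sqintB sf ss; have sp := sqintD sf ss.
have H := integral_mul_le de0 sd sp.
have H2 : \int[leb]_(x in circ) ((f x + s x) ^+ 2) <= 4 * \int[leb]_(x in circ) (f x ^+ 2).
  apply: (@le_trans _ _ (\int[leb]_(x in circ) (2 * f x ^+ 2 + 2 * s x ^+ 2))).
    apply: le_Rintegral => //; [by case: sp|exact: rintD (rintZ 2 r1) (rintZ 2 r3)|].
    by move=> x _; have := sqr_ge0 (f x - s x); rewrite sqrrB sqrrD; lra.
  rewrite RintegralD//; [|exact: rintZ|exact: rintZ].
  rewrite !RintegralZl//.
  have : \int[leb]_(x in circ) (s x ^+ 2) <= \int[leb]_(x in circ) (f x ^+ 2).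
    by rewrite integral_sqr_rtrig//; exact: energy_le.
  lra.
have -> : \int[leb]_(x in circ) `|f x ^+ 2 - s x ^+ 2| = \int[leb]_(x in circ) `|(f x - s x) * (f x + s x)|.
  by apply: eq_Rintegral => x _; rewrite -subr_sqr.
rewrite invfM mulrAC mulrC ler_wpM2r ?invr_ge0 ?(ltW p0)//.
apply: (le_trans H); rewrite mulrC ler_wpM2l//.
by rewrite lerD2l ler_wpM2l// ltW.
Qed.

End fourier_facts.

(** * Uniform estimates along a solution *)

Section solution_facts.
Context {R : realType}.
Local Notation leb := (@lebesgue_measure R).
Local Notation circ := (@circle R).
Local Notation nc := (@Normc.normc R).
#[local] Hint Extern 0 (measurable _) => solve [exact: measurable_circle] : core.

Definition mass (f : R -> R) : R := \int[leb]_(x in circ) (f x ^+ 2).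

Lemma mass_ge0 f : 0 <= mass f. Proof. exact: Rint_sqr_ge0. Qed.

(** Expand f ^ 2 as ((f - g) + g) ^ 2 and weigh the cross term. *)
Lemma mass_perturb (f g : R -> R) (de : R) : 0 < de -> square_integrable f -> square_integrable g ->
  `|mass f - mass g| <= (1 + de^-1) * mass (fun x => f x - g x) + de * mass g.
Proof.
move=> de0 sf sg; have sd := sqintB sf sg.
have r1 : rint (fun x => f x ^+ 2) by case: sf.
have r2 : rint (fun x => g x ^+ 2) by case: sg.
have r3 : rint (fun x => (f x - g x) ^+ 2) by case: sd.
have r4 := sqint_mul sd sg.
have -> : mass f - mass g = mass (fun x => f x - g x) + 2 * \int[leb]_(x in circ) ((f x - g x) * g x).
  rewrite /mass -RintegralB// -RintegralZl// -RintegralD//; last exact: rintZ.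
  by apply: eq_Rintegral => x _; ring.
apply: (le_trans (ler_normD _ _)); rewrite ger0_norm ?mass_ge0//.
rewrite [in leRHS]mulrDl mul1r -addrA lerD2l normrM ger0_norm//.
have H := integral_mul_le de0 sd sg.
have H2 : `|\int[leb]_(x in circ) ((f x - g x) * g x)| <= \int[leb]_(x in circ) `|(f x - g x) * g x|.
  exact: le_normr_Rintegral.
by move: (le_trans H2 H); rewrite ler_pdivlMr// mulrC.
Qed.

Variables (eps : R) (a : int -> R[i]) (u : R -> R -> R).
Hypothesis eps0 : 0 <= eps.
Hypothesis ua : is_global_solution bbm_omega bbm_phi eps a u.
Hypothesis ha : hermitian a.

Let su t : square_integrable (u t). Proof. by case: ua => /(_ t)[]. Qed.

Definition tail N t : R := mass (fun x => u t x - rtrig (fourier_coef (u t)) N x).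

Lemma tailE N t : tail N t =
  mass (u t) - 4 * pi * energy N (fun n => fourier_coef (u t) n%:Z).
Proof. by rewrite /tail /mass rtrig_error. Qed.

Lemma mass_solution_continuous : continuous (fun t => mass (u t)).
Proof.
move=> t; apply/cvgrPdist_le => e e0.
have [_ ut _ _] := ua.
(* the constant makes the last term of mass_perturb at most e / 2 *)
pose de := e / (2 * (mass (u t) + 1)).
have m1 : 0 < 2 * (mass (u t) + 1) by rewrite mulr_gt0// ltr_wpDl// mass_ge0.
have de0 : 0 < de by rewrite divr_gt0.
have k0 : 0 < 1 + de^-1 by rewrite addr_gt0// invr_gt0.
have e2 : 0 < e / 2 / (1 + de^-1) by rewrite !divr_gt0.
have /cvgrPdist_le /(_ _ e2) := ut t.
apply: filterS => s; rewrite sub0r normrN ger0_norm ?Rint_sqr_ge0// ler_pdivlMr// mulrC => H.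
rewrite distrC; apply: (le_trans (mass_perturb de0 (su s) (su t))).
have : de * mass (u t) <= e / 2.
  rewrite /de -mulrA ler_wpM2l ?(ltW e0)// mulrC ler_pdivrMr//.
  by have := mass_ge0 (u t); lra.
by move: H; rewrite -/(mass _); lra.
Qed.

Lemma is_derive_continuous (f : R -> R) (t l : R) : is_derive t (1 : R) f l -> {for t, continuous f}.
Proof. by move=> [d _]; apply: differentiable_continuous; apply/derivable1_diffP. Qed.

Lemma energy_solution_continuous N :
  continuous (fun t => energy N (fun n => fourier_coef (u t) n%:Z)).
Proof.
have [_ _ du _] := ua; rewrite /energy.
elim: (iota 1 N) => [|n s IH].
  by under eq_fun do rewrite big_nil; move=> t; exact: cvg_cst.
under eq_fun do rewrite big_cons sqr_normcE.
move=> t; apply: cvgD; last exact: IH.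
have [/is_derive_continuous c1 /is_derive_continuous c2] := du t n%:Z.
by under eq_fun do rewrite !expr2; apply: cvgD; apply: cvgM.
Qed.

Lemma tail_continuous N : continuous (tail N).
Proof.
have -> : tail N = (fun t => mass (u t) - 4 * pi * energy N (fun n => fourier_coef (u t) n%:Z)).
  by apply/funext => t; rewrite tailE.
move=> t; apply: cvgB; first exact: mass_solution_continuous.
by apply: cvgM; [exact: cvg_cst|exact: energy_solution_continuous].
Qed.

Lemma energy_nondecreasing (N N' : nat) (c : nat -> R[i]) : (N <= N')%N -> energy N c <= energy N' c.
Proof.
move=> NN'; rewrite /energy -(subnKC NN') iotaD big_cat lerDl.
by apply: sumr_ge0 => k _; exact: sqr_ge0.
Qed.

Lemma tail_nonincreasing N N' t : (N <= N')%N -> tail N' t <= tail N t.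
Proof.
move=> NN'; rewrite !tailE lerD2l lerN2 ler_wpM2l ?energy_nondecreasing//.
by rewrite mulr_ge0// pi_ge0.
Qed.

Lemma tail_cvg0 t : tail ^~ t @ \oo --> (0 : R).
Proof.
have [/(_ t)[_ ft] _ _ _] := ua; apply: cvg_trans ft; apply: near_eq_cvg; near=> N.
apply: eq_Rintegral => x _; rewrite nc_real_fun//.
exact: hermitian_fourier (sqint_rint (su t)).
Unshelve. all: by end_near. Qed.

(** Dini's theorem: the tails are continuous in time, decrease with N, and
    tend to 0 at each time; bounded time intervals are compact. *)
Lemma tail_uniform T e : 0 < e -> exists N0, forall N, (N0 <= N)%N ->
  forall t, `|t| <= T -> tail N t <= e.
Proof.
move=> e0; have /compact_near_coveringP nc := @segment_compact R (- T) T.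
have := nc nat \oo (fun N t => tail N t <= e) _.
case.
  move=> t _; have /cvgrPdist_lt /(_ _ e0) [N0 _ HN0] := tail_cvg0 t.
  have tN0 : tail N0 t < e.
    have := HN0 N0 (leqnn _); rewrite /= sub0r normrN.
    exact: le_lt_trans (ler_norm _).
  have tnear : \forall s \near t, tail N0 s < e.
    by apply: (@cvgr_lt R R (nbhs t) _ (tail N0) (tail N0 t)) => //; exact: tail_continuous.
  exists ([set s | tail N0 s < e], [set N | (N0 <= N)%N]) => /=.
    by split; [exact: tnear|exists N0].
  move=> [s N] /= [sN0 NN0].
  exact: le_trans (tail_nonincreasing _ NN0) (ltW sN0).
move=> N0 _ H; exists N0 => N NN0 t tT.
by apply: (H N NN0); rewrite /= in_itv /= -ler_norml.
Qed.

Lemma mass_bounded T : 0 <= T -> exists2 M, 0 <= M & forall t, `|t| <= T -> mass (u t) <= M.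
Proof.
move=> T0; have TT : - T <= T by rewrite -subr_ge0 opprK addr_ge0.
have [c _ H] := EVT_max TT (continuous_subspaceT mass_solution_continuous).
exists (mass (u c)); first exact: mass_ge0.
by move=> t tT; apply: H; rewrite in_itv /= -ler_norml.
Qed.

Lemma ler_pi1 : 1 <= pi :> R. Proof. by have := pi_ge2 R; lra. Qed.

(** The regularity asked of a solution, continuity in L^2 in time, is enough
    for the scheme to converge to it: the mass is bounded and the tails are
    uniformly small on bounded time intervals. *)
Lemma solution_scheme_cvg (Psi : nat -> R -> (nat * bool -> R) -> nat * bool -> R)
    (K : nat -> R) (J : nat -> nat) (x0 : nat * bool -> R) (t : R) :
  (forall N, 0 <= K N) ->
  (forall N h x, sqnorm (modes N) (Psi N h x) = sqnorm (modes N) x) ->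
  (forall N, step_error (modes N) (Psi N)
     (fun x => realify (truncated_field phin (triad_rate eps) N x)) (K N)) ->
  (forall N, N.+1%:R * (1 + 16 * K N * N.+1%:R ^+ 4) <= (J N)%:R) ->
  (forall n, (0 < n)%N -> scaled x0 n = a n%:Z) ->
  forall n, (0 < n)%N ->
  (fun N => nc (scaled (scheme Psi J N t x0) n - fourier_coef (u t) n%:Z)) @ \oo --> (0 : R).
Proof.
move=> K0 Psi1 Psi2 HJ hx0 n n0.
have [h1 h2 h3 h4] := ua.
pose T := `|t| + 1; have T0 : 0 <= T by rewrite addr_ge0.
have [M M0 HM] := mass_bounded T0.
have pi1 := ler_pi1.
have pV : pi^-1 <= 1 :> R by rewrite invf_le1// (lt_le_trans ltr01).
apply: (scheme_cvg (c := fun s n => fourier_coef (u s) n%:Z)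
   (q := fun s n => fourier_coef (fun x => u s x ^+ 2) n%:Z) (M := M) eps0 K0 Psi1 Psi2 HJ) => //.
- move=> s m m0; have := h3 s m%:Z; congr is_cderive.
  by rewrite /Lmult /Jmult /bbm_omega -/(phin m) rmorphN; ring.
- move=> s N sT; apply: le_trans (HM s sT); apply: le_trans (energy_le N (su s)).
  have E0 : 0 <= energy N (fun n => fourier_coef (u s) n%:Z) by apply: sumr_ge0 => k _; exact: sqr_ge0.
  by rewrite -[leLHS]mul1r ler_wpM2r//; lra.
- move=> s m sT _; apply: le_trans (HM s sT).
  have r : rint (fun x => u s x ^+ 2) by case: (su s).
  apply: (le_trans (nc_fourier_coef _ r)).
  have -> : \int[leb]_(x in circ) `|u s x ^+ 2| = mass (u s).
    by apply: eq_Rintegral => x _; rewrite ger0_norm ?sqr_ge0.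
  by rewrite -[leRHS]mul1r ler_wpM2r ?mass_ge0.
- move=> eta eta0.
  (* the constant makes the term of quad_error with the mass at most eta / 2 *)
  pose de := eta / (8 * (M + 1)).
  have M1 : 0 < 8 * (M + 1) by lra.
  have de0 : 0 < de by rewrite divr_gt0.
  have ee : 0 < de * (eta / 2) by rewrite mulr_gt0// divr_gt0.
  have [N0 HN0] := tail_uniform T ee; exists N0 => N NN0 s m sT mN.
  have m0 : (0 < m)%N by move: mN; rewrite mem_iota => /andP[].
  apply: (le_trans (quad_error N de0 m0 (su s))).
  have t1 : de^-1 * tail N s <= eta / 2 by rewrite mulrC ler_pdivrMr// mulrC HN0.
  have t2 : de * (4 * mass (u s)) <= eta / 2.
    rewrite /de -mulrA ler_wpM2l ?(ltW eta0)// mulrC ler_pdivrMr//.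
    by have := HM s sT; lra.
  have t3 : 0 <= de^-1 * tail N s + de * (4 * mass (u s)).
    by rewrite addr_ge0// mulr_ge0 ?invr_ge0 ?(ltW de0)//; [exact: mass_ge0|rewrite mulr_ge0// mass_ge0].
  have p2 : (2 * pi)^-1 <= 1 :> R by rewrite invf_le1 ?twopi_gt0//; lra.
  apply: (le_trans (ler_wpM2r t3 p2)); rewrite mul1r; lra.
- move=> m m0; rewrite hx0// (fourier_series_unique (su 0) ha h4)//.
  by rewrite eqz_nat -lt0n.
Qed.

End solution_facts.

(** * Covariance of the random solution *)

Section random_datum.
Context {R : realType} {d : measure_display} {Om : measurableType d} {P : probability Om R}.
Local Notation nc := (@Normc.normc R).
Variables (h l : nat -> {RV P >-> R}).
Hypothesis h_gauss : forall n : nat, (0 < n)%N -> standard_gaussian (h n).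
Hypothesis l_gauss : forall n : nat, (0 < n)%N -> standard_gaussian (l n).
Hypothesis hl_indep : mutually_independent [set i : nat * bool | (0 < i.1)%N]
  (fun i : nat * bool => if i.2 then h i.1 else l i.1).

Definition datum (w : Om) (i : nat * bool) : R := (if i.2 then h i.1 else l i.1) w.

Lemma gauss_family_datum N : gauss_family P (modes N) datum.
Proof.
split; first by move=> [n b] _; exact: measurable_funPT.
move=> A mA; rewrite (hl_indep (uniq_modes N) _ mA); last first.
  by move=> [n b]; rewrite mem_modes => /andP[].
rewrite big_seq [RHS]big_seq; apply: eq_bigr => -[n b]; rewrite mem_modes => /andP[n0 _].
by case: b => /=; [exact: (h_gauss n0)|exact: (l_gauss n0)].
Qed.

Lemma scaled_datum w n : scaled (datum w) n = gaussian_coef h l n%:Z w * (bbm_lambda n%:Z)%:C%C.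
Proof.
rewrite /scaled /gaussian_coef /cvec /datum /= /lambdan; apply/eqP; rewrite eq_complex /=.
by apply/andP; split; apply/eqP; ring.
Qed.

Lemma bbm_lambdaN (n : int) : bbm_lambda (- n) = bbm_lambda n :> R.
Proof. by rewrite /bbm_lambda mulrNz sqrrN. Qed.

Lemma hermitian_datum w : hermitian (fun n => gaussian_coef h l n w * (bbm_lambda n)%:C%C).
Proof.
move=> n n0; rewrite bbm_lambdaN rmorphM; congr (_ * _); last by rewrite /= oppr0.
by case: n n0 => [[//|n]|n] _ //; apply/esym; exact: conjcK.
Qed.

Lemma gauss_family_iter D (Psi : R -> (nat * bool -> R) -> nat * bool -> R) B k s F :
  good_step P D Psi B -> gauss_family P D F ->
  gauss_family P D (fun w => iter k (Psi s) (F w)).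
Proof. by move=> gPsi gF; elim: k => //= k IH; exact: step_law gPsi _ _ IH. Qed.

Variables (eps : R) (u : Om -> R -> R -> R).
Hypothesis eps0 : 0 <= eps.
Hypothesis u_rv : forall (t : R) (n : int),
  complex_random_variable (fun w => fourier_coef (u w t) n).
Hypothesis u_sol : {ae P, forall w, is_global_solution bbm_omega bbm_phi eps
  (fun n => gaussian_coef h l n w * (bbm_lambda n)%:C%C) (u w)}.

(** The Fourier coefficients of the solution at time t in the normalised
    coordinates, in which they turn out to be uncorrelated with variance 1 at all
    times. *)
Definition amplitude t (a : nat * bool) w : R :=
  Num.sqrt 2 / lambdan a.1 * realify (fun n => fourier_coef (u w t) n%:Z) a.

Lemma measurable_amplitude t a : measurable_fun setT (amplitude t a).
Proof.
apply: measurable_funM; first exact: measurable_cst.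
by case: a => n [] /=; have [] := u_rv t n%:Z.
Qed.

(** The scheme started from the datum is a Gaussian family for every
    truncation, and converges almost surely to the solution; hence the solution
    has the covariance of a standard Gaussian family. *)
Lemma amplitude_cov t a b : (0 < a.1)%N -> (0 < b.1)%N ->
  P.-integrable setT (fun w => (amplitude t a w * amplitude t b w)%:E) /\
  (\int[P]_w (amplitude t a w * amplitude t b w)%:E = (a == b)%:R%:E)%E.
Proof.
move=> a0 b0.
have S N := cid (splits_truncated P phin (triad_rate eps) N).
pose Psi N := projT1 (S N); have gPsi N : good_step P (modes N) (Psi N) _ := projT2 (S N).
have KS N := cid2 (step_err (gPsi N)).
pose K N := s2val (KS N).
have K0 N : 0 <= K N := s2valP (KS N).
have KE N : step_error (modes N) (Psi N) _ (K N) := s2valP' (KS N).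
pose J N := Num.bound (N.+1%:R * (1 + 16 * K N * N.+1%:R ^+ 4) : R).
have HJ N : N.+1%:R * (1 + 16 * K N * N.+1%:R ^+ 4) <= (J N)%:R.
  by rewrite ltW// archi_boundP// mulr_ge0// addr_ge0// mulr_ge0 ?exprn_ge0// mulr_ge0.
(* truncations below N0 do not contain the modes a and b *)
pose N0 := maxn a.1 b.1.
pose F N w := scheme Psi J (N + N0)%N t (datum w).
have cvgF c : (0 < c.1)%N ->
    {ae P, forall w, (fun N => F N w c) @ \oo --> amplitude t c w}.
  case: c => n b' /= n0; apply: filterS u_sol => w uw.
  have := solution_scheme_cvg eps0 uw (@hermitian_datum w) t K0
    (fun N => step_sqnorm (gPsi N)) KE HJ (fun n _ => scaled_datum w n) n0.
  rewrite -(cvg_shiftn N0) => sc.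
  have l0 := lambdan_gt0 (R := R) n.
  have s0 : 0 < Num.sqrt 2 :> R by rewrite sqrtr_gt0.
  have c0 : 0 < Num.sqrt 2 / lambdan n :> R by rewrite divr_gt0.
  apply/cvgrPdist_le => e e0.
  have ec : 0 < e / (Num.sqrt 2 / lambdan n) by rewrite divr_gt0.
  have /cvgrPdist_le /(_ _ ec) := sc; apply: filterS => N.
  rewrite sub0r normrN ger0_norm ?normc_ge0// ler_pdivlMr// => H.
  apply: le_trans H; rewrite -/(F N w).
  have FE : F N w (n, b') = Num.sqrt 2 / lambdan n * realify (scaled (F N w)) (n, b').
    have kE : Num.sqrt 2 / lambdan n * (lambdan n / Num.sqrt 2) = 1 :> R.
      by rewrite mulrA divfK ?gt_eqF// divff// gt_eqF.
    by rewrite /realify /scaled; case: (b') => /=; rewrite mul0r ?subr0 ?addr0 mulrA kE mul1r.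
  rewrite FE /amplitude -mulrBr normrM gtr0_norm// mulrC ler_wpM2r ?(ltW c0)//.
  apply: (@le_trans _ _ (nc (fourier_coef (u w t) n%:Z - scaled (F N w) n))); last by rewrite normc_distC.
  have rE (f : nat -> R[i]) : realify f (n, b') = if b' then complex.Re (f n) else complex.Im (f n) by [].
  rewrite !rE.
  move: (fourier_coef _ _) (scaled _ _) => [z1 z2] [y1 y2]; case: (b').
    exact: (normr_Re_le (Complex (z1 - y1) (z2 - y2))).
  exact: (normr_Im_le (Complex (z1 - y1) (z2 - y2))).
apply: (gauss_family_limit_cov (D := fun N => modes (N + N0)) (F := F)).
- by move=> N; exact: uniq_modes.
- move=> N; exact: gauss_family_iter (gPsi _) (gauss_family_datum _).
- by move=> N; rewrite (surjective_pairing a) mem_modes a0 (leq_trans (leq_maxl a.1 b.1))// leq_addl.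
- by move=> N; rewrite (surjective_pairing b) mem_modes b0 (leq_trans (leq_maxr a.1 b.1))// leq_addl.
- exact: measurable_amplitude.
- exact: measurable_amplitude.
- exact: cvgF.
- exact: cvgF.
Qed.

Lemma expectation_amplitude t (Z : Om -> R) (al be : R) a b c e' :
  (0 < a.1)%N -> (0 < b.1)%N -> (0 < c.1)%N -> (0 < e'.1)%N ->
  measurable_fun setT Z ->
  {ae P, forall w, Z w = al * (amplitude t a w * amplitude t b w) +
                         be * (amplitude t c w * amplitude t e' w)} ->
  fine ('E_P[Z])%E = al * (a == b)%:R + be * (c == e')%:R.
Proof.
move=> a0 b0 c0 e0 mZ Zae; rewrite unlock.
have [i1 e1] := amplitude_cov t a0 b0; have [i2 e2] := amplitude_cov t c0 e0.
rewrite (ae_eq_integral (fun w => (al%:E * (amplitude t a w * amplitude t b w)%:E +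
    be%:E * (amplitude t c w * amplitude t e' w)%:E)%E))//; first last.
- by apply: filterS Zae => w wZ _; rewrite wZ EFinD !EFinM.
- apply: emeasurable_funD; apply: emeasurable_funM => //; (exact: measurable_int i1 || exact: measurable_int i2).
- exact/measurable_EFinP.
rewrite integralD//; [|exact: integrableZl|exact: integrableZl].
by rewrite !integralZl// e1 e2.
Qed.

(** Conjugation changes the sign of the imaginary part at negative
    frequencies. *)
Definition frequency_sign (n : int) : R := if (0 <= n)%R then 1 else -1.

Lemma solution_coef t : {ae P, forall w, forall n : int, n != 0 ->
  fourier_coef (u w t) n = (bbm_lambda n / Num.sqrt 2)%:C%C *
    Complex (amplitude t (`|n|%N, true) w) (frequency_sign n * amplitude t (`|n|%N, false) w)}.
Proof.
apply: filterS u_sol => w [/(_ t)[sut _] _ _ _] n n0.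
have pos k : fourier_coef (u w t) k%:Z = (lambdan k / Num.sqrt 2)%:C%C *
    Complex (amplitude t (k, true) w) (amplitude t (k, false) w).
  have l0 := lambdan_gt0 (R := R) k.
  have s0 : 0 < Num.sqrt 2 :> R by rewrite sqrtr_gt0.
  have kE (x : R) : lambdan k / Num.sqrt 2 * (Num.sqrt 2 / lambdan k * x) = x.
    by rewrite !mulrA divfK ?gt_eqF// divff ?mul1r// gt_eqF.
  rewrite /amplitude /realify; move: (fourier_coef _ _) => [x y].
  by apply/eqP; rewrite eq_complex /= !mul0r subr0 addr0 !kE !eqxx.
case: n n0 => n n0; first by rewrite pos /frequency_sign /= mul1r.
rewrite NegzE bbm_lambdaN abszN (fourier_coefN _ (sqint_rint sut)) pos /frequency_sign /=.
apply/eqP; rewrite eq_complex /= -/(lambdan n.+1); apply/andP; split; apply/eqP; ring.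
Qed.

(** Frequencies of different modulus involve different modes. For m = - n, the
    contributions of the real and of the imaginary parts have opposite signs and
    cancel. *)
Lemma solution_covariance t (m n : int) : m != 0 -> n != 0 ->
  cexpectation P (fun w => (fourier_coef (u w t) m)^*%C * fourier_coef (u w t) n) =
  ((m == n)%:R * `|bbm_lambda n| ^+ 2)%:C%C.
Proof.
move=> m0 n0.
have [mR mI] := u_rv t m; have [nR nI] := u_rv t n.
have pm (k : int) (b : bool) : k != 0 -> (0 < (`|k|%N, b).1)%N by rewrite /= absz_gt0.
pose Z w := (fourier_coef (u w t) m)^*%C * fourier_coef (u w t) n.
pose C := bbm_lambda m / Num.sqrt 2 * (bbm_lambda n / Num.sqrt 2) : R.
have eR : fine ('E_P[fun w => complex.Re (Z w)])%E =
    C * ((`|m|%N, true) == (`|n|%N, true))%:R +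
    C * (frequency_sign m * frequency_sign n) * ((`|m|%N, false) == (`|n|%N, false))%:R.
  apply: (@expectation_amplitude t) => //; try exact: pm.
    rewrite (_ : (fun w => _) = (fun w => complex.Re (fourier_coef (u w t) m) * complex.Re (fourier_coef (u w t) n) +
      complex.Im (fourier_coef (u w t) m) * complex.Im (fourier_coef (u w t) n))).
      by apply: measurable_funD; apply: measurable_funM.
    by apply/funext => w; rewrite /Z; case: (fourier_coef _ m) (fourier_coef _ n) => a b [a' b'] /=; ring.
  apply: filterS (solution_coef t) => w H; rewrite /Z !H//= /C; ring.
have eI : fine ('E_P[fun w => complex.Im (Z w)])%E =
    C * frequency_sign n * ((`|m|%N, true) == (`|n|%N, false))%:R +
    - (C * frequency_sign m) * ((`|m|%N, false) == (`|n|%N, true))%:R.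
  apply: (@expectation_amplitude t) => //; try exact: pm.
    rewrite (_ : (fun w => _) = (fun w => complex.Re (fourier_coef (u w t) m) * complex.Im (fourier_coef (u w t) n) -
      complex.Im (fourier_coef (u w t) m) * complex.Re (fourier_coef (u w t) n))).
      by apply: measurable_funB; apply: measurable_funM.
    by apply/funext => w; rewrite /Z; case: (fourier_coef _ m) (fourier_coef _ n) => a b [a' b'] /=; ring.
  apply: filterS (solution_coef t) => w H; rewrite /Z !H//= /C; ring.
rewrite /cexpectation -/Z eR eI !xpair_eqE !andbT !andbF !mulr0 addr0; congr Complex.
have sq2 : Num.sqrt 2 * Num.sqrt 2 = 2 :> R by rewrite -expr2 sqr_sqrtr.
have s0 : Num.sqrt 2 != 0 :> R by rewrite gt_eqF// sqrtr_gt0.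
have CE : C = bbm_lambda m * bbm_lambda n / 2 by rewrite /C mulrACA; congr (_ * _); rewrite -invfM sq2.
have l0 : 0 <= bbm_lambda n :> R by rewrite /bbm_lambda invr_ge0.
rewrite ger0_norm// CE.
have [mn|mn] := eqVneq `|m|%N `|n|%N; last first.
  have -> : (m == n) = false by apply/negP => /eqP mnE; rewrite mnE eqxx in mn.
  by rewrite !mulr0 mul0r addr0.
have [->|mn'] := eqVneq m n.
  by rewrite /frequency_sign; case: ifP => _; field.
have mE : m = - n by move: mn mn'; lia.
have -> : frequency_sign m * frequency_sign n = -1.
  by rewrite mE /frequency_sign; case: (leP 0 n) => nn; case: (leP 0 (- n)) => nn'; rewrite ?mul1r ?mulr1//; exfalso; move: n0; lia.
by rewrite mul0r; ring.
Qed.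

(** E (h ^ 2 + l ^ 2) ^ 2 / 4 = (3 + 2 + 3) / 4. *)
Lemma fourth_moment_datum (n : int) : n != 0 -> fourth_moment P (gaussian_coef h l n) = 2.
Proof.
move=> n0.
pose k := `|n|%N; have k0 : (0 < k)%N by rewrite absz_gt0.
have kN b : (k, b) \in modes k by rewrite mem_modes k0 leqnn.
have gF := gauss_family_datum k; have uD := uniq_modes k.
have ncE w : nc (gaussian_coef h l n w) ^+ 4 =
    4^-1 * (datum w (k, true) ^+ 4 + 2 * (datum w (k, true) ^+ 2 * datum w (k, false) ^+ 2) + datum w (k, false) ^+ 4).
  have ncg : nc (gaussian_coef h l n w) = nc (((Num.sqrt 2)^-1)%:C%C * Complex (datum w (k, true)) (datum w (k, false))).
    by rewrite /k; case: n {n0 k k0 kN gF uD} => n //; rewrite /gaussian_coef normc_conj.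
  rewrite ncg Normc.normcM normc_real exprMn.
  have -> : `|(Num.sqrt 2)^-1| ^+ 4 = 4^-1 :> R.
    by rewrite (exprM _ 2 2) real_normK ?num_real// exprVn sqr_sqrtr// exprVn -natrX.
  rewrite (exprM _ 2 2) sqr_normcE /=; ring.
have mF b : measurable_fun setT (fun w => datum w (k, b)) by case: gF => mF _; exact: mF.
have m4 b : measurable_fun setT (fun w => datum w (k, b) ^+ 4) by exact: measurable_funX.
have m22 : measurable_fun setT (fun w => datum w (k, true) ^+ 2 * datum w (k, false) ^+ 2).
  by apply: measurable_funM; exact: measurable_funX.
have p4 b w : 0 <= datum w (k, b) ^+ 4 by rewrite exprn_even_ge0.
have p22 w : 0 <= datum w (k, true) ^+ 2 * datum w (k, false) ^+ 2.
  by rewrite mulr_ge0// sqr_ge0.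
have intD (f g : Om -> R) : (forall w, 0 <= f w) -> measurable_fun setT f ->
    (forall w, 0 <= g w) -> measurable_fun setT g ->
    (\int[P]_w (f w + g w)%:E = \int[P]_w (f w)%:E + \int[P]_w (g w)%:E)%E.
  move=> f0 mf g0 mg; under eq_integral do rewrite EFinD.
  by apply: ge0_integralD => //; (try by move=> w _; rewrite lee_fin); exact/measurable_EFinP.
have intZ (a : R) (f : Om -> R) : 0 <= a -> (forall w, 0 <= f w) -> measurable_fun setT f ->
    (\int[P]_w (a * f w)%:E = a%:E * \int[P]_w (f w)%:E)%E.
  move=> a0 f0 mf; under eq_integral do rewrite EFinM.
  by apply: ge0_integralZl_EFin => //; (try by move=> w _; rewrite lee_fin); exact/measurable_EFinP.
rewrite /fourth_moment unlock; under eq_integral do rewrite ncE.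
have m222 := measurable_funM (measurable_cst (2 : R)) m22.
have p222 w : 0 <= 2 * (datum w (k, true) ^+ 2 * datum w (k, false) ^+ 2) by rewrite mulr_ge0.
rewrite intZ//; [|by move=> w; rewrite !addr_ge0|by do !apply: measurable_funD].
rewrite intD//; [|by move=> w; rewrite addr_ge0|exact: measurable_funD].
have tf : (k, true) != (k, false) by rewrite xpair_eqE andbF.
rewrite intD// intZ// !(gauss_family_exp4 uD gF)// (gauss_family_sqr_sqr uD gF (kN true) (kN false) tf)/=.
by rewrite mulr1; field.
Qed.

End random_datum.

(** With phi (n) = n lambda_n ^ 2, each bracket of the sum over k + l = n
    equals lambda_n ^ 2 lambda_k ^ 2 lambda_l ^ 2 (n - k - l) = 0. *)
Lemma G_rhs_bbm {R : realType} (M4 : int -> R) (n : int) (t : R) : M4 n = 2 ->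
  G_rhs bbm_omega bbm_phi bbm_lambda M4 n t = 0.
Proof.
move=> M4n; rewrite /G_rhs M4n subrr mul0r addr0.
rewrite (_ : (fun N : nat => _) = fun=> 0) ?lim_cst ?mulr0//.
apply/funext => N; apply: big1 => k _ /=.
have lam (j : int) : `|bbm_lambda j| ^+ 2 = (1 + j%:~R ^+ 2)^-1 :> R.
  by rewrite real_normK ?num_real// /bbm_lambda exprVn sqr_sqrtr// addr_ge0 ?sqr_ge0.
rewrite !lam /bbm_phi -!mulrBl; set A := (1 + n%:~R ^+ 2)^-1.
rewrite intrB; set B := (1 + k%:~R ^+ 2)^-1; set D := (1 + _ ^+ 2)^-1.
by ring.
Qed.

Theorem proposition1p1 (R : realType) (d : measure_display)
    (Om : measurableType d) (P : probability Om R)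
    (h l : nat -> {RV P >-> R})
    (h_gauss : forall n : nat, (0 < n)%N -> standard_gaussian (h n))
    (l_gauss : forall n : nat, (0 < n)%N -> standard_gaussian (l n))
    (hl_indep : mutually_independent [set i : nat * bool | (0 < i.1)%N]
                  (fun i : nat * bool => if i.2 then h i.1 else l i.1))
    (G : int -> R -> R)
    (G_def : is_G bbm_omega bbm_phi bbm_lambda
               (fun n => fourth_moment P (gaussian_coef h l n)) G)
    (eps : R) (eps_gt0 : 0 < eps)
    (u : Om -> R -> R -> R)
    (u_rv : forall (t : R) (n : int),
       complex_random_variable (fun w => fourier_coef (u w t) n))
    (u_sol : {ae P, forall w, is_global_solution bbm_omega bbm_phi eps
       (fun n => gaussian_coef h l n w * (bbm_lambda n)%:C%C) (u w)}) :
  forall (m n : int) (t : R), m != 0 -> n != 0 ->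
    G n t = 0 /\
    remainder P bbm_lambda G eps t (fun k w => fourier_coef (u w t) k) m n = 0.
Proof.
move=> m n t m0 n0.
have Gt : G n t = 0.
  have [G0 dG] := G_def n n0; rewrite -G0; apply: is_derive_0_is_cst => s.
  have <- : G_rhs bbm_omega bbm_phi bbm_lambda
      (fun n => fourth_moment P (gaussian_coef h l n)) n s = 0; last exact: dG.
  by rewrite G_rhs_bbm// (fourth_moment_datum h_gauss l_gauss hl_indep).
split=> //; rewrite /remainder Gt mulr0.
rewrite (solution_covariance h_gauss l_gauss hl_indep (ltW eps_gt0) u_rv u_sol)//.
by rewrite subrr subr0 mul0r.
Qed.
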